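(* Let $n\ge d$ and let $\mathbf F=(F_1,\dots,F_n):\mathbb R^d\to\mathbb R^n$ have twice differentiable components and Jacobian $\mathbf J$. Suppose that: (i) there are $L,L_2>0$ with $\|\mathbf J(\mathbf x)\|\le L$ and $\|\mathbf J(\mathbf x)-\mathbf J(\mathbf y)\|\le L_2\|\mathbf x-\mathbf y\|$ for all $\mathbf x,\mathbf y\in\mathbb R^d$; (ii) there are $\mathbf x_*\in\mathbb R^d$ and $\mu_*>0$ with $\mathbf J(\mathbf x_* )^\top\mathbf F(\mathbf x_* )=\mathbf 0$ and $\sigma_d(\mathbf J(\mathbf x_* ))\ge\mu_*$; (iii) there is $\rho\ge0$ with $\|\mathbf J(\mathbf x)^\top\mathbf F(\mathbf x)-(\mathbf H(\mathbf x_* )+\mathbf Q(\mathbf x_* ))(\mathbf x-\mathbf x_* )\|\le\rho\|\mathbf x-\mathbf x_*\|^2$ for all $\mathbf x\in\mathbb R^d$; (iv) $\theta:=\|\mathbf H(\mathbf x_* )^{-1/2}\mathbf Q(\mathbf x_* )\mathbf H(\mathbf x_* )^{-1/2}\|\in[0,1)$. Run the RQGN algorithm (see context) with one fixed choice among Options I, II, III and with $\mathbf x_0$ satisfying, for some $c\in(1,1/\theta)$, $$\|\mathbf x_0-\mathbf x_*\|\le\frac{(c-1)\mu_*^2}{4cLL_2}\qquad\text{and}\qquad\lambda_{\mathrm{over}}(\mathbf x_0)\le\frac{(1-\gamma)(1-c\theta)}{10(2-\gamma)\eta_0C_2},$$ where $C_2=C_1+4\tilde c\,dD/(\sqrt{1-c\theta}\,\mu^5)$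 and $\gamma,\tilde c,\mu,D,C_1$ are given in the context. Let $$\nu=\min\Big\{\gamma,\frac{1-c\theta}{2\eta_0}\Big\},\qquad q_{\mathrm{over}}=e^{1/5}\Big(\delta_0+\frac{(1-\gamma)(1-c\theta)}{10(2-\gamma)\eta_0}\Big).$$ Then for all $t\ge0$ $$\mathbb E[\eta_t-1]\le q_{\mathrm{over}}(t+1)(1-\nu)^t\qquad\text{and}\qquad\mathbb E\left[\frac{\lambda_{\mathrm{over}}(\mathbf x_{t+1})}{\lambda_{\mathrm{over}}(\mathbf x_t)}\right]\le c\theta+q_{\mathrm{over}}(t+1)(1-\nu)^t.$$ Moreover, for every $p\in(0,1)$ there exists a non-negative integer $t_0=\mathcal O\big(\log(1+q_{\mathrm{over}}/(p(1-c\theta)\nu^2))/\nu\big)$ such that, with probability at least $1-p$, $$\lambda_{\mathrm{over}}(\mathbf x_{t_0+t})\le\Big(\frac{1+c\theta}2\Big)^t\Big(1-\frac{1-c\theta}{2\eta_0}\Big)^{t_0}\lambda_{\mathrm{over}}(\mathbf x_0)$$ simultaneously for all $t\ge0$.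
   Context: Notation: $\|\cdot\|$ is the Euclidean norm of vectors and the spectral norm of matrices; $\sigma_i(\cdot)$ is the $i$-th largest singular value; $\preceq$ is the Loewner order; $\mathcal O(\cdot)$ hides an absolute constant; $1/\theta=+\infty$ if $\theta=0$. Set $\mathbf H(\mathbf x)=\mathbf J(\mathbf x)^\top\mathbf J(\mathbf x)\in\mathbb R^{d\times d}$, $\mathbf H_t=\mathbf H(\mathbf x_t)$, $\mathbf Q(\mathbf x)=\sum_{i=1}^nF_i(\mathbf x)\nabla^2F_i(\mathbf x)$, $\phi(\mathbf x)=\frac12\|\mathbf F(\mathbf x)\|^2$, $\tilde\nabla^2\phi(\mathbf x)=\mathbf H(\mathbf x)+\mathbf Q(\mathbf x_* )$, and (whenever $\tilde\nabla^2\phi(\mathbf x)$ is positive semidefinite) $\lambda_{\mathrm{over}}(\mathbf x)=\|(\tilde\nabla^2\phi(\mathbf x))^{1/2}(\mathbf x-\mathbf x_* )\|$. Let $\mu=\mu_*/\sqrt2$ and $\Omega_{\mathrm{over}}=\{\mathbf x:\|\mathbf x-\mathbf x_*\|\le\mu_*^2/(4LL_2)\}$ (on which $\sigma_d(\mathbf J(\mathbf x))\ge\mu$). Set $D=L^3L_2+LL_2^2\|\mathbf F(\mathbf x_* )\|$ and $$C_1=\frac{2D}{(1-c\theta)^{3/2}\mu^5}+\Big(\frac{4(1+c\theta)}{(1-c\theta)^{3/2}}+\frac{2c}{c-1}\Big)\frac{LL_2}{\mu^3}+\frac{2\sqrt{1+c\theta}\,\rho}{(1-c\theta)\mu^3}.$$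 Quasi-Newton updates. For symmetric positive definite $\mathbf G,\mathbf H$ and a vector $\mathbf u$: BFGS$(\mathbf G,\mathbf H,\mathbf u)=\mathbf G-\frac{\mathbf G\mathbf u\mathbf u^\top\mathbf G}{\mathbf u^\top\mathbf G\mathbf u}+\frac{\mathbf H\mathbf u\mathbf u^\top\mathbf H}{\mathbf u^\top\mathbf H\mathbf u}$; F-BFGS$(\mathbf G,\mathbf H,\mathbf u)=$ BFGS$(\mathbf G,\mathbf H,\mathbf R^\top\mathbf u)$, where $\mathbf R$ is a square matrix with $\mathbf G^{-1}=\mathbf R^\top\mathbf R$; SR1$(\mathbf G,\mathbf H,\mathbf u)=\mathbf G-\frac{(\mathbf G-\mathbf H)\mathbf u\mathbf u^\top(\mathbf G-\mathbf H)}{\mathbf u^\top(\mathbf G-\mathbf H)\mathbf u}$, interpreted as $\mathbf G$ if $(\mathbf G-\mathbf H)\mathbf u=\mathbf 0$. RQGN algorithm ($n\ge d$). Input: $\mathbf x_0\in\Omega_{\mathrm{over}}$, a symmetric positive definite $\mathbf G_0\in\mathbb R^{d\times d}$ with $\mathbf G_0\succeq\mathbf H_0$, and $M=2LL_2/\mu^2$. For $t=0,1,\dots$: $\mathbf x_{t+1}=\mathbf x_t-\mathbf G_t^{-1}\mathbf J(\mathbf x_t)^\top\mathbf F(\mathbf x_t)$; $r_t=\|\mathbf x_{t+1}-\mathbf x_t\|$; $\widetilde{\mathbf G}_t=(1+Mr_t)\mathbf G_t$; draw $\mathbf u_t\sim\mathcal N(\mathbf 0,\mathbf I_d)$ independently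 of the past; set $\mathbf G_{t+1}$ to be BFGS$(\widetilde{\mathbf G}_t,\mathbf H_{t+1},\mathbf u_t)$ (Option I), F-BFGS$(\widetilde{\mathbf G}_t,\mathbf H_{t+1},\mathbf u_t)$ (Option II, the factor $\mathbf R$ of $\widetilde{\mathbf G}_t$ being determined by $\mathbf u_0,\dots,\mathbf u_{t-1}$), or SR1$(\widetilde{\mathbf G}_t,\mathbf H_{t+1},\mathbf u_t)$ (Option III). Statements about the iterates are understood almost surely. For each $t$, $\eta_t$ is the smallest real $\eta$ with $\mathbf H_t\preceq\mathbf G_t\preceq\eta\mathbf H_t$ (it is part of the theory that $\mathbf H_t\preceq\mathbf G_t$ and $\mathbf H_t\succ\mathbf 0$, so $\eta_t$ is well defined). Constants: Option I: $\gamma=\mu^2/(dL^2)$, $\tilde c=1$, $\delta_0=\mathrm{tr}(\mathbf H_0^{-1}(\mathbf G_0-\mathbf H_0))$. Option II: $\gamma=1/d$, $\tilde c=1$, $\delta_0=\mathrm{tr}(\mathbf H_0^{-1}(\mathbf G_0-\mathbf H_0))$. Option III: $\gamma=1/d$, $\tilde c=L^2/\mu^2$, $\delta_0=\frac{dL^2\,\mathrm{tr}(\mathbf G_0-\mathbf H_0)}{\mu^2\,\mathrm{tr}(\mathbf H_0)}$. The ratio $\lambda_{\mathrm{over}}(\mathbf x_{t+1})/\lambda_{\mathrm{over}}(\mathbf x_t)$ is interpreted as $0$ when $\lambda_{\mathrm{over}}(\mathbf x_t)=0$. *)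

(* Defs.v *)
From HB Require Import structures.
From mathcomp Require Import all_boot all_order all_algebra.
From mathcomp Require Import all_classical all_reals all_analysis.
From mathcomp Require Import measurable_realfun.

Set Implicit Arguments.
Unset Strict Implicit.
Unset Printing Implicit Defensive.
Import Order.TTheory GRing.Theory Num.Theory.
Import numFieldNormedType.Exports.
Local Open Scope classical_set_scope.
Local Open Scope ring_scope.

Section LinearAlgebra.
Context {R : realType}.

(* The library norm on matrices is the sup norm, hence these two. *)
Definition enorm k (v : 'cV[R]_k) : R := Num.sqrt (\sum_i v i 0 ^+ 2).

Definition specnorm m k (A : 'M[R]_(m, k)) : R :=
  sup [set enorm (A *m v) | v in [set v : 'cV[R]_k | enorm v <= 1]].

Definition qform k (A : 'M[R]_k) (v : 'cV[R]_k) : R := (v^T *m A *m v) 0 0.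

Definition psdmx k (A : 'M[R]_k) : Prop :=
  A^T = A /\ forall v, 0 <= qform A v.

Definition pdmx k (A : 'M[R]_k) : Prop :=
  A^T = A /\ forall v, v != 0 -> 0 < qform A v.

Definition loewner k (A B : 'M[R]_k) : Prop := psdmx (B - A).

(* The unique positive semidefinite square root of a positive semidefinite
   matrix (0 if A is not positive semidefinite). *)
Definition sqrtmx k (A : 'M[R]_k) : 'M[R]_k :=
  xget 0 [set S | psdmx S /\ S *m S = A].

(* The k singular values of an m x k matrix (m >= k in the use below), in
   nonincreasing order: the nonnegative square roots of the eigenvalues of
   A^T A, repeated according to algebraic multiplicity. *)
Definition singular_values m k (A : 'M[R]_(m, k)) : seq R :=
  xget [::] [set s : seq R |
    [/\ sorted >=%R s, all (>= 0) s
      & char_poly (A^T *m A) = \prod_(a <- s) ('X - (a ^+ 2)%:P)]].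

(* i is counted from 1: [singular_value A 1] is the largest. *)
Definition singular_value m k (A : 'M[R]_(m, k)) (i : nat) : R :=
  (singular_values A)`_i.-1.

End LinearAlgebra.

Section NonlinearLeastSquares.
Context {R : realType} {n d : nat}.
Variable F : 'cV[R]_d -> 'cV[R]_n.

Definition component (i : 'I_n) (x : 'cV[R]_d) : R := F x i 0.

Definition gradient (f : 'cV[R]_d -> R) (x : 'cV[R]_d) : 'cV[R]_d :=
  \col_j 'D_(delta_mx j 0) f x.

Definition hessian (f : 'cV[R]_d -> R) (x : 'cV[R]_d) : 'M[R]_d :=
  \matrix_(i, j) 'D_(delta_mx j 0) (fun y => gradient f y i 0) x.

Definition twice_differentiable (f : 'cV[R]_d -> R) : Prop :=
  forall x, differentiable f x /\ differentiable (gradient f) x.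

Definition Jac (x : 'cV[R]_d) : 'M[R]_(n, d) :=
  \matrix_(i, j) gradient (component i) x j 0.

Definition gn_hess (x : 'cV[R]_d) : 'M[R]_d := (Jac x)^T *m Jac x.

Definition grad_phi (x : 'cV[R]_d) : 'cV[R]_d := (Jac x)^T *m F x.

Definition Qmx (x : 'cV[R]_d) : 'M[R]_d :=
  \sum_i component i x *: hessian (component i) x.

Definition tilde_hess (xs x : 'cV[R]_d) : 'M[R]_d := gn_hess x + Qmx xs.

(* lambda_over is only defined where [tilde_hess xs x] is positive
   semidefinite; the value +oo elsewhere makes every upper bound on it assert
   that it is defined. *)
Definition lambda_over (xs x : 'cV[R]_d) : \bar R :=
  if `[< psdmx (tilde_hess xs x) >]
  then (enorm (sqrtmx (tilde_hess xs x) *m (x - xs)))%:E else +oo%E.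

End NonlinearLeastSquares.

(* a / b for finite a and b, read as 0 if b = 0; +oo if a or b is undefined. *)
Definition lambda_ratio {R : realType} (a b : \bar R) : \bar R :=
  match a, b with
  | a'%:E, b'%:E => if b' == 0 then 0%E else (a' / b')%:E
  | _, _ => +oo%E
  end.

(* The smallest real e with H <= G <= e H in the Loewner order; +oo if there is
   none. *)
Definition eta {R : realType} k (H G : 'M[R]_k) : \bar R :=
  let S := [set e : R | loewner H G /\ loewner G (e *: H)] in
  xget +oo%E [set e%:E | e in [set e | S e /\ forall e', S e' -> e <= e']].

Section RQGN.
Context {R : realType} {n d : nat}.

(* Division by 0 is 0, so both updates are total; in particular [sr1 G H u] is
   G when (G - H) u = 0. *)
Definition bfgs (G H : 'M[R]_d) (u : 'cV[R]_d) : 'M[R]_d :=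
  G - (qform G u)^-1 *: (G *m u *m u^T *m G)
    + (qform H u)^-1 *: (H *m u *m u^T *m H).

Definition sr1 (G H : 'M[R]_d) (u : 'cV[R]_d) : 'M[R]_d :=
  G - (qform (G - H) u)^-1 *: ((G - H) *m u *m u^T *m (G - H)).

Inductive qn_option := BFGS | FBFGS | SR1.

(* Only FBFGS uses the factor C of G, with G^-1 = C^T C. *)
Definition qn_update (o : qn_option) (G H C : 'M[R]_d) (u : 'cV[R]_d) :=
  match o with
  | BFGS => bfgs G H u
  | FBFGS => bfgs G H (C^T *m u)
  | SR1 => sr1 G H u
  end.

Variables (F : 'cV[R]_d -> 'cV[R]_n) (M : R).

Definition next_x (x : 'cV[R]_d) (G : 'M[R]_d) : 'cV[R]_d :=
  x - invmx G *m grad_phi F x.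

Definition scaled_G (x : 'cV[R]_d) (G : 'M[R]_d) : 'M[R]_d :=
  (1 + M * enorm (next_x x G - x)) *: G.

(* The pair (x_t, G_t) for given realizations C_0, C_1, ... of the factors and
   u_0, u_1, ... of the random directions. *)
Fixpoint rqgn (o : qn_option) (x0 : 'cV[R]_d) (G0 : 'M[R]_d)
    (C : nat -> 'M[R]_d) (u : nat -> 'cV[R]_d) (t : nat) :
    'cV[R]_d * 'M[R]_d :=
  if t is s.+1 then
    let: (x, G) := rqgn o x0 G0 C u s in
    let y := next_x x G in
    (y, qn_update o (scaled_G x G) (gn_hess F y) (C s) (u s))
  else (x0, G0).

End RQGN.

Section Randomness.
Context {R : realType} {disp : measure_display} {T : measurableType disp}.
Variables (P : probability T R) (d : nat) (U : nat -> T -> 'cV[R]_d).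

(* The sigma-algebra generated by the vectors U s with s in D. *)
Definition sigma_of (D : set nat) : set (set T) :=
  <<s [set B | exists s i (A : set R),
        [/\ D s, measurable A & B = (fun w => U s w i 0) @^-1` A]] >>.

Definition past (t : nat) : set (set T) := sigma_of [set s | (s < t)%N].

(* N(0, I_d) is the law of d independent N(0, 1) coordinates; a law on R^d is
   determined by its values on boxes. *)
Definition standard_gaussian (u : T -> 'cV[R]_d) : Prop :=
  (forall i, measurable_fun setT (fun w => u w i 0)) /\
  forall A : 'I_d -> set R, (forall i, measurable (A i)) ->
    P [set w | forall i, A i (u w i 0)] =
    (\prod_i fine (normal_prob 0 1 (A i)))%:E.

Definition gaussian_draws : Prop :=
  forall t, standard_gaussian (U t) /\
    forall B B', past t B -> sigma_of [set t] B' ->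
      P (B `&` B') = (P B * P B')%E.

(* C t is determined, in a Borel measurable way, by U 0, ..., U t.-1. *)
Definition past_measurable (C : nat -> T -> 'M[R]_d) : Prop :=
  forall t i j (A : set R), measurable A ->
    past t ((fun w => C t w i j) @^-1` A).

(* E[X] is defined and at most b. *)
Definition expect_le (X : T -> \bar R) (b : R) : Prop :=
  measurable_fun [set: T] X /\ (\int[P]_w X w <= b%:E)%E.

End Randomness.

(* Main.v *)
From HB Require Import structures.
Require Import Defs.
From mathcomp Require Import all_boot all_order all_algebra.
From mathcomp Require Import all_classical all_reals all_analysis.
From mathcomp Require Import measurable_realfun.
From mathcomp Require Import ring lra perm.
From mathcomp Require spectral sesquilinear complex.

Set Implicit Arguments.
Unset Strict Implicit.
Unset Printing Implicit Defensive.
Import Order.TTheory GRing.Theory Num.Theory.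
Import numFieldNormedType.Exports.
Local Open Scope classical_set_scope.
Local Open Scope ring_scope.

(** The proof has a deterministic and a probabilistic half.

    Deterministic half. Write H for the Gauss-Newton Hessian at x_t, A = H + Q for the
    approximate Hessian, kappa = c theta and lam for lambda_over. On the basin around the
    stationary point (1 - kappa) H <= A <= (1 + kappa) H in the Loewner order, because Q is
    bounded by theta times the Hessian at the stationary point, which in turn is at most
    c H (basin_tilde_ge, basin_tilde_le). If H <= G <= eta H, then G^-1 A is self-adjoint
    for the inner product of A, with spectrum between (1 - kappa) / eta and 1 + kappa, so
    one step of the method contracts the A-norm of the error by 1 - (1 - kappa) / eta, up
    to a remainder that is quadratic in the error (newton_contraction, step_lam). Neither
    the inflation of G by 1 + M r_t nor the updates destroy H <= G, and only the inflation
    and the change of H can increase eta, by a factor of at most (1 + M r_t)^2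
    (qn_update_bounds, scaled_G_ge, scaled_G_le). As lam decays geometrically, the numbers
    M r_t have a sum of at most 1/20, so eta stays below 10/9 of its initial value. This
    closes an induction (rqgn_sound) that holds for all directions whatsoever: the iterates
    stay in the basin, H_t <= G_t, and lam decays at the rate tau = 1 - (1 - kappa) / (2 eta_0).

    Probabilistic half. A trace potential dominates eta - 1 (qform_le_potential). One update
    along u lowers it by at least a Rayleigh quotient u^T B u / |u|^2, where B is determined
    by the past (potential_update). For a standard Gaussian u independent of B the mean of
    this quotient is tr B / d: the mean of u u^T / |u|^2 is the identity divided by d, by
    invariance of the law under sign flips and exchanges of coordinates (mean_rayleigh).
    Since tr B / d is at least gamma times the potential, the mean potential contracts by
    1 - gamma per step, apart from the effect of the inflation, which the deterministic
    decay of lam controls (mean_delta_step); solving this recursion gives the factor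
    (t + 1) (1 - nu)^t in the two expectations (mean_delta_le, expect_eta, expect_ratio).
    The last claim follows from the inequality of Markov and a union bound over all times
    after t_0 (linear_phase), where t_0 is the length after which the tail of the series of
    these expectations is small (burn_in_length).

    Apart from this, the expectations require that the run depends measurably on the
    directions: matrix inverses and the updates are rational in the entries, the Jacobian
    is continuous, and eta is a supremum over rational vectors (measurable_rqgn,
    measurable_eta). *)

(** * Roots of positive semidefinite matrices *)

(** Turns a function given on a finite spectrum into a polynomial in the matrix. *)
Lemma poly_interpolation (F : fieldType) (f : F -> F) (s : seq F) :
  exists p : {poly F}, forall x, x \in s -> p.[x] = f x.
Proof.
elim: s => [|a s [p ps]]; first by exists 0.
have [as_|as_] := boolP (a \in s).
  by exists p => x; rewrite inE => /predU1P[->|]; exact: ps.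
pose q : {poly F} := \prod_(x <- s) ('X - x%:P).
have qs x : x \in s -> q.[x] = 0 by move=> xs; apply/rootP; rewrite root_prod_XsubC.
have qa : q.[a] != 0 by rewrite -/(root q a) root_prod_XsubC.
exists (p + ((f a - p.[a]) / q.[a])%:P * q) => x.
rewrite inE hornerD hornerM hornerC => /predU1P[->|xs].
  by rewrite divfK// addrC subrK.
by rewrite (qs _ xs) mulr0 addr0 ps.
Qed.

Section FourthRoot.
Import spectral sesquilinear complex.

(** Over R[i] the spectral theorem diagonalises A, and its eigenvalues are real. A real
    polynomial interpolating the fourth root on them is then evaluated at A, so that the
    result is real and symmetric by construction. A fourth root is taken, not a square
    root, because the square of a symmetric matrix is visibly positive semidefinite. *)
Lemma symmx_fourth_root (R : realType) n (A : 'M[R]_n) :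
  A^T = A -> (forall a, root (char_poly A) a -> 0 <= a) ->
  exists2 T : 'M[R]_n, T^T = T & (T *m T) *m (T *m T) = A.
Proof.
case: n A => [|n] A AT Aroot.
  by exists 0; apply/matrixP => -[].
pose f : {rmorphism R -> R[i]} := real_complex R.
pose Ac := map_mx f A; pose P := spectralmx Ac; pose D := spectral_diag Ac.
have f_real a : f a \is Num.real by rewrite complex_real.
have Ah : Ac \is hermsymmx.
  apply: realsym_hermsym; last by apply/mxOverP => i j; rewrite mxE f_real.
  apply/is_hermitianmxP; rewrite expr0 scale1r map_mx_id//.
  by rewrite /Ac map_trmx AT.
have P_unit : P \in unitmx := spectral_unit Ac.
have AE : Ac = invmx P *m diag_mx D *m P.
  exact/orthomx_spectralP/hermitian_normalmx.
have D_real i : f (complex.Re (D 0 i)) = D 0 i.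
  by apply: RRe_real; have /mxOverP := hermitian_spectral_diag_real Ah; exact.
pose lam i := complex.Re (D 0 i).
have lam0 i : 0 <= lam i.
  apply: Aroot; rewrite -(fmorph_root f) map_char_poly -/Ac D_real.
  rewrite -eigenvalue_root_char; apply/eigenvalueP; exists (row i P).
    rewrite AE !mulmxA -row_mul mulmxV// row1 -rowE row_diag_mx -scalemxAl.
    by rewrite -rowE.
  apply/negP => /eqP Pi0; have : row i (P *m invmx P) = 0 by rewrite row_mul Pi0 mul0mx.
  rewrite mulmxV// row1 => /matrixP/(_ 0 i)/eqP; rewrite !mxE !eqxx /=.
  by rewrite oner_eq0.
have [p pE] := poly_interpolation (fun x : R => Num.sqrt (Num.sqrt x)) [seq lam i | i : 'I_n.+1].
have pT : (horner_mx A p)^T = horner_mx A p.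
  elim/poly_ind: p {pE} => [|p c IH]; first by rewrite rmorph0 trmx0.
  rewrite rmorphD rmorphM /= horner_mx_X horner_mx_C linearD /= trmx_mul IH AT.
  by rewrite tr_scalar_mx (comm_mx_horner p (erefl (A *m A))).
exists (horner_mx A p) => //.
apply: (map_mx_inj (f := f)); rewrite !map_mxM map_horner_mx -/Ac AE.
rewrite horner_mx_uconjC// horner_mx_diag.
set E := diag_mx (map_mx _ _).
have inP (X Y : 'M[R[i]]_n.+1) : invmx P *m X *m P *m (invmx P *m Y *m P) = invmx P *m (X *m Y) *m P.
  by rewrite !mulmxA mulmxK.
rewrite (inP E E) (inP (E *m E) (E *m E)).
suff -> : E *m E *m (E *m E) = diag_mx D by [].
rewrite /E !mulmx_diag; apply/(congr1 (@diag_mx _ _))/rowP => i; rewrite !mxE.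
rewrite -D_real horner_map -/(lam i) pE; last by apply/mapP; exists i => //; rewrite mem_enum.
set r := Num.sqrt (Num.sqrt (lam i)).
have <- : f (r * r * (r * r)) = f r * f r * (f r * f r) by rewrite !rmorphM.
congr (f _).
by rewrite -!expr2 /r sqr_sqrtr ?sqrtr_ge0// sqr_sqrtr.
Qed.

End FourthRoot.

(** * Quadratic and bilinear forms *)

Section Forms.
Context {R : realType}.
Implicit Types (k m : nat).

Definition bform k (A : 'M[R]_k) (u v : 'cV[R]_k) : R := (u^T *m A *m v) 0 0.

Lemma qformE k (A : 'M[R]_k) v : qform A v = bform A v v. Proof. by []. Qed.

Lemma bformDl k (A : 'M[R]_k) u1 u2 v : bform A (u1 + u2) v = bform A u1 v + bform A u2 v.
Proof. by rewrite /bform linearD !mulmxDl mxE. Qed.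

Lemma bformDr k (A : 'M[R]_k) u v1 v2 : bform A u (v1 + v2) = bform A u v1 + bform A u v2.
Proof. by rewrite /bform mulmxDr mxE. Qed.

Lemma bformZl k (A : 'M[R]_k) a u v : bform A (a *: u) v = a * bform A u v.
Proof. by rewrite /bform linearZ /= -!scalemxAl mxE. Qed.

Lemma bformZr k (A : 'M[R]_k) a u v : bform A u (a *: v) = a * bform A u v.
Proof. by rewrite /bform -!scalemxAr mxE. Qed.

Lemma bformNr k (A : 'M[R]_k) u v : bform A u (- v) = - bform A u v.
Proof. by rewrite -scaleN1r bformZr mulN1r. Qed.

Lemma bformC k (A : 'M[R]_k) u v : A^T = A -> bform A u v = bform A v u.
Proof.
move=> AT; rewrite /bform -[in RHS]AT.
have -> : v^T *m A^T *m u = (u^T *m A *m v)^T by rewrite !trmx_mul trmxK mulmxA.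
by rewrite [RHS]mxE.
Qed.

Lemma bform_mxD k (A B : 'M[R]_k) u v : bform (A + B) u v = bform A u v + bform B u v.
Proof. by rewrite /bform mulmxDr mulmxDl mxE. Qed.

Lemma bform_mxZ k a (A : 'M[R]_k) u v : bform (a *: A) u v = a * bform A u v.
Proof. by rewrite /bform -scalemxAr -scalemxAl mxE. Qed.

Lemma bform_mxN k (A : 'M[R]_k) u v : bform (- A) u v = - bform A u v.
Proof. by rewrite -scaleN1r bform_mxZ mulN1r. Qed.

Lemma bform_mulr k (A B : 'M[R]_k) u v : bform A u (B *m v) = bform (A *m B) u v.
Proof. by rewrite /bform !mulmxA. Qed.

Lemma bform_mull k (A B : 'M[R]_k) u v : bform A (B *m u) v = bform (B^T *m A) u v.
Proof. by rewrite /bform trmx_mul !mulmxA. Qed.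

Lemma qformD k (A B : 'M[R]_k) v : qform (A + B) v = qform A v + qform B v.
Proof. exact: bform_mxD. Qed.

Lemma qformB k (A B : 'M[R]_k) v : qform (A - B) v = qform A v - qform B v.
Proof. by rewrite qformD [qform (- B) v]bform_mxN. Qed.

Lemma qformZ k a (A : 'M[R]_k) v : qform (a *: A) v = a * qform A v.
Proof. exact: bform_mxZ. Qed.

Lemma qform0 k (A : 'M[R]_k) : qform A 0 = 0.
Proof. by rewrite /qform mulmx0 mxE. Qed.

Lemma qform_addv k (A : 'M[R]_k) u v : A^T = A ->
  qform A (u + v) = qform A u + 2 * bform A u v + qform A v.
Proof.
by move=> AT; rewrite !qformE bformDl !bformDr (bformC v u AT); ring.
Qed.

Lemma qform_scale k (A : 'M[R]_k) a v : qform A (a *: v) = a ^+ 2 * qform A v.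
Proof. by rewrite !qformE bformZl bformZr mulrA. Qed.

Lemma qform_congr m k (A : 'M[R]_m) (B : 'M[R]_(m, k)) v :
  qform (B^T *m A *m B) v = qform A (B *m v).
Proof. by rewrite /qform trmx_mul !mulmxA. Qed.

Lemma qform_scalar k a (v : 'cV[R]_k) : qform a%:M v = a * qform 1%:M v.
Proof. by rewrite -qformZ scale_scalar_mx mulr1. Qed.

Lemma qform1E k (v : 'cV[R]_k) : qform 1%:M v = \sum_i v i 0 ^+ 2.
Proof. by rewrite /qform mulmx1 mxE; apply: eq_bigr => i _; rewrite mxE. Qed.

Lemma qform1_ge0 k (v : 'cV[R]_k) : 0 <= qform 1%:M v.
Proof. by rewrite qform1E sumr_ge0// => i _; rewrite sqr_ge0. Qed.

Lemma psd1 k : psdmx (1%:M : 'M[R]_k).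
Proof. by split=> [|v]; rewrite ?tr_scalar_mx ?qform1_ge0. Qed.

Lemma sqr_enorm k (v : 'cV[R]_k) : enorm v ^+ 2 = qform 1%:M v.
Proof. by rewrite /enorm sqr_sqrtr -qform1E ?qform1_ge0. Qed.

Lemma enormE k (v : 'cV[R]_k) : enorm v = Num.sqrt (qform 1%:M v).
Proof. by rewrite qform1E. Qed.

Lemma enorm_ge0 k (v : 'cV[R]_k) : 0 <= enorm v.
Proof. exact: sqrtr_ge0. Qed.

Lemma enorm_eq0 k (v : 'cV[R]_k) : (enorm v == 0) = (v == 0).
Proof.
rewrite /enorm sqrtr_eq0 le_eqVlt [_ < 0]ltNge -qform1E qform1_ge0 orbF qform1E.
rewrite psumr_eq0; last by move=> i _; rewrite sqr_ge0.
apply/idP/idP => [/allP v0|/eqP->]; last by apply/allP => i _; rewrite mxE expr0n eqxx.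
apply/eqP/matrixP => i j; rewrite ord1 !mxE; apply/eqP; rewrite -sqrf_eq0.
by apply: (v0 i); rewrite mem_index_enum.
Qed.

Lemma enorm0 k : enorm (0 : 'cV[R]_k) = 0.
Proof. by apply/eqP; rewrite enorm_eq0. Qed.

Lemma enorm_gt0 k (v : 'cV[R]_k) : (0 < enorm v) = (v != 0).
Proof. by rewrite lt_def enorm_ge0 andbT enorm_eq0. Qed.

Lemma qform1_gt0 k (v : 'cV[R]_k) : (0 < qform 1%:M v) = (v != 0).
Proof. by rewrite -sqr_enorm exprn_even_gt0//= enorm_eq0. Qed.

Lemma enormZ k a (v : 'cV[R]_k) : enorm (a *: v) = `|a| * enorm v.
Proof. by rewrite !enormE qform_scale sqrtrM ?sqr_ge0// sqrtr_sqr. Qed.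

Lemma enormN k (v : 'cV[R]_k) : enorm (- v) = enorm v.
Proof. by rewrite -scaleN1r enormZ normrN1 mul1r. Qed.

(** The quadratic t |-> A(u + t v) is nonnegative. If A vanishes at v it is affine, so its
    slope must vanish; this degenerate case is what the SR1 update needs. *)
Lemma psd_cauchy_schwarz k (A : 'M[R]_k) u v : psdmx A ->
  bform A u v ^+ 2 <= qform A u * qform A v.
Proof.
move=> [AT A0].
have key t : 0 <= qform A u + 2 * t * bform A u v + t ^+ 2 * qform A v.
  have := A0 (u + t *: v); rewrite qform_addv// qform_scale bformZr.
  by rewrite mulrA.
have [qv0|qv0] := eqVneq (qform A v) 0.
  have [->|b0] := eqVneq (bform A u v) 0; first by rewrite qv0 mulr0 expr0n.
  have := key (- (qform A u + 1) / (2 * bform A u v)).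
  rewrite qv0 mulr0 addr0.
  have -> : 2 * (- (qform A u + 1) / (2 * bform A u v)) * bform A u v = - (qform A u + 1).
    by field.
  by rewrite opprD addrA subrr sub0r oppr_ge0 ler10.
have qv : 0 < qform A v by rewrite lt_def qv0 A0.
have := key (- bform A u v / qform A v).
rewrite -[_ <= _ * _]subr_ge0 => /(fun h => mulr_ge0 h (ltW qv)).
set x := (X in 0 <= X -> _).
suff -> : x = qform A u * qform A v - bform A u v ^+ 2 by [].
by rewrite /x; field.
Qed.

Lemma psd_cauchy_schwarz_sqrt k (A : 'M[R]_k) u v : psdmx A ->
  `|bform A u v| <= Num.sqrt (qform A u) * Num.sqrt (qform A v).
Proof.
move=> Ap; have [_ A0] := Ap.
rewrite -sqrtrM// -sqrtr_sqr ler_wsqrtr//; exact: psd_cauchy_schwarz.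
Qed.

Lemma psd_qform0 k (A : 'M[R]_k) v : psdmx A -> qform A v = 0 -> A *m v = 0.
Proof.
move=> Ap v0; have [AT A0] := Ap; apply/eqP.
rewrite -enorm_eq0 -sqrf_eq0 sqr_enorm.
have -> : qform 1%:M (A *m v) = bform A (A *m v) v.
  by rewrite qformE bform_mulr mul1mx.
have := psd_cauchy_schwarz (A *m v) v Ap; rewrite v0 mulr0 => h.
by rewrite -sqrf_eq0 eq_le h sqr_ge0.
Qed.

Lemma psd_seminorm_triangle k (A : 'M[R]_k) u v : psdmx A ->
  Num.sqrt (qform A (u + v)) <= Num.sqrt (qform A u) + Num.sqrt (qform A v).
Proof.
move=> Ap; have [AT A0] := Ap.
rewrite -[leRHS]ger0_norm ?addr_ge0 ?sqrtr_ge0// -sqrtr_sqr ler_wsqrtr//.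
rewrite sqrrD !sqr_sqrtr// qform_addv// lerD2r lerD2l -[leRHS]mulr_natl ler_wpM2l//.
exact: le_trans (ler_norm _) (psd_cauchy_schwarz_sqrt _ _ Ap).
Qed.

Lemma enormD k (u v : 'cV[R]_k) : enorm (u + v) <= enorm u + enorm v.
Proof. by rewrite !enormE psd_seminorm_triangle//; exact: psd1. Qed.

Lemma enormB k (u v : 'cV[R]_k) : enorm (u - v) <= enorm u + enorm v.
Proof. by rewrite -(enormN v) enormD. Qed.

Lemma enorm_cauchy_schwarz k (u v : 'cV[R]_k) : `|bform 1%:M u v| <= enorm u * enorm v.
Proof. by rewrite !enormE psd_cauchy_schwarz_sqrt//; exact: psd1. Qed.

End Forms.

(** * Loewner order, traces and norms *)

Section Loewner.
Context {R : realType}.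
Implicit Types (k m : nat).

Lemma pd_psd k (A : 'M[R]_k) : pdmx A -> psdmx A.
Proof.
move=> [AT A0]; split=> // v; have [->|/A0/ltW//] := eqVneq v 0.
by rewrite qform0.
Qed.

Lemma loewnerE k (A B : 'M[R]_k) : A^T = A -> B^T = B ->
  loewner A B <-> forall v, qform A v <= qform B v.
Proof.
move=> AT BT; split=> [[_ AB] v|AB].
  by rewrite -subr_ge0 -qformB.
split=> [|v]; first by rewrite linearB/= AT BT.
by rewrite qformB subr_ge0.
Qed.

Lemma loewner_qform k (A B : 'M[R]_k) v : loewner A B -> qform A v <= qform B v.
Proof. by move=> [_ /(_ v)]; rewrite qformB subr_ge0. Qed.

Lemma pd_unitmx k (A : 'M[R]_k) : pdmx A -> A \in unitmx.
Proof.
move=> [AT A0]; rewrite -row_free_unit -kermx_eq0; apply/negPn/negP => /rowV0Pn[v].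
move=> /sub_kermxP vA v0; have := A0 v^T; rewrite /qform trmxK vA mul0mx mxE ltxx.
by rewrite trmx_eq0 => /(_ v0).
Qed.

Lemma trmx_invmx_sym k (A : 'M[R]_k) : A^T = A -> (invmx A)^T = invmx A.
Proof. by move=> AT; rewrite trmx_inv AT. Qed.

Lemma qform_invmx k (A : 'M[R]_k) v : A^T = A -> A \in unitmx ->
  qform (invmx A) v = qform A (invmx A *m v).
Proof.
move=> AT Au; rewrite -qform_congr trmx_invmx_sym// mulVmx// mul1mx //.
Qed.

Lemma pd_invmx k (A : 'M[R]_k) : pdmx A -> pdmx (invmx A).
Proof.
move=> Ap; have Au := pd_unitmx Ap; have [AT A0] := Ap.
split=> [|v v0]; first exact: trmx_invmx_sym.
rewrite qform_invmx// A0//; apply: contra_neq v0 => v0.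
by rewrite -(mulKVmx Au v) v0 mulmx0.
Qed.

(** Cauchy-Schwarz for the form A at B^-1 v and A^-1 v. *)
Lemma loewner_invmx k (A B : 'M[R]_k) v : pdmx A -> pdmx B ->
  (forall v, qform A v <= qform B v) -> qform (invmx B) v <= qform (invmx A) v.
Proof.
move=> Ap Bp AB; have Au := pd_unitmx Ap; have Bu := pd_unitmx Bp.
have [AT A0] := Ap; have [BT B0] := Bp.
have [->|v0] := eqVneq v 0; first by rewrite !qform0.
have q0 : 0 < qform (invmx B) v by apply (pd_invmx Bp).2.
have := psd_cauchy_schwarz (invmx B *m v) (invmx A *m v) (pd_psd Ap).
have -> : bform A (invmx B *m v) (invmx A *m v) = qform (invmx B) v.
  by rewrite bform_mulr mulmxV// bform_mull trmx_invmx_sym// mulmx1.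
rewrite -(qform_invmx _ AT Au) => h.
rewrite -(ler_pM2l q0) -expr2 (le_trans h)//.
rewrite ler_wpM2r//; last by rewrite (qform_invmx _ BT Bu).
exact: (pd_psd (pd_invmx Ap)).2.
Qed.

Lemma psd_gram_root k (A : 'M[R]_k) : psdmx A -> exists2 T, psdmx T & T *m T = A.
Proof.
move=> [AT A0]; have [a|T TT TA] := symmx_fourth_root AT.
  rewrite -eigenvalue_root_char => /eigenvalueP[v vA v0].
  have v0' : v^T != 0 by rewrite trmx_eq0.
  have := A0 v^T; rewrite /qform trmxK vA -scalemxAl mxE.
  have -> : (v *m v^T) 0 0 = qform 1%:M v^T by rewrite /qform mulmx1 trmxK.
  by rewrite pmulr_lge0// qform1_gt0.
exists (T *m T) => //; split=> [|v]; first by rewrite trmx_mul TT.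
by rewrite -{1}TT -[T^T]mulmx1 qform_congr qform1_ge0.
Qed.

Lemma sqrtmxP k (A : 'M[R]_k) : psdmx A -> psdmx (sqrtmx A) /\ sqrtmx A *m sqrtmx A = A.
Proof.
by move=> /psd_gram_root[T Tp TA]; rewrite /sqrtmx; case: xgetP => // /(_ T) []; split.
Qed.

Lemma enorm_sqrtmx k (A : 'M[R]_k) v : psdmx A -> enorm (sqrtmx A *m v) = Num.sqrt (qform A v).
Proof.
move=> /sqrtmxP[[ST _] SA]; rewrite enormE -qform_congr.
by rewrite mulmx1 ST SA.
Qed.

Lemma mxtrace_qform k (A : 'M[R]_k) : \tr A = \sum_i qform A (delta_mx i 0).
Proof.
rewrite /mxtrace; apply: eq_bigr => i _; rewrite /qform trmx_delta -rowE -colE.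
by rewrite !mxE.
Qed.

Lemma psd_trace_ge0 k (A : 'M[R]_k) : psdmx A -> 0 <= \tr A.
Proof. by move=> [_ A0]; rewrite mxtrace_qform sumr_ge0. Qed.

Lemma psd_trace_mul_ge0 k (A B : 'M[R]_k) : psdmx A -> psdmx B -> 0 <= \tr (A *m B).
Proof.
move=> /psd_gram_root[T [TT _] <-] [BT B0].
rewrite -mulmxA mxtrace_mulC psd_trace_ge0//; split=> [|v].
  by rewrite !trmx_mul TT BT mulmxA.
by rewrite -{1}TT qform_congr.
Qed.

(** With B = T T and T symmetric, the trace of B is the sum of the squared norms of the
    columns of T, and Cauchy-Schwarz applies to each column. *)
Lemma qform_le_trace k (B : 'M[R]_k) v : psdmx B -> qform B v <= \tr B * qform 1%:M v.
Proof.
move=> /psd_gram_root[T [TT _] TB].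
have qE w : qform B w = \sum_i (bform 1%:M (T *m delta_mx i 0) w) ^+ 2.
  rewrite -TB -{1}TT -[T^T]mulmx1 qform_congr qform1E; apply: eq_bigr => i _.
  rewrite bform_mull TT mulmx1 /bform trmx_delta -mulmxA -rowE.
  by rewrite !mxE.
rewrite qE (_ : \tr B = \sum_i qform 1%:M (T *m delta_mx i 0)); last first.
  rewrite mxtrace_qform; apply: eq_bigr => i _.
  by rewrite -qform_congr TT mulmx1 TB.
rewrite mulr_suml ler_sum// => i _; apply: psd_cauchy_schwarz; exact: psd1.
Qed.

(** H^-1 B is similar to a positive semidefinite matrix, so its trace bounds its largest
    eigenvalue, which is the largest eigenvalue of B relative to H. *)
Lemma qform_le_trace_invmx k (H B : 'M[R]_k) v : pdmx H -> psdmx B ->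
  qform B v <= \tr (invmx H *m B) * qform H v.
Proof.
move=> Hp [BT B0]; have Hu := pd_unitmx Hp.
have [T [TT _] TH] := psd_gram_root (pd_psd Hp).
have Tu : T \in unitmx by move: Hu; rewrite -TH unitmx_mul andbb.
have TiT : (invmx T)^T = invmx T by exact: trmx_invmx_sym.
have Hi : invmx H = invmx T *m invmx T.
  by rewrite -[RHS](mulKmx Hu) -[X in _ *m (X *m _)]TH -mulmxA mulKVmx// mulmxV// mulmx1.
have Cp : psdmx (invmx T *m B *m invmx T).
  split=> [|w]; first by rewrite !trmx_mul TiT BT mulmxA.
  by rewrite -{1}TiT qform_congr.
have := qform_le_trace (T *m v) Cp.
rewrite -{1}TiT qform_congr mulKmx// -qform_congr mulmx1 TT TH.
by rewrite Hi -mulmxA [\tr (_ *m (B *m _))]mxtrace_mulC -!mulmxA mxtrace_mulC mulmxA.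
Qed.

(** Makes the supremum that defines the spectral norm finite; b is the Frobenius norm. *)
Lemma enorm_mulmx_bound m k (A : 'M[R]_(m, k)) :
  exists2 b : R, 0 <= b & forall v, enorm (A *m v) <= b * enorm v.
Proof.
have Bp : psdmx (A^T *m A).
  split=> [|v]; first by rewrite trmx_mul trmxK.
  by rewrite -[A^T]mulmx1 qform_congr qform1_ge0.
exists (Num.sqrt (\tr (A^T *m A))) => [|v]; first exact: sqrtr_ge0.
rewrite !enormE -sqrtrM ?psd_trace_ge0// ler_wsqrtr//.
by rewrite -qform_congr mulmx1 qform_le_trace.
Qed.

Lemma enorm_mulmx_le m k (A : 'M[R]_(m, k)) v : enorm (A *m v) <= specnorm A * enorm v.
Proof.
have [->|v0] := eqVneq v 0; first by rewrite mulmx0 !enorm0 mulr0.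
have v_gt0 : 0 < enorm v by rewrite enorm_gt0.
rewrite -ler_pdivrMr// mulrC -[X in X * _]ger0_norm ?invr_ge0 ?enorm_ge0//.
rewrite -enormZ scalemxAr; apply: sup_upper_bound.
  have [b b0 Ab] := enorm_mulmx_bound A; split; first by exists (enorm (A *m 0)), 0; rewrite //= enorm0.
  exists b => _ [w /= w1 <-]; rewrite (le_trans (Ab w))//.
  by rewrite -[leRHS]mulr1 ler_wpM2l.
exists ((enorm v)^-1 *: v) => //=.
by rewrite enormZ ger0_norm ?invr_ge0 ?enorm_ge0// mulVf// gt_eqF.
Qed.

Lemma specnorm_ge0 m k (A : 'M[R]_(m, k)) : 0 <= specnorm A.
Proof.
have [b b0 Ab] := enorm_mulmx_bound A.
apply: (@le_trans _ _ (enorm (A *m 0))); first exact: enorm_ge0.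
apply: sup_upper_bound; last by exists 0; rewrite //= enorm0.
split; first by exists (enorm (A *m 0)), 0; rewrite //= enorm0.
exists b => _ [w /= w1 <-]; rewrite (le_trans (Ab w))//.
by rewrite -[leRHS]mulr1 ler_wpM2l.
Qed.

Lemma enorm_trmx_mulmx_le m k (A : 'M[R]_(m, k)) w : enorm (A^T *m w) <= specnorm A * enorm w.
Proof.
have [->|v0] := eqVneq (A^T *m w) 0.
  by rewrite enorm0 mulr_ge0 ?specnorm_ge0 ?enorm_ge0.
have v_gt0 : 0 < enorm (A^T *m w) by rewrite enorm_gt0.
rewrite -(ler_pM2r v_gt0) -expr2 sqr_enorm.
have -> : qform 1%:M (A^T *m w) = bform 1%:M w (A *m (A^T *m w)).
  by rewrite /qform /bform !mulmx1 trmx_mul trmxK !mulmxA.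
apply: (le_trans (ler_norm _)); apply: (le_trans (enorm_cauchy_schwarz _ _)).
rewrite mulrC mulrAC ler_wpM2r ?enorm_ge0//.
exact: enorm_mulmx_le.
Qed.

End Loewner.

(** * Quasi-Newton updates *)

Section Updates.
Context {R : realType} {d : nat}.
Implicit Types (A B G H S : 'M[R]_d) (u v : 'cV[R]_d).

Lemma qform_rank1 A u v : A^T = A -> qform (A *m u *m u^T *m A) v = bform A u v ^+ 2.
Proof.
move=> AT; rewrite expr2 -{1}(bformC v u AT) /bform /qform.
rewrite -[v^T *m (_ *m A) *m v]mulmxA -!mulmxA mulmxA.
by rewrite mulmxA [(_ *m (u^T *m _)) 0 0]mxE big_ord1 !mulmxA.
Qed.

Lemma mxtrace_rank1 S A u : A^T = A ->
  \tr (S *m (A *m u *m u^T *m A)) = qform (A *m S *m A) u.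
Proof.
move=> AT; rewrite mulmxA mxtrace_mulC !mulmxA mxtrace_mulC mulmxA.
by rewrite /mxtrace big_ord1 /qform !mulmxA.
Qed.

Lemma bfgs_sym G H u : G^T = G -> H^T = H -> (bfgs G H u)^T = bfgs G H u.
Proof.
by move=> GT HT; rewrite /bfgs !linearD/= linearN/= !linearZ/= !trmx_mul !trmxK GT HT !mulmxA.
Qed.

Lemma sr1_sym G H u : G^T = G -> H^T = H -> (sr1 G H u)^T = sr1 G H u.
Proof.
move=> GT HT; have BT : (G - H)^T = G - H by rewrite linearB/= GT HT.
by rewrite /sr1 linearB/= !linearZ/= !trmx_mul !trmxK BT GT !mulmxA.
Qed.

Lemma qform_bfgs G H u v : G^T = G -> H^T = H ->
  qform (bfgs G H u) v =
  qform G v - (qform G u)^-1 * bform G u v ^+ 2 + (qform H u)^-1 * bform H u v ^+ 2.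
Proof. by move=> GT HT; rewrite /bfgs qformD qformB !qformZ !qform_rank1. Qed.

Lemma qform_sr1 G H u v : G^T = G -> H^T = H ->
  qform (sr1 G H u) v =
  qform G v - (qform (G - H) u)^-1 * bform (G - H) u v ^+ 2.
Proof.
by move=> GT HT; rewrite /sr1 [LHS]qformB qformZ qform_rank1// linearB/= GT HT.
Qed.

(** Deflating a form along u minimises it over the line v + R u. *)
Lemma deflation_le A u v a : psdmx A ->
  qform A v - (qform A u)^-1 * bform A u v ^+ 2 <= qform A (v - a *: u).
Proof.
move=> Ap; have [AT A0] := Ap.
rewrite qform_addv// -[- (a *: u)]scaleNr qform_scale bformZr sqrrN (bformC v u AT).
set b := bform A u v; set q := qform A u.
have [q0|q0] := eqVneq q 0.
  have b0 : b = 0 by rewrite /b (bformC u v AT) /bform -mulmxA (psd_qform0 Ap q0) mulmx0 mxE.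
  by rewrite b0 q0 expr0n/= !mulr0 subr0 !addr0.
have qp : 0 < q by rewrite lt_def q0 A0.
rewrite -subr_ge0 (_ : _ - _ = q^-1 * (a * q - b) ^+ 2); last by field.
by rewrite mulr_ge0 ?invr_ge0 ?sqr_ge0// ltW.
Qed.

Lemma deflation_eq A u v : psdmx A ->
  exists a, qform A v - (qform A u)^-1 * bform A u v ^+ 2 = qform A (v - a *: u).
Proof.
move=> Ap; have [AT A0] := Ap; exists (bform A u v / qform A u).
rewrite qform_addv// -[- (_ *: u)]scaleNr qform_scale bformZr sqrrN (bformC v u AT).
have [q0|q0] := eqVneq (qform A u) 0; last by field.
by rewrite q0 invr0; ring.
Qed.

Lemma deflation_ge0 A u v : psdmx A ->
  0 <= qform A v - (qform A u)^-1 * bform A u v ^+ 2.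
Proof. by move=> Ap; have [a ->] := deflation_eq u v Ap; apply Ap.2. Qed.

(** The deflated G takes at v the value of G at some v - a u, where G is at least H, and H
    there is at least the deflated H at v. *)
Lemma bfgs_ge G H u v : psdmx G -> psdmx H -> (forall w, qform H w <= qform G w) ->
  qform H v <= qform (bfgs G H u) v.
Proof.
move=> Gp Hp HG; rewrite qform_bfgs ?Gp.1 ?Hp.1//.
have [a ->] := deflation_eq u v Gp.
rewrite -lerBlDr; apply: le_trans (HG _); exact: deflation_le.
Qed.

(** The argument for the lower bound with G and e H exchanged; 1 <= e leaves room for the
    rank one term that the update adds. *)
Lemma bfgs_le G H u v e : psdmx G -> psdmx H -> 1 <= e ->
  (forall w, qform G w <= e * qform H w) -> qform (bfgs G H u) v <= e * qform H v.
Proof.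
move=> Gp Hp e1 GH; rewrite qform_bfgs ?Gp.1 ?Hp.1//.
have [a aE] := deflation_eq u v Hp.
apply: (@le_trans _ _ (e * qform H (v - a *: u) + (qform H u)^-1 * bform H u v ^+ 2)).
  by rewrite lerD2r; apply: le_trans (GH _); exact: deflation_le.
rewrite -aE mulrBr -addrA -[leRHS]addr0 lerD2l addrC subr_le0 ler_peMl//.
by rewrite mulr_ge0 ?invr_ge0 ?sqr_ge0//; apply Hp.2.
Qed.

Lemma sr1_ge G H u v : G^T = G -> H^T = H -> psdmx (G - H) ->
  qform H v <= qform (sr1 G H u) v.
Proof.
move=> GT HT Bp; rewrite qform_sr1//.
have := deflation_ge0 u v Bp; rewrite {1}qformB => h.
by rewrite -subr_ge0 (le_trans h)// addrAC.
Qed.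

Lemma sr1_le G H u v : G^T = G -> H^T = H -> psdmx (G - H) ->
  qform (sr1 G H u) v <= qform G v.
Proof.
move=> GT HT Bp; rewrite qform_sr1// lerBlDr lerDl.
by rewrite mulr_ge0 ?invr_ge0 ?sqr_ge0//; apply Bp.2.
Qed.

Lemma mxtrace_invmx_bfgs G H u : G^T = G -> H^T = H -> H \in unitmx ->
  \tr (invmx H *m bfgs G H u) = \tr (invmx H *m G)
    - (qform G u)^-1 * qform (G *m invmx H *m G) u + (qform H u)^-1 * qform H u.
Proof.
move=> GT HT Hu; rewrite /bfgs mulmxDr mulmxBr !linearD/= linearN/=.
by rewrite -!scalemxAr !linearZ/= !mxtrace_rank1// mulmxV// mul1mx.
Qed.

Lemma mxtrace_mulmxBr S A B : \tr (S *m (A - B)) = \tr (S *m A) - \tr (S *m B).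
Proof. by rewrite mulmxBr linearB. Qed.

(** BFGS lowers the trace potential by at least u^T G H^-1 G u / u^T G u - 1, which
    the Cauchy-Schwarz inequality bounds below by u^T (G - H) u / u^T H u. *)
Lemma bfgs_trace_le G H u (a : R) : pdmx G -> pdmx H -> 0 < a ->
  (forall w, qform H w <= qform G w) -> (forall w, qform H w <= a * qform 1%:M w) ->
  \tr (invmx H *m (bfgs G H u - H)) <=
  \tr (invmx H *m (G - H)) - qform (a^-1 *: (G - H)) u / qform 1%:M u.
Proof.
move=> Gp Hp a0 HG Ha; have [GT G0] := Gp; have [HT H0] := Hp; have Hu := pd_unitmx Hp.
rewrite !mxtrace_mulmxBr mxtrace_invmx_bfgs// [leRHS]addrAC lerD2r -addrA lerD2l.
have [->|u0] := eqVneq u 0; first by rewrite !qform0 !mulr0 mul0r addr0 oppr0.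
have qG := G0 u u0; have qH := H0 u u0; have qn : 0 < qform 1%:M u by rewrite qform1_gt0.
rewrite mulVf ?gt_eqF// qformZ qformB addrC -[leRHS]opprK lerNr opprB opprK.
set g := qform G u in qG *; set h := qform H u in qH *; set s := qform 1%:M u in qn *.
set t := qform (G *m _ *m G) u.
have gt : g ^+ 2 <= h * t.
  have := psd_cauchy_schwarz u (invmx H *m (G *m u)) (pd_psd Hp).
  rewrite bform_mulr mulmxV// -qform_invmx//.
  have -> : bform 1%:M u (G *m u) = g by rewrite bform_mulr mul1mx.
  by rewrite -qform_congr GT.
apply: (@le_trans _ _ (g / h - 1)); last first.
  by rewrite lerD2r ler_pdivrMr// -mulrA ler_pdivlMl// -expr2 [t * h]mulrC.
have -> : g / h - 1 = (g - h) / h by field; rewrite gt_eqF.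
rewrite mulrAC [leRHS]mulrC ler_wpM2r ?subr_ge0 ?HG//.
by rewrite -invfM lef_pV2 ?posrE ?mulr_gt0// Ha.
Qed.

(** At v this compares the inverses of H and G at G S^T v. *)
Lemma fbfgs_gain_psd G H S : pdmx G -> pdmx H -> (forall w, qform H w <= qform G w) ->
  psdmx (S *m (G *m invmx H *m G - G) *m S^T).
Proof.
move=> Gp Hp HG; have [GT G0] := Gp; have [HT H0] := Hp; have Hu := pd_unitmx Hp.
have Gu := pd_unitmx Gp.
split=> [|v].
  by rewrite !trmx_mul trmxK linearB/= !trmx_mul GT trmx_invmx_sym// !mulmxA.
rewrite -{1}[S]trmxK qform_congr qformB subr_ge0.
have -> : qform G (S^T *m v) = qform (invmx G) (G *m (S^T *m v)).
  by rewrite -[RHS]qform_congr GT mulmxV// mul1mx.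
by rewrite -[X in qform (X *m _ *m _)]GT [leRHS]qform_congr loewner_invmx.
Qed.

Lemma fbfgs_gain_trace G H S : pdmx G -> pdmx H -> invmx G = S^T *m S ->
  \tr (S *m (G *m invmx H *m G - G) *m S^T) = \tr (invmx H *m (G - H)).
Proof.
move=> Gp Hp GS; have Gu := pd_unitmx Gp; have Hu := pd_unitmx Hp.
rewrite mxtrace_mulC mulmxA -GS !mulmxBr mulVmx// [in RHS]mulVmx//.
by rewrite !linearB/= -!mulmxA mulKmx.
Qed.

(** Along S^T u the form G takes the value |u|^2, so the decrease found for BFGS becomes a
    Rayleigh quotient of a matrix that does not depend on u. *)
Lemma fbfgs_trace_le G H S u : pdmx G -> pdmx H -> invmx G = S^T *m S ->
  (forall w, qform H w <= qform G w) ->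
  \tr (invmx H *m (bfgs G H (S^T *m u) - H)) <=
  \tr (invmx H *m (G - H))
    - qform (S *m (G *m invmx H *m G - G) *m S^T) u / qform 1%:M u.
Proof.
move=> Gp Hp GS HG; have [GT G0] := Gp; have [HT H0] := Hp; have Hu := pd_unitmx Hp.
have Gu := pd_unitmx Gp.
have SS : S^T *m S \in unitmx by rewrite -GS unitmx_inv.
have [STu Su] : S^T \in unitmx /\ S \in unitmx by move: SS; rewrite unitmx_mul => /andP.
have SGS : S *m G *m S^T = 1%:M.
  have -> : G = invmx S *m invmx S^T.
    rewrite -[G]invmxK GS -[RHS](mulKmx SS) -[S^T *m S *m _]mulmxA mulKVmx//.
    by rewrite mulmxV// mulmx1.
  by rewrite mulmxA mulmxV// mul1mx mulVmx.
rewrite !mxtrace_mulmxBr mxtrace_invmx_bfgs// [leRHS]addrAC lerD2r -addrA lerD2l.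
have [->|u0] := eqVneq u 0; first by rewrite mulmx0 !qform0 !mulr0 mul0r addr0 oppr0.
have q1 : qform G (S^T *m u) = qform 1%:M u by rewrite -qform_congr trmxK SGS.
have q2 : qform H (S^T *m u) != 0.
  rewrite gt_eqF// H0//; apply: contra_neq u0 => u0.
  by rewrite -(mulKmx STu u) u0 mulmx0.
have qn : qform 1%:M u != 0 by rewrite gt_eqF// qform1_gt0.
have -> : qform (S *m (G *m invmx H *m G - G) *m S^T) u =
    qform (G *m invmx H *m G) (S^T *m u) - qform 1%:M u.
  by rewrite -{1}[S]trmxK qform_congr qformB q1.
rewrite mulVf// q1 mulrBl divff//.
by rewrite mulrC opprB addrC.
Qed.

(** The trace drops by |B u|^2 / u^T B u with B = G - H; then Cauchy-Schwarz. *)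
Lemma sr1_trace_le G H u : G^T = G -> H^T = H -> psdmx (G - H) ->
  \tr (sr1 G H u - H) <= \tr (G - H) - qform (G - H) u / qform 1%:M u.
Proof.
move=> GT HT Bp; have [BT B0] := Bp.
rewrite /sr1 addrAC [leLHS]linearB/= lerD2l lerN2 linearZ/=.
rewrite -[X in \tr X]mul1mx mxtrace_rank1// mulmx1.
have [->|u0] := eqVneq u 0; first by rewrite !qform0 mul0r mulr0.
have qn : 0 < qform 1%:M u by rewrite qform1_gt0.
have [q0|q0] := eqVneq (qform (G - H) u) 0; first by rewrite q0 mul0r invr0 mul0r.
have qp : 0 < qform (G - H) u by rewrite lt_def q0 B0.
rewrite ler_pdivrMr// mulrAC -mulrA [leRHS]mulrC ler_pdivlMr// -expr2.
have := psd_cauchy_schwarz u ((G - H) *m u) (psd1 d).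
have -> : bform 1%:M u ((G - H) *m u) = qform (G - H) u by rewrite bform_mulr mul1mx.
by rewrite -qform_congr BT mulmx1.
Qed.

Lemma qn_update_bounds (o : qn_option) G H S u (e : R) : pdmx H -> G^T = G -> 1 <= e ->
  (forall v, qform H v <= qform G v) -> (forall v, qform G v <= e * qform H v) ->
  let G' := qn_update o G H S u in
  [/\ G'^T = G', (forall v, qform H v <= qform G' v) & (forall v, qform G' v <= e * qform H v)].
Proof.
move=> Hp GT e1 HG GH; have [HT _] := Hp; have Hpsd := pd_psd Hp.
have Gp : psdmx G by split=> // v; apply: le_trans (HG v); apply Hpsd.2.
have Bp : psdmx (G - H).
  by split=> [|v]; [rewrite linearB/= GT HT|rewrite qformB subr_ge0].
case: o => /=; split=> [|v|v].
- exact: bfgs_sym.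
- exact: bfgs_ge.
- exact: bfgs_le.
- exact: bfgs_sym.
- exact: bfgs_ge.
- exact: bfgs_le.
- exact: sr1_sym.
- exact: sr1_ge.
- by apply: le_trans (GH v); exact: sr1_le.
Qed.

End Updates.

(** * Gauss-Newton Hessians *)

Section GaussNewton.
Context {R : realType} {n d : nat} (F : 'cV[R]_d -> 'cV[R]_n).
Implicit Types (x y z v e : 'cV[R]_d).

Lemma gn_hess_sym y : (gn_hess F y)^T = gn_hess F y.
Proof. by rewrite /gn_hess trmx_mul trmxK. Qed.

Lemma qform_gn_hess y v : qform (gn_hess F y) v = enorm (Jac F y *m v) ^+ 2.
Proof. by rewrite /gn_hess -[(Jac F y)^T]mulmx1 qform_congr sqr_enorm. Qed.

(** Every eigenvalue of J^T J is the square of a listed singular value, and the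
    list is sorted, so the last entry controls the whole quadratic form. *)
Lemma singular_value_qform (J : 'M[R]_(n, d)) (s : R) v : (0 < d)%N -> 0 < s ->
  s <= singular_value J d -> s ^+ 2 * qform 1%:M v <= qform (J^T *m J) v.
Proof.
move=> d0 s0; rewrite /singular_value /singular_values.
case: xgetP => [l _ [lsort lpos lchar] sl|_]; last first.
  by rewrite nth_nil => /(lt_le_trans s0); rewrite ltxx.
have lsize : size l = d.
  have := congr1 (fun p : {poly R} => size p) lchar.
  rewrite size_char_poly (eq_bigr (fun a => 'X - (a ^+ 2)%:P))//.
  by rewrite -(big_map (fun a => a ^+ 2) xpredT (fun a => 'X - a%:P)) size_prod_XsubC size_map => -[].
have sle a : a \in l -> s <= a.
  move=> al; apply: (le_trans sl); rewrite -[leRHS](nth_index 0 al).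
  have il : (index a l < d)%N by rewrite -lsize index_mem.
  apply: (sorted_leq_nth (leT := >=%R)) => //.
  - by move=> x y z xy yz; apply: le_trans yz xy.
  - by move=> x; exact: lexx.
  - by rewrite inE lsize.
  - by rewrite inE lsize ltn_predL.
  - by rewrite -ltnS prednK.
rewrite -subr_ge0 -qform_scalar -qformB.
have BT : (J^T *m J - (s ^+ 2)%:M)^T = J^T *m J - (s ^+ 2)%:M.
  by rewrite linearB/= trmx_mul trmxK tr_scalar_mx.
have [b|T TT <-] := symmx_fourth_root BT.
  rewrite -eigenvalue_root_char => /eigenvalueP[w wB w0].
  have : eigenvalue (J^T *m J) (b + s ^+ 2).
    apply/eigenvalueP; exists w => //.
    by rewrite scalerDl -wB mulmxBr mul_mx_scalar subrK.
  rewrite eigenvalue_root_char lchar -(big_map (fun a => a ^+ 2) xpredT (fun a => 'X - a%:P)).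
  rewrite root_prod_XsubC => /mapP[a al bE].
  rewrite -(lerD2r (s ^+ 2)) add0r bE ler_sqr ?nnegrE ?sle// ltW//.
  exact: lt_le_trans (sle _ al).
rewrite -{1 2}TT -trmx_mul -[(T *m T)^T]mulmx1 qform_congr; exact: qform1_ge0.
Qed.

Context (L L2 : R).
Context (Jac_le : forall y, specnorm (Jac F y) <= L).
Context (Jac_lip : forall y z, specnorm (Jac F y - Jac F z) <= L2 * enorm (y - z)).

Lemma enorm_Jac y v : enorm (Jac F y *m v) <= L * enorm v.
Proof.
apply: (le_trans (enorm_mulmx_le _ _)); rewrite ler_wpM2r ?enorm_ge0//.
Qed.

Lemma enorm_JacB y z v :
  enorm (Jac F y *m v - Jac F z *m v) <= L2 * enorm (y - z) * enorm v.
Proof.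
rewrite -mulmxBl; apply: (le_trans (enorm_mulmx_le _ _)).
by rewrite ler_wpM2r ?enorm_ge0//.
Qed.

Lemma gn_hess_le y v : qform (gn_hess F y) v <= L ^+ 2 * qform 1%:M v.
Proof.
rewrite qform_gn_hess -sqr_enorm -exprMn ler_sqr ?nnegrE ?enorm_ge0 ?enorm_Jac//.
by apply: (le_trans _ (enorm_Jac y v)); exact: enorm_ge0.
Qed.

(** The difference of squares a^2 - b^2 = (a - b) (a + b) with a = |J(y) v|, b = |J(z) v|. *)
Lemma gn_hess_lip y z v :
  qform (gn_hess F y) v <= qform (gn_hess F z) v
                           + 2 * L * L2 * enorm (y - z) * qform 1%:M v.
Proof.
have key (a b l m : R) : 0 <= a -> 0 <= b -> a <= b + l -> 0 <= l -> a <= m -> b <= m ->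
    a ^+ 2 <= b ^+ 2 + 2 * m * l.
  move=> a0 b0 ab l0 am bm; rewrite -lerBlDl subr_sqr mulrC.
  apply: (@le_trans _ _ ((a + b) * l)).
    by apply: ler_wpM2l; [exact: addr_ge0|rewrite lerBlDl].
  by apply: ler_wpM2r => //; rewrite [2 * m]mulr_natl mulr2n lerD.
rewrite !qform_gn_hess -sqr_enorm.
have -> : 2 * L * L2 * enorm (y - z) * enorm v ^+ 2 =
  2 * (L * enorm v) * (L2 * enorm (y - z) * enorm v) by ring.
apply: key; rewrite ?enorm_ge0 ?enorm_Jac//.
  rewrite -lerBlDl; apply: le_trans (enorm_JacB _ _ _).
  by rewrite lerBlDr; apply: le_trans (enormD _ _); rewrite subrK.
exact: le_trans (enorm_ge0 _) (enorm_JacB y z v).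
Qed.

Lemma enorm_gn_hessB y z v : 0 <= L ->
  enorm ((gn_hess F y - gn_hess F z) *m v) <= 2 * L * L2 * enorm (y - z) * enorm v.
Proof.
move=> L0.
have -> : (gn_hess F y - gn_hess F z) *m v =
   (Jac F y)^T *m (Jac F y *m v - Jac F z *m v) + (Jac F y - Jac F z)^T *m (Jac F z *m v).
  rewrite /gn_hess mulmxBr [(Jac F y - Jac F z)^T]linearB/= !mulmxBl !mulmxA.
  by rewrite addrA subrK.
have -> : 2 * L * L2 * enorm (y - z) * enorm v =
  L * (L2 * enorm (y - z) * enorm v) + (L2 * enorm (y - z)) * (L * enorm v) by ring.
apply: (le_trans (enormD _ _)); apply: lerD.
  apply: (le_trans (enorm_trmx_mulmx_le _ _)).
  by apply: ler_pM; rewrite ?specnorm_ge0 ?enorm_ge0 ?enorm_JacB.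
apply: (le_trans (enorm_trmx_mulmx_le _ _)).
by apply: ler_pM; rewrite ?specnorm_ge0 ?enorm_ge0 ?enorm_Jac.
Qed.

End GaussNewton.

(** * Contraction of the preconditioned Newton step *)

Section NewtonStep.
Context {R : realType} {d : nat}.

Let sub_ge_opp (k a b g : R) : k * a <= b -> g <= (1 + k) * a -> - b <= a - g.
Proof. lra. Qed.

Let sub_le_scaled (t a g : R) : t * a <= g -> a - g <= (1 - t) * a.
Proof. lra. Qed.

(** A symmetric form squeezed between -b A and b A has norm at most b for A: polarise
    with the positive semidefinite forms b A - B and b A + B. *)
Lemma sandwiched_form_le (A B : 'M[R]_d) (b : R) (v w : 'cV[R]_d) :
  psdmx A -> B^T = B -> 0 <= b ->
  (forall u, - (b * qform A u) <= qform B u <= b * qform A u) ->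
  `|bform B v w| <= b * Num.sqrt (qform A v) * Num.sqrt (qform A w).
Proof.
move=> [AT A0] BT b0 AB.
have P1 : psdmx (b *: A - B).
  split=> [|u]; first by rewrite linearB/= linearZ/= AT BT.
  by rewrite qformB qformZ subr_ge0; case/andP: (AB u).
have P2 : psdmx (b *: A + B).
  split=> [|u]; first by rewrite linearD/= linearZ/= AT BT.
  by rewrite qformD qformZ -lerBlDl sub0r; case/andP: (AB u).
have := psd_cauchy_schwarz v w P1; have := psd_cauchy_schwarz v w P2.
have := P1.2 v; have := P1.2 w; have := P2.2 v; have := P2.2 w.
rewrite !qformB !qformD !qformZ !bform_mxD bform_mxN !bform_mxZ.
set av := qform A v; set aw := qform A w; set bv := qform B v; set bw := qform B w.
set x := bform B v w; set y := bform A v w.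
have av0 : 0 <= av := A0 v; have aw0 : 0 <= aw := A0 w.
move=> h1 h2 h3 h4 h5 h6.
rewrite -[b * _ * _]ger0_norm ?mulr_ge0 ?sqrtr_ge0//.
rewrite -ler_sqr ?nnegrE// !real_normK ?num_real// !exprMn !sqr_sqrtr//.
rewrite -/av -/aw.
suff key (p q r s t z : R) : 0 <= p -> 0 <= q -> 0 <= r -> 0 <= s ->
    t ^+ 2 <= p * q -> z ^+ 2 <= r * s -> (t - z) ^+ 2 <= (p + r) * (q + s).
  have := key _ _ _ _ _ _ h2 h1 h4 h3 h5 h6.
  have -> : b * y + x - (b * y - x) = 2 * x by ring.
  have -> : (b * av + bv + (b * av - bv)) * (b * aw + bw + (b * aw - bw)) =
     2 ^+ 2 * (b ^+ 2 * av * aw) by ring.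
  by rewrite exprMn ler_pM2l.
move=> p0 q0 r0 s0 tpq zrs.
suff : - (2 * t * z) <= p * s + r * q.
  by move: tpq zrs; clear; lra.
apply: le_trans (ler_norm _) _; rewrite normrN.
rewrite -[leRHS]ger0_norm; last by rewrite addr_ge0 ?mulr_ge0.
rewrite -ler_sqr ?nnegrE// !real_normK ?num_real//.
have h : (t ^+ 2) * (z ^+ 2) <= (p * q) * (r * s) by apply: ler_pM; rewrite ?sqr_ge0.
apply: (@le_trans _ _ (4 * ((p * q) * (r * s)))).
  by rewrite !exprMn -mulrA (_ : 2 ^+ 2 = 4) ?ler_pM2l//; ring.
by rewrite -subr_ge0 (_ : _ - _ = (p * s - r * q) ^+ 2) ?sqr_ge0//; ring.
Qed.

Context (H G A : 'M[R]_d) (kappa mu : R).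
Context (Hp : pdmx H) (Gp : pdmx G) (AT : A^T = A).
Context (k0 : 0 <= kappa) (k1 : kappa < 1) (mu0 : 0 < mu).
Context (mu_le : forall v, mu ^+ 2 * qform 1%:M v <= qform H v).
Context (A_ge : forall v, (1 - kappa) * qform H v <= qform A v).
Context (A_le : forall v, qform A v <= (1 + kappa) * qform H v).
Context (HG : forall v, qform H v <= qform G v).

Let k1' : 0 < 1 - kappa. Proof. by rewrite subr_gt0. Qed.

Lemma tilde_pd : pdmx A.
Proof.
split=> // v v0; apply: lt_le_trans (A_ge v); rewrite mulr_gt0//.
exact: Hp.2.
Qed.

Lemma enorm_le_tilde v :
  Num.sqrt (1 - kappa) * mu * enorm v <= Num.sqrt (qform A v).
Proof.
have mu0' := ltW mu0.
rewrite -[mu]ger0_norm// -sqrtr_sqr enormE.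
rewrite -!sqrtrM ?mulr_ge0 ?sqr_ge0 ?(ltW k1')//.
by rewrite ler_wsqrtr// (le_trans _ (A_ge v))// -mulrA ler_pM2l.
Qed.

(** The preconditioned Newton step contracts the norm of A, since G^-1 A is
    self-adjoint for A with spectrum in [(1 - kappa) / eta, 1 + kappa]. *)
Lemma newton_contraction (eta : R) (e : 'cV[R]_d) : 1 <= eta -> (forall v, qform G v <= eta * qform H v) ->
  Num.sqrt (qform A (e - invmx G *m (A *m e))) <=
  (1 - (1 - kappa) / eta) * Num.sqrt (qform A e).
Proof.
move=> eta1 Geta; have eta0 : 0 < eta by apply: lt_le_trans eta1.
have [_ A0] := tilde_pd; have Ap := pd_psd tilde_pd.
have Gu := pd_unitmx Gp; have [GT G0] := Gp.
pose b : R := 1 - (1 - kappa) / eta; rewrite -/b.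
have kb : kappa <= b.
  by rewrite /b lerBrDl -lerBrDr ler_pdivrMr// ler_peMr// (ltW k1').
have b0 : 0 <= b := le_trans k0 kb.
pose B : 'M[R]_d := A - A *m invmx G *m A.
have BT : B^T = B by rewrite /B linearB/= !trmx_mul AT trmx_invmx_sym// mulmxA.
pose y : 'cV[R]_d := e - invmx G *m (A *m e); rewrite -/y.
have yE v : bform B v e = bform A v y.
  by rewrite /y bformDr bformNr !bform_mulr /B bform_mxD bform_mxN.
have GAA v : qform (A *m invmx G *m A) v = qform G (invmx G *m (A *m v)).
  by rewrite -qform_invmx// -qform_congr AT.
have qAA v : bform A v (invmx G *m (A *m v)) = qform (A *m invmx G *m A) v.
  by rewrite qformE !bform_mulr.
have AB u : - (b * qform A u) <= qform B u <= b * qform A u.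
  have au0 : 0 <= qform A u := Ap.2 u.
  set z := invmx G *m (A *m u); set gz := qform (A *m invmx G *m A) u.
  have gz0 : 0 <= gz by rewrite /gz GAA; exact: (pd_psd Gp).2.
  rewrite qformB -/gz; apply/andP; split.
    have : gz ^+ 2 <= qform A u * ((1 + kappa) * gz).
      have := psd_cauchy_schwarz u z Ap; rewrite qAA -/gz => /le_trans; apply.
      apply: ler_wpM2l => //; apply: (le_trans (A_le _)).
      apply: ler_wpM2l; first by rewrite addr_ge0.
      by apply: (le_trans (HG _)); rewrite /gz GAA.
    move=> h; have {h} : gz <= (1 + kappa) * qform A u.
      have [->|gz1] := eqVneq gz 0; first by rewrite mulr_ge0 ?addr_ge0.
      have gp : 0 < gz by rewrite lt_def gz1.
      by move: h; rewrite mulrCA mulrA expr2 ler_pM2r.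
    have : kappa * qform A u <= b * qform A u by rewrite ler_wpM2r.
    exact: sub_ge_opp.
  have : qform A u ^+ 2 <= (eta / (1 - kappa) * qform A u) * gz.
    have := psd_cauchy_schwarz u z (pd_psd Gp).
    rewrite bform_mulr mulmxV// bform_mulr mul1mx -qformE => /le_trans; apply.
    rewrite /z -GAA -/gz; apply: ler_wpM2r => //; apply: (le_trans (Geta u)).
    rewrite -mulrA ler_pM2l// ler_pdivlMl//; exact: A_ge.
  move=> h; have {h} : (1 - kappa) / eta * qform A u <= gz.
    have [->|a1] := eqVneq (qform A u) 0; first by rewrite mulr0.
    have ap : 0 < qform A u by rewrite lt_def a1.
    move: h; rewrite expr2 mulrAC ler_pM2r// => h.
    rewrite -ler_pdivlMl ?divr_gt0// invf_div; exact: h.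
  exact: sub_le_scaled.
have h := sandwiched_form_le y e Ap BT b0 AB.
have := le_trans (ler_norm _) h; rewrite yE -qformE.
have [->|y0] := eqVneq (qform A y) 0; first by rewrite sqrtr0 => _; rewrite mulr_ge0 ?sqrtr_ge0.
have yp : 0 < Num.sqrt (qform A y) by rewrite sqrtr_gt0 lt_def y0 Ap.2.
rewrite -{1}[qform A y]sqr_sqrtr ?Ap.2// expr2 mulrAC.
by rewrite ler_pM2r.
Qed.

(** A is at most (1 + kappa) G, and the inverse of G is at most that of mu^2. *)
Lemma tilde_precond_le w :
  Num.sqrt (qform A (invmx G *m w)) <= Num.sqrt (1 + kappa) / mu * enorm w.
Proof.
have kp : 0 <= 1 + kappa by rewrite addr_ge0.
have mu2 : pdmx ((mu ^+ 2)%:M : 'M[R]_d).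
  split=> [|v v0]; first by rewrite tr_scalar_mx.
  by rewrite qform_scalar mulr_gt0 ?exprn_gt0 ?qform1_gt0.
have -> : Num.sqrt (1 + kappa) / mu * enorm w = Num.sqrt ((1 + kappa) * (qform 1%:M w / mu ^+ 2)).
  have mu0' := ltW mu0.
  by rewrite sqrtrM// sqrtrM ?qform1_ge0// sqrtrV ?sqr_ge0// sqrtr_sqr ger0_norm// enormE mulrA mulrAC.
rewrite ler_wsqrtr//; apply: (le_trans (A_le _)); apply: ler_wpM2l => //.
apply: (le_trans (HG _)); rewrite -qform_invmx ?Gp.1 ?pd_unitmx//.
apply: le_trans (_ : qform (invmx (mu ^+ 2)%:M) w <= _).
  apply: loewner_invmx => // v; rewrite qform_scalar.
  exact: le_trans (mu_le v) (HG v).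
by rewrite invmx_scalar qform_scalar mulrC.
Qed.

End NewtonStep.

Lemma rqgnS {R : realType} {n d : nat} (F : 'cV[R]_d -> 'cV[R]_n) M o x0 G0 C u t :
  let x := (rqgn F M o x0 G0 C u t).1 in let G := (rqgn F M o x0 G0 C u t).2 in
  let y := next_x F x G in
  rqgn F M o x0 G0 C u t.+1 =
    (y, qn_update o (scaled_G F M x G) (gn_hess F y) (C t) (u t)).
Proof. by rewrite /=; case: rqgn. Qed.

(** * Expectation and independence of bounded random variables *)

Section BoundedRandomVariables.
Context {R : realType} {disp : measure_display} {T : measurableType disp}.
Context (P : probability T R).
Implicit Types X Y : T -> R.

(** Bounded random variables are integrable and closed under the ring operations, which
    removes every integrability side condition from the expectations below. *)
Definition brv X := measurable_fun [set: T] X /\ exists K : R, forall w, `|X w| <= K.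

Lemma brv_integrable X : brv X -> P.-integrable [set: T] (EFin \o X).
Proof.
move=> [mX [K XK]].
apply: (@le_integrable _ _ _ P setT measurableT _ (EFin \o cst `|K|)).
- exact/measurable_EFinP.
- move=> w _ /=; rewrite lee_fin [leRHS]ger0_norm//.
  exact: le_trans (XK w) (ler_norm K).
exact: finite_measure_integrable_cst.
Qed.

Lemma brv_cst r : brv (cst r).
Proof. by split; [exact: measurable_cst|exists `|r|]. Qed.

Lemma brvD X Y : brv X -> brv Y -> brv (fun w => X w + Y w).
Proof.
move=> [mX [K XK]] [mY [K' YK]]; split; first exact: measurable_funD.
by exists (K + K') => w; apply: le_trans (ler_normD _ _) _; exact: lerD.
Qed.

Lemma brvM X Y : brv X -> brv Y -> brv (fun w => X w * Y w).
Proof.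
move=> [mX [K XK]] [mY [K' YK]]; split; first exact: measurable_funM.
by exists (K * K') => w; rewrite normrM ler_pM.
Qed.

Lemma brvZ a X : brv X -> brv (fun w => a * X w).
Proof. by apply: brvM; exact: brv_cst. Qed.

Lemma brvB X Y : brv X -> brv Y -> brv (fun w => X w - Y w).
Proof.
move=> bX bY; have := brvD bX (brvZ (-1) bY).
by congr brv; apply/funext => w /=; rewrite mulN1r.
Qed.

Lemma brv_sum (I : Type) (r : seq I) (X : I -> T -> R) : (forall i, brv (X i)) ->
  brv (fun w => \sum_(i <- r) X i w).
Proof.
move=> bX; elim: r => [|i r IH].
  have := brv_cst 0; congr brv; apply/funext => w /=; by rewrite big_nil.
have := brvD (bX i) IH; congr brv; apply/funext => w /=; by rewrite big_cons.
Qed.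

Definition mean X : R := \int[P]_w X w.

Lemma mean_cst r : mean (cst r) = r.
Proof. by rewrite /mean Rintegral_cst//= probability_setT mulr1. Qed.

Lemma meanD X Y : brv X -> brv Y -> mean (fun w => X w + Y w) = mean X + mean Y.
Proof. by move=> bX bY; rewrite /mean RintegralD//; exact: brv_integrable. Qed.

Lemma meanZ a X : brv X -> mean (fun w => a * X w) = a * mean X.
Proof. by move=> bX; rewrite /mean RintegralZl//; exact: brv_integrable. Qed.

Lemma meanB X Y : brv X -> brv Y -> mean (fun w => X w - Y w) = mean X - mean Y.
Proof. by move=> bX bY; rewrite /mean RintegralB//; exact: brv_integrable. Qed.

Lemma mean_sum (I : Type) (r : seq I) (X : I -> T -> R) : (forall i, brv (X i)) ->
  mean (fun w => \sum_(i <- r) X i w) = \sum_(i <- r) mean (X i).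
Proof.
move=> bX; elim: r => [|i r IH].
  rewrite big_nil -[RHS]mean_cst; congr mean; apply/funext => w; by rewrite big_nil.
rewrite big_cons -IH -meanD//; last exact: brv_sum.
by congr mean; apply/funext => w; rewrite big_cons.
Qed.

Lemma ae_eq_mean X Y : brv X -> brv Y -> {ae P, forall w, X w = Y w} -> mean X = mean Y.
Proof.
move=> [mX _] [mY _] XY; rewrite /mean /Rintegral; congr fine.
apply: ae_eq_integral => //; [exact/measurable_EFinP|exact/measurable_EFinP|].
by apply: filterS XY => w XY _; rewrite XY.
Qed.

Lemma le_mean X Y : brv X -> brv Y -> (forall w, X w <= Y w) -> mean X <= mean Y.
Proof. by move=> bX bY XY; apply: le_Rintegral => //; exact: brv_integrable. Qed.

Lemma ae_le_mean X Y : brv X -> brv Y -> {ae P, forall w, X w <= Y w} -> mean X <= mean Y.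
Proof.
move=> bX bY XY.
have bZ : brv (fun w => Num.max (X w) (Y w)).
  case: bX bY => mX [K XK] [mY [K' YK]]; split; first exact: measurable_maxr.
  exists (Num.max K K') => w; rewrite le_max.
  by case: (leP (X w) (Y w)) => _; rewrite ?XK ?YK ?orbT.
rewrite (@ae_eq_mean Y (fun w => Num.max (X w) (Y w)))//.
  by apply: le_mean => // w; rewrite le_max lexx.
by apply: filterS XY => w XY; rewrite max_r.
Qed.

Lemma mean_ge0 X : brv X -> (forall w, 0 <= X w) -> 0 <= mean X.
Proof. by move=> bX X0; rewrite -[leLHS]mean_cst; apply: le_mean => //; exact: brv_cst. Qed.

Lemma EFin_mean X : brv X -> (\int[P]_w (X w)%:E)%E = (mean X)%:E.
Proof.
move=> bX; rewrite /mean /Rintegral fineK//.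
exact/integrable_fin_num/brv_integrable.
Qed.

Definition indep X Y := forall A B : set R, measurable A -> measurable B ->
  P (X @^-1` A `&` Y @^-1` B) = (P (X @^-1` A) * P (Y @^-1` B))%E.

(** The joint law is the product of the two laws, so that the theorem of Tonelli applies. *)
Let mean_indep_ge0 X Y : brv X -> brv Y -> (forall w, 0 <= X w) -> (forall w, 0 <= Y w) ->
  indep X Y -> mean (fun w => X w * Y w) = mean X * mean Y.
Proof.
move=> bX bY X0 Y0 XY; have [mX _] := bX; have [mY _] := bY.
pose X' : {mfun T >-> R} := HB.pack X (isMeasurableFun.Build _ _ _ _ X mX).
pose Y' : {mfun T >-> R} := HB.pack Y (isMeasurableFun.Build _ _ _ _ Y mY).
have mZ : measurable_fun [set: T] (fun w => (X w, Y w) : R * R).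
  exact: measurable_fun_pair.
pose Z : {mfun T >-> (R * R)%type} :=
  HB.pack (fun w => (X w, Y w)) (isMeasurableFun.Build _ _ _ _ _ mZ).
pose f (z : R * R) : \bar R := (`|z.1| * `|z.2|)%:E.
have mf : measurable_fun [set: _] f.
  apply/measurable_EFinP; apply: measurable_funM.
    by apply: measurableT_comp => //; exact: measurable_fst.
  by apply: measurableT_comp => //; exact: measurable_snd.
have f0 z : (0 <= f z)%E by rewrite lee_fin mulr_ge0.
apply: EFin_inj; rewrite EFinM -!EFin_mean//; last exact: brvM.
transitivity (\int[distribution P Z]_z f z)%E.
  rewrite ge0_integral_distribution//; apply: eq_integral => w _ /=.
  by rewrite /f /= !ger0_norm.
transitivity (\int[product_measure1 (distribution P X') (distribution P Y')]_z f z)%E.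
  apply: eq_measure_integral => A mA _; apply/esym.
  apply: (@product_measure_unique _ _ _ _ _ (distribution P X') (distribution P Y') (distribution P Z)) => //.
rewrite fubini_tonelli1// /fubini_F /f /=.
transitivity (\int[distribution P X']_x ((`|x|)%:E * \int[P]_w (Y w)%:E))%E.
  apply: eq_integral => x _; under eq_integral do rewrite EFinM.
  rewrite ge0_integralZl//; last by apply/measurable_EFinP; exact: normr_measurable.
  congr (_ * _)%E; rewrite ge0_integral_distribution//.
  - by apply: eq_integral => w _ /=; rewrite ger0_norm.
  - by apply/measurable_EFinP; exact: normr_measurable.
rewrite ge0_integralZr//; [|by apply/measurable_EFinP; exact: normr_measurable|
  by apply: integral_ge0 => w _; rewrite lee_fin].
congr (_ * _)%E; rewrite ge0_integral_distribution//.
- by apply: eq_integral => w _ /=; rewrite ger0_norm.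
- by apply/measurable_EFinP; exact: normr_measurable.
Qed.

(** Adding their bounds makes both variables nonnegative. *)
Lemma mean_indep X Y : brv X -> brv Y -> indep X Y ->
  mean (fun w => X w * Y w) = mean X * mean Y.
Proof.
move=> bX bY XY; have [mX [K XK]] := bX; have [mY [K' YK]] := bY.
pose X1 w := X w + K; pose Y1 w := Y w + K'.
have bX1 : brv X1 by apply: brvD => //; exact: brv_cst.
have bY1 : brv Y1 by apply: brvD => //; exact: brv_cst.
have X10 w : 0 <= X1 w by have := XK w; rewrite ler_norml => /andP[+ _]; rewrite -subr_ge0 opprK.
have Y10 w : 0 <= Y1 w by have := YK w; rewrite ler_norml => /andP[+ _]; rewrite -subr_ge0 opprK.
have I1 : indep X1 Y1.
  move=> A B mA mB.
  rewrite (_ : X1 @^-1` A = X @^-1` ((fun x => x + K) @^-1` A))//.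
  rewrite (_ : Y1 @^-1` B = Y @^-1` ((fun x => x + K') @^-1` B))//.
  have msh (a : R) (S : set R) : measurable S -> measurable ((fun x => x + a) @^-1` S).
    move=> mS; rewrite -[_ @^-1` _]setTI.
    by apply: (measurable_funD (@measurable_id _ _ _) (measurable_cst a)).
  by apply: XY; exact: msh.
have := mean_indep_ge0 bX1 bY1 X10 Y10 I1.
have -> : mean X1 = mean X + K by rewrite meanD ?mean_cst//; exact: brv_cst.
have -> : mean Y1 = mean Y + K' by rewrite meanD ?mean_cst//; exact: brv_cst.
have -> : (fun w => X1 w * Y1 w) = (fun w => X w * Y w + (K' * X w + (K * Y w + K * K'))).
  by apply/funext => w; rewrite /X1 /Y1; ring.
have bK : brv (fun w => K * Y w + K * K') by apply: brvD; [exact: brvZ|exact: brv_cst].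
have bK' : brv (fun w => K' * X w + (K * Y w + K * K')) by apply: brvD => //; exact: brvZ.
rewrite meanD//; last exact: brvM.
rewrite meanD//; last exact: brvZ.
rewrite (@meanD _ (cst (K * K'))); [|exact: brvZ|exact: brv_cst].
rewrite mean_cst (meanZ K' bX) (meanZ K bY).
by move: (mean X) (mean Y) (mean _) => a b c; clear; move=> h; lra.
Qed.

End BoundedRandomVariables.

(** * Laws on boxes *)

Section GaussianDirection.
Context {R : realType}.

(** Reflection preserves Lebesgue measure and the even Gaussian density. *)
Lemma normal_prob_opp (A : set R) : measurable A ->
  normal_prob 0 1 (-%R @^-1` A) = normal_prob (0 : R) 1 A.
Proof.
move=> mA.
have mopp : measurable_fun [set: measurableTypeR R] (-%R : measurableTypeR R -> measurableTypeR R).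
  exact: oppr_measurable.
pose opp : {mfun measurableTypeR R >-> measurableTypeR R} :=
  HB.pack (-%R : R -> R) (isMeasurableFun.Build _ _ _ _ _ mopp).
have mpdf : measurable_fun [set: R] (fun x : R => (normal_pdf 0 1 x)%:E).
  by apply/measurable_EFinP; exact: measurable_normal_pdf.
have even x : normal_pdf 0 1 (- x) = normal_pdf (0 : R) 1 x.
  by rewrite normal_pdfE ?oner_neq0// /normal_fun !subr0 sqrrN.
have leb X : measurable X -> lebesgue_measure X = pushforward (@lebesgue_measure R) opp X.
  apply: lebesgue_measure_unique => _ [[a b] /= _ <-].
  rewrite /pushforward /=.
  have -> : -%R @^-1` `]a, b] = [set` `[- b, - a[] :> set R.
    apply/seteqP; split => x /=; rewrite !in_itv/= => /andP[h1 h2].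
      by rewrite lerNl h2 ltrNr h1.
    by rewrite ltrNr h2 lerNl h1.
  rewrite !lebesgue_measure_itv/= !lte_fin ltrN2.
  by case: ifP => // _; rewrite -!EFinB opprK addrC.
rewrite /normal_prob; apply/esym.
transitivity (\int[pushforward (@lebesgue_measure R) opp]_(x in A) (normal_pdf 0 1 x)%:E)%E.
  by apply: eq_measure_integral => X mX _; exact: leb.
rewrite (ge0_integral_pushforward mopp).
- by apply: eq_integral => x _ /=; rewrite even.
- exact: mA.
- exact: measurable_funTS.
- by move=> y _; rewrite lee_fin normal_pdf_ge0.
Qed.

Lemma normal_prob_set1 (a : R) : normal_prob (0 : R) 1 [set a] = 0%E.
Proof.
apply: ((null_content_dominatesP _ _).1 (@normal_prob_dominates R 0 1)) => //.
exact: lebesgue_measure_set1.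
Qed.

Context {d : nat}.

Definition box (A : 'I_d -> set R) : set 'cV[R]_d := [set x | forall i, A i (x i 0)].

Definition boxes : set (set 'cV[R]_d) :=
  [set box A | A in [set A | forall i, measurable (A i)]].

(** Boxes are closed under intersection, so a law on this sigma-algebra is determined by
    the box probabilities, which are all that a standard Gaussian law prescribes. *)
Notation cVm := (g_sigma_algebraType boxes).

Lemma boxes_setI : setI_closed boxes.
Proof.
move=> _ _ [A mA <-] [B mB <-]; exists (fun i => A i `&` B i).
  by move=> i; apply: measurableI.
apply/seteqP; split => x /=; rewrite /box/= => h.
  by split=> i; case: (h i).
by move=> i; split; [exact: h.1|exact: h.2].
Qed.

Lemma measurable_coord (i : 'I_d) : measurable_fun [set: cVm] (fun x : cVm => x i 0).
Proof.
move=> _ A mA; rewrite setTI; apply: sub_sigma_algebra.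
exists (fun j => if j == i then A else setT).
  by move=> j /=; case: ifP.
apply/seteqP; split => x /=; rewrite /box/= => h; first by have := h i; rewrite eqxx.
by move=> j; case: eqP => // ->.
Qed.

Context {disp : measure_display} {T : measurableType disp} (P : probability T R).

Lemma measurable_to_boxes (u : T -> 'cV[R]_d) :
  (forall i, measurable_fun setT (fun w => u w i 0)) ->
  measurable_fun [set: T] (u : T -> cVm).
Proof.
move=> mu; apply: (@measurability _ _ T cVm setT u boxes) => //.
move=> _ [_ [A mA <-] <-]; rewrite setTI.
have -> : u @^-1` box A = \bigcap_(i in [set: 'I_d]) ((fun w => u w i 0) @^-1` A i).
  by apply/seteqP; split => w /= h i => [_|]; exact: h.
apply: fin_bigcap_measurable => // i _.
by rewrite -[_ @^-1` _]setTI; exact: mu.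
Qed.

(** By the pi-lambda theorem, u and v have the same law. *)
Lemma eq_law_mean (u v : T -> 'cV[R]_d) (f : 'cV[R]_d -> R) :
  (forall i, measurable_fun setT (fun w => u w i 0)) ->
  (forall i, measurable_fun setT (fun w => v w i 0)) ->
  (forall A, (forall i, measurable (A i)) -> P (u @^-1` box A) = P (v @^-1` box A)) ->
  measurable_fun [set: cVm] (f : cVm -> R) -> (exists K : R, forall x, `|f x| <= K) ->
  mean P (f \o u) = mean P (f \o v).
Proof.
move=> mu mv uv mf [K fK].
have mu' := measurable_to_boxes mu; have mv' := measurable_to_boxes mv.
pose U : {mfun T >-> cVm} := HB.pack u (isMeasurableFun.Build _ _ _ _ (u : T -> cVm) mu').
pose V : {mfun T >-> cVm} := HB.pack v (isMeasurableFun.Build _ _ _ _ (v : T -> cVm) mv').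
have bf (w : {mfun T >-> cVm}) : P.-integrable [set: T] ((fun x : cVm => (f x)%:E) \o w).
  apply: (brv_integrable P (X := f \o w)); split; last by exists K => x; exact: fK.
  exact: measurableT_comp.
have mf' : measurable_fun [set: cVm] (fun x : cVm => (f x)%:E) by apply/measurable_EFinP.
rewrite /mean /Rintegral; congr fine.
transitivity (\int[distribution P U]_x (f x)%:E)%E.
  by rewrite integral_distribution//; exact: bf.
transitivity (\int[distribution P V]_x (f x)%:E)%E; last first.
  by rewrite integral_distribution//; exact: bf.
apply: eq_measure_integral => A mA _.
apply: (@measure_unique _ _ cVm boxes (fun=> setT) _ _ _ _ (distribution P U) (distribution P V)) => //.
- exact: boxes_setI.
- by move=> _; exists (fun=> setT) => //; apply/seteqP; split.
- by rewrite bigcup_const.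
- by move=> _ [B mB <-]; exact: uv.
- by move=> _; rewrite (le_lt_trans (probability_le1 _ _)) ?ltry.
Qed.

End GaussianDirection.

(** * The direction of a Gaussian vector *)

Section GaussianMoments.
Context {R : realType}.

Lemma measurable_invr : measurable_fun [set: R] (fun x : R => x^-1).
Proof.
have m0 : measurable [set 0 : R] by exact: measurable_set1.
rewrite -(setvU [set 0 : R]); apply/measurable_funU => //; first exact: measurableC.
split; last exact: measurable_fun_set1.
apply: open_continuous_measurable_fun.
  exact/closed_openC/closed_eq.
by move=> x; rewrite inE /= => /eqP x0; exact: inv_continuous.
Qed.

Lemma measurable_funV {disp : measure_display} {T : measurableType disp} (f : T -> R) :
  measurable_fun [set: T] f -> measurable_fun [set: T] (fun w => (f w)^-1).
Proof. by move=> mf; exact: (measurableT_comp measurable_invr). Qed.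

Lemma coord_sqr_le {d : nat} (x : 'cV[R]_d) (i : 'I_d) : x i 0 ^+ 2 <= qform 1%:M x.
Proof.
rewrite qform1E (bigD1 i)//= lerDl sumr_ge0// => j _; exact: sqr_ge0.
Qed.

(** The entries of u u^T / |u|^2, in which every Rayleigh quotient at u is linear. *)
Definition direction {d : nat} (i j : 'I_d) (x : 'cV[R]_d) : R :=
  x i 0 * x j 0 / qform 1%:M x.

Lemma rayleighE {d : nat} (B : 'M[R]_d) (x : 'cV[R]_d) :
  qform B x / qform 1%:M x = \sum_i \sum_j B i j * direction i j x.
Proof.
rewrite {1}/qform mxE mulr_suml exchange_big/=.
apply: eq_bigr => j _; rewrite mxE mulr_suml mulr_suml.
apply: eq_bigr => i _; rewrite mxE /direction; ring.
Qed.

Lemma direction_le1 {d : nat} (i j : 'I_d) (x : 'cV[R]_d) : `|direction i j x| <= 1.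
Proof.
have [x0|x0] := eqVneq (qform 1%:M x) 0; first by rewrite /direction x0 invr0 mulr0 normr0.
have xp : 0 < qform 1%:M x by rewrite lt_def x0 qform1_ge0.
rewrite /direction normrM normfV [`|qform _ _|]gtr0_norm// ler_pdivrMr// mul1r.
rewrite -ler_sqr ?nnegrE ?(ltW xp)// real_normK ?num_real// exprMn expr2.
by rewrite ler_pM ?sqr_ge0 ?coord_sqr_le.
Qed.

Lemma direction_measurable {d : nat} {disp : measure_display} {T : measurableType disp}
    (i j : 'I_d) (u : T -> 'cV[R]_d) :
  (forall i, measurable_fun setT (fun w => u w i 0)) ->
  measurable_fun [set: T] (fun w => direction i j (u w)).
Proof.
move=> mu; apply: measurable_funM; first exact: measurable_funM.
apply: measurable_funV.
under eq_fun do rewrite qform1E.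
by apply: measurable_sum => k; exact: measurable_funX.
Qed.

Context {d : nat}.
Context {disp : measure_display} {T : measurableType disp} (P : probability T R).
Context (u : T -> 'cV[R]_d) (gauss : standard_gaussian P u).

Let mu_coord : forall i, measurable_fun setT (fun w => u w i 0). Proof. exact: gauss.1. Qed.

Let boxE A : (forall i, measurable (A i)) ->
  P (u @^-1` box A) = (\prod_i fine (normal_prob 0 1 (A i)))%:E.
Proof. exact: gauss.2. Qed.

Let direction_law (v : T -> 'cV[R]_d) (i j : 'I_d) :
  (forall i, measurable_fun setT (fun w => v w i 0)) ->
  (forall A, (forall i, measurable (A i)) -> P (v @^-1` box A) =
    (\prod_i fine (normal_prob 0 1 (A i)))%:E) ->
  mean P (fun w => direction i j (u w)) = mean P (fun w => direction i j (v w)).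
Proof.
move=> mv vE; apply: (eq_law_mean (f := direction i j)) => //.
- by move=> A mA; rewrite boxE// vE.
- apply: direction_measurable => k; exact: measurable_coord.
- by exists 1 => x; exact: direction_le1.
Qed.

(** Flipping the sign of coordinate i preserves the law and negates the entry (i, j). *)
Let mean_direction_offdiag (i j : 'I_d) : i != j ->
  mean P (fun w => direction i j (u w)) = 0.
Proof.
move=> ij.
pose v w : 'cV[R]_d := \col_k (if k == i then - u w k 0 else u w k 0).
have mv k : measurable_fun setT (fun w => v w k 0).
  have -> : (fun w => v w k 0) = if k == i then -%R \o (fun w => u w k 0) else fun w => u w k 0.
    by apply/funext => w; rewrite mxE; case: ifP.
  case: ifP => _; last exact: mu_coord.
  by apply: measurableT_comp; [exact: oppr_measurable|exact: mu_coord].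
have vE A : (forall k, measurable (A k)) -> P (v @^-1` box A) =
    (\prod_k fine (normal_prob 0 1 (A k)))%:E.
  move=> mA; pose A' k := if k == i then -%R @^-1` A k else A k.
  have mA' k : measurable (A' k).
    rewrite /A'; case: eqP => // _; rewrite -[_ @^-1` _]setTI.
    exact: oppr_measurable.
  have -> : v @^-1` box A = u @^-1` box A'.
    apply/seteqP; split => w; rewrite /box /A' /= => h k; have := h k;
    by rewrite mxE; case: ifP.
  rewrite boxE//; congr EFin; apply: eq_bigr => k _; rewrite /A'.
  by case: eqP => // _; rewrite normal_prob_opp.
have := direction_law i j mv vE.
have -> : (fun w => direction i j (v w)) = (fun w => (-1) * direction i j (u w)).
  apply/funext => w; rewrite /direction.
  have -> : qform 1%:M (v w) = qform 1%:M (u w).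
    rewrite !qform1E; apply: eq_bigr => k _; rewrite mxE; case: ifP => // _.
    by rewrite sqrrN.
  by rewrite !mxE eqxx eq_sym (negbTE ij) !mulNr mul1r.
rewrite meanZ; last first.
  by split; [exact: direction_measurable|exists 1 => w; exact: direction_le1].
by move=> h; lra.
Qed.

(** Exchanging two coordinates preserves the law. *)
Let mean_direction_diag_eq (i j : 'I_d) :
  mean P (fun w => direction i i (u w)) = mean P (fun w => direction j j (u w)).
Proof.
pose s := tperm i j.
pose v w : 'cV[R]_d := \col_k u w (s k) 0.
have mv k : measurable_fun setT (fun w => v w k 0).
  have -> : (fun w => v w k 0) = fun w => u w (s k) 0 by apply/funext => w; rewrite mxE.
  exact: mu_coord.
have vE A : (forall k, measurable (A k)) -> P (v @^-1` box A) =
    (\prod_k fine (normal_prob 0 1 (A k)))%:E.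
  move=> mA.
  have -> : v @^-1` box A = u @^-1` box (A \o s).
    apply/seteqP; split => w; rewrite /box /= => h k.
      by have := h (s k); rewrite mxE /s tpermK.
    by rewrite mxE; have := h (s k); rewrite /= /s tpermK.
  rewrite boxE; last by move=> k; exact: mA.
  congr EFin.
  by rewrite [RHS](reindex_inj (@perm_inj _ s)).
rewrite (direction_law i i mv vE); congr mean; apply/funext => w.
rewrite /direction.
have -> : qform 1%:M (v w) = qform 1%:M (u w).
  rewrite !qform1E [RHS](reindex_inj (@perm_inj _ s)); apply: eq_bigr => k _.
  by rewrite mxE.
by rewrite !mxE /s tpermL.
Qed.

Let gauss_neq0 : (0 < d)%N -> {ae P, forall w, qform 1%:M (u w) != 0}.
Proof.
move=> d0; pose A (k : 'I_d) : set R := [set 0].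
have mA k : measurable (A k) by exact: measurable_set1.
exists (u @^-1` box A); split.
- have -> : u @^-1` box A = \bigcap_(i in [set: 'I_d]) ((fun w => u w i 0) @^-1` A i).
    by apply/seteqP; split => w /= h i => [_|]; exact: h.
  apply: fin_bigcap_measurable => // i _.
  by rewrite -[_ @^-1` _]setTI; exact: mu_coord.
- rewrite boxE// (bigD1 (Ordinal d0))//= /A normal_prob_set1/=.
  by rewrite mul0r.
move=> w /= /negP; rewrite negbK => /eqP w0 k; rewrite /A /=.
have := coord_sqr_le (u w) k; rewrite w0 => h.
by apply/eqP; rewrite -sqrf_eq0 eq_le h sqr_ge0.
Qed.

(** The d diagonal entries have equal means, and they almost surely sum to 1. *)
Lemma mean_direction (i j : 'I_d) :
  mean P (fun w => direction i j (u w)) = (i == j)%:R / d%:R.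
Proof.
have [<-|ij] := eqVneq i j; last by rewrite mean_direction_offdiag// mul0r.
have d0 : (0 < d)%N by apply: leq_ltn_trans (ltn_ord i).
have bd k : brv (fun w => direction k k (u w)).
  by split; [exact: direction_measurable|exists 1 => w; exact: direction_le1].
apply/eqP; rewrite eq_sym -(inj_eq (mulIf (_ : d%:R != 0)))//; last by rewrite pnatr_eq0 -lt0n.
rewrite divfK ?pnatr_eq0 -?lt0n// mulr_natr.
have -> : mean P (fun w => direction i i (u w)) *+ d =
    \sum_(k < d) mean P (fun w => direction k k (u w)).
  rewrite (eq_bigr (fun=> mean P (fun w => direction i i (u w)))).
    by rewrite sumr_const card_ord.
  by move=> k _; exact: mean_direction_diag_eq.
rewrite -mean_sum// eq_sym -[X in _ == X](mean_cst P); apply/eqP.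
apply: ae_eq_mean; [exact: brv_sum|exact: brv_cst|].
apply: filterS (gauss_neq0 d0) => w w0.
rewrite /cst /= -(divff w0) /direction -mulr_suml; congr (_ / _).
by rewrite qform1E; apply: eq_bigr => k _; rewrite expr2.
Qed.

(** The mean of u u^T / |u|^2 is the identity divided by d, and independence factors out
    the entries of B. *)
Lemma mean_rayleigh (B : T -> 'M[R]_d) : (forall i j, brv (fun w => B w i j)) ->
  (forall i j, indep P (fun w => B w i j) (fun w => direction i j (u w))) ->
  mean P (fun w => qform (B w) (u w) / qform 1%:M (u w)) = mean P (fun w => \tr (B w)) / d%:R.
Proof.
move=> bB iB.
have bd i j : brv (fun w => direction i j (u w)).
  by split; [exact: direction_measurable|exists 1 => w; exact: direction_le1].
have -> : (fun w => qform (B w) (u w) / qform 1%:M (u w)) =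
    (fun w => \sum_i \sum_j B w i j * direction i j (u w)).
  by apply/funext => w; exact: rayleighE.
rewrite mean_sum; last by move=> i; apply: brv_sum => j; exact: brvM.
rewrite /mxtrace mean_sum// mulr_suml; apply: eq_bigr => i _.
rewrite mean_sum; last by move=> j; exact: brvM.
rewrite (bigD1 i)//= big1 ?addr0 => [|j ji]; rewrite mean_indep// mean_direction.
  by rewrite eqxx mul1r.
by rewrite eq_sym (negbTE ji) mul0r mulr0.
Qed.

End GaussianMoments.

(** * Measurability of matrix-valued maps *)

Section MatrixMeasurability.
Context {R : realType} {disp : measure_display} {T : measurableType disp}.

Definition mx_measurable m k (A : T -> 'M[R]_(m, k)) :=
  forall i j, measurable_fun [set: T] (fun w => A w i j).

Lemma mx_measurable_cst m k (A : 'M[R]_(m, k)) : mx_measurable (cst A).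
Proof. by move=> i j; exact: measurable_cst. Qed.

Lemma mx_measurableD m k (A B : T -> 'M[R]_(m, k)) : mx_measurable A -> mx_measurable B ->
  mx_measurable (fun w => A w + B w).
Proof.
move=> mA mB i j; have := measurable_funD (mA i j) (mB i j).
by congr measurable_fun; apply/funext => w /=; rewrite mxE.
Qed.

Lemma mx_measurableZ m k (a : T -> R) (A : T -> 'M[R]_(m, k)) :
  measurable_fun [set: T] a -> mx_measurable A -> mx_measurable (fun w => a w *: A w).
Proof.
move=> ma mA i j; have := measurable_funM ma (mA i j).
by congr measurable_fun; apply/funext => w /=; rewrite mxE.
Qed.

Lemma mx_measurableN m k (A : T -> 'M[R]_(m, k)) : mx_measurable A ->
  mx_measurable (fun w => - A w).
Proof.
move=> /(mx_measurableZ (measurable_cst (-1 : R))) mA i j; have := mA i j.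
by congr measurable_fun; apply/funext => w; rewrite scaleN1r.
Qed.

Lemma mx_measurableB m k (A B : T -> 'M[R]_(m, k)) : mx_measurable A -> mx_measurable B ->
  mx_measurable (fun w => A w - B w).
Proof. by move=> mA mB; apply: mx_measurableD => //; exact: mx_measurableN. Qed.

Lemma mx_measurable_tr m k (A : T -> 'M[R]_(m, k)) : mx_measurable A ->
  mx_measurable (fun w => (A w)^T).
Proof.
by move=> mA i j; have := mA j i; congr measurable_fun; apply/funext => w; rewrite mxE.
Qed.

Lemma mx_measurableM m k l (A : T -> 'M[R]_(m, k)) (B : T -> 'M[R]_(k, l)) :
  mx_measurable A -> mx_measurable B -> mx_measurable (fun w => A w *m B w).
Proof.
move=> mA mB i j.
have := @measurable_sum _ T R setT _ (index_enum 'I_k) (fun q w => A w i q * B w q j)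
  (fun q => measurable_funM (mA i q) (mB q j)).
by congr measurable_fun; apply/funext => w; rewrite mxE.
Qed.

Lemma measurable_qform k (A : T -> 'M[R]_k) (v : T -> 'cV[R]_k) :
  mx_measurable A -> mx_measurable v -> measurable_fun [set: T] (fun w => qform (A w) (v w)).
Proof.
move=> mA mv; apply: (mx_measurableM (mx_measurableM (mx_measurable_tr mv) mA) mv).
Qed.

Lemma measurable_mxtrace k (A : T -> 'M[R]_k) : mx_measurable A ->
  measurable_fun [set: T] (fun w => \tr (A w)).
Proof. by move=> mA; apply: measurable_sum => i; exact: mA. Qed.

Lemma measurable_fun_prod (I : Type) (r : seq I) (f : I -> T -> R) :
  (forall i, measurable_fun [set: T] (f i)) ->
  measurable_fun [set: T] (fun w => \prod_(i <- r) f i w).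
Proof.
move=> mf; elim: r => [|i r IH].
  by under eq_fun do rewrite big_nil; exact: measurable_cst.
by under eq_fun do rewrite big_cons; exact: measurable_funM.
Qed.

Lemma measurable_det k (A : T -> 'M[R]_k) : mx_measurable A ->
  measurable_fun [set: T] (fun w => \det (A w)).
Proof.
move=> mA; apply: measurable_sum => s; apply: measurable_funM.
  exact: measurable_cst.
by apply: measurable_fun_prod => i; exact: mA.
Qed.

Lemma mx_measurableV k (A : T -> 'M[R]_k) : (forall w, A w \in unitmx) ->
  mx_measurable A -> mx_measurable (fun w => invmx (A w)).
Proof.
move=> Au mA.
have mdet := measurable_funV (measurable_det mA).
have madj : mx_measurable (fun w => \adj (A w)).
  move=> i j; under eq_fun do rewrite mxE /cofactor.
  apply: measurable_funM; first exact: measurable_cst.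
  apply: measurable_det => a b; under eq_fun do rewrite !mxE.
  exact: mA.
move=> i j; have := mx_measurableZ mdet madj i j.
by congr measurable_fun; apply/funext => w; rewrite /invmx Au.
Qed.

Lemma measurable_sqrt (f : T -> R) : measurable_fun [set: T] f ->
  measurable_fun [set: T] (fun w => Num.sqrt (f w)).
Proof.
move=> mf; apply: (measurableT_comp _ mf).
by apply: continuous_measurable_fun; exact: sqrt_continuous.
Qed.

Lemma measurable_enorm k (v : T -> 'cV[R]_k) : mx_measurable v ->
  measurable_fun [set: T] (fun w => enorm (v w)).
Proof.
move=> mv; under eq_fun do rewrite enormE.
by apply/measurable_sqrt/measurable_qform => //; exact: mx_measurable_cst.
Qed.

Lemma rational_point_near k (x : 'cV[R]_k) (e : R) : 0 < e ->
  exists q : 'cV[rat]_k, forall i, `|x i 0 - ratr (q i 0)| < e.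
Proof.
move=> e0.
have h i : exists q : rat, `|x i 0 - ratr q| < e.
  have [q] : exists q : rat, ratr q \in `](x i 0 - e), (x i 0 + e)[.
    by apply: rat_in_itvoo; rewrite ltrD2l gtrN.
  rewrite in_itv /= => /andP[h1 h2]; exists q.
  by rewrite ltr_distlC h1 h2.
have [q qP] := choice h.
by exists (\col_i q i) => i; rewrite mxE.
Qed.

Lemma open_rational_box k (U : set 'cV[R]_k) (x : 'cV[R]_k) : open U -> U x ->
  exists q : 'cV[rat]_k, exists N : nat,
   (forall i, `|x i 0 - ratr (q i 0)| < N.+1%:R^-1) /\
   (forall y : 'cV[R]_k, (forall i, `|y i 0 - ratr (q i 0)| < N.+1%:R^-1) -> U y).
Proof.
move=> oU Ux; have /nbhs_ballP[e /= e0 eU] := open_nbhs_nbhs (conj oU Ux).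
have [N] : exists N : nat, N.+1%:R^-1 < e / 2.
  have := @near_infty_natSinv_lt R (PosNum (divr_gt0 e0 (ltr0Sn _ 1))).
  by move=> [N _ h]; exists N; exact: (h N (leqnn N)).
move=> Ne; have N0 : 0 < (N.+1%:R^-1 : R) by rewrite invr_gt0.
have [q qx] := rational_point_near x N0.
exists q, N; split=> // y qy; apply: eU; split => // i j; rewrite ord1.
rewrite /ball /= (le_lt_trans (ler_distD (ratr (q i 0)) _ _))//.
rewrite (splitr e) ltrD// ?(lt_trans (qx i))//.
by rewrite distrC (lt_trans (qy i)).
Qed.

(** An open set is a countable union of boxes with rational centres and sizes. *)
Lemma measurable_open_preimage k (X : T -> 'cV[R]_k) (U : set 'cV[R]_k) :
  mx_measurable X -> open U -> measurable (X @^-1` U).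
Proof.
move=> mX oU.
pose bx (p : 'cV[rat]_k * nat) : set 'cV[R]_k :=
  [set y | forall i, `|y i 0 - ratr (p.1 i 0)| < p.2.+1%:R^-1].
pose F p : set T := if `[< bx p `<=` U >] then X @^-1` bx p else set0.
have -> : X @^-1` U = \bigcup_p F p.
  apply/seteqP; split => w /= => [Uw|[p _]]; last first.
    by rewrite /F; case: asboolP => // pU; exact: pU.
  have [q [N [h1 h2]]] := open_rational_box oU Uw.
  by exists (q, N) => //; rewrite /F; case: asboolP.
apply: countable_bigcupT_measurable => [|p]; first exact: countableP.
rewrite /F; case: asboolP => _ //.
have -> : X @^-1` bx p = \bigcap_(i in [set: 'I_k])
    ((fun w => `|X w i 0 - ratr (p.1 i 0)|) @^-1` [set` `]-oo, (p.2.+1%:R^-1 : R)[ ]).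
  by apply/seteqP; split => w /= h i => [_|]; have := h i; rewrite /= in_itv/=; [|apply].
apply: fin_bigcap_measurable => // i _.
rewrite -[_ @^-1` _]setTI; apply: (measurableT_comp (@normr_measurable R setT)) => //.
by apply: measurable_funB; [exact: mX|exact: measurable_cst].
Qed.

Lemma measurable_continuous k (X : T -> 'cV[R]_k) (f : 'cV[R]_k -> R) :
  mx_measurable X -> continuous f -> measurable_fun [set: T] (fun w => f (X w)).
Proof.
move=> mX cf; apply: (measurability _ (RGenOInfty.measurableE R)) => //.
move=> _ [_ [a ->] <-]; rewrite setTI.
apply: (measurable_open_preimage (U := f @^-1` [set` `]a, +oo[ ])) => //.
apply: open_comp; last exact: itv_open_ends_open.
by move=> x _; exact: cf.
Qed.

End MatrixMeasurability.

(** * The smallest Loewner factor *)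

Section Eta.
Context {R : realType}.

Lemma continuous_sum (V : topologicalType) (I : Type) (r : seq I) (f : I -> V -> R) :
  (forall i, continuous (f i)) -> continuous (fun v => \sum_(i <- r) f i v).
Proof.
move=> cf; elim: r => [|i r IH].
  rewrite (_ : (fun v => _) = cst 0); first by move=> v; exact: cvg_cst.
  by apply/funext => v; rewrite big_nil.
rewrite (_ : (fun v => _) = (fun v => f i v + \sum_(j <- r) f j v)).
  by move=> v; apply: cvgD; [exact: cf|exact: IH].
by apply/funext => v; rewrite big_cons.
Qed.

Lemma continuous_qform k (B : 'M[R]_k) : continuous (fun v : 'cV[R]_k => qform B v).
Proof.
have -> : (fun v : 'cV[R]_k => qform B v) =
    (fun v => \sum_i \sum_j v j 0 * (B j i * v i 0)).
  apply/funext => v; rewrite /qform mxE; apply: eq_bigr => i _.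
  rewrite mxE mulr_suml; apply: eq_bigr => j _; by rewrite mxE mulrA.
have cj q : continuous (fun v : 'cV[R]_k => v q 0) by exact: coord_continuous.
apply: continuous_sum => i; apply: continuous_sum => j v.
exact: (continuousM (cj j v) (continuousM (@cst_continuous _ _ (B j i) v) (cj i v))).
Qed.

(** The infimum of the admissible factors is itself admissible, because each vector gives a
    closed condition; it is at least 1 because some vector is nonzero. *)
Lemma etaP k (H G : 'M[R]_k) (b : R) : (0 < k)%N -> pdmx H -> G^T = G ->
  (forall v, qform H v <= qform G v) -> (forall v, qform G v <= b * qform H v) ->
  [/\ eta H G = (fine (eta H G))%:E, 1 <= fine (eta H G),
      (forall v, qform G v <= fine (eta H G) * qform H v)
    & forall e, (forall v, qform G v <= e * qform H v) -> fine (eta H G) <= e].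
Proof.
move=> k0 Hp GT HG Gb; have [HT Hpos] := Hp.
set S := [set e : R | loewner H G /\ loewner G (e *: H)].
have SE e : S e <-> forall v, qform G v <= e * qform H v.
  split=> [[_ h] v|h]; first by rewrite -qformZ; exact: loewner_qform.
  by split; apply/loewnerE => // [|v]; rewrite ?linearZ/= ?HT// qformZ.
pose v0 : 'cV[R]_k := delta_mx (Ordinal k0) 0.
have v0_neq0 : v0 != 0.
  by apply/eqP => /matrixP/(_ (Ordinal k0) 0)/eqP; rewrite !mxE !eqxx oner_eq0.
have S1 e : S e -> 1 <= e.
  move=> /SE/(_ v0) h; have q0 := Hpos _ v0_neq0.
  by rewrite -(ler_pM2r q0) mul1r; apply: le_trans h; exact: HG.
have Sinf : has_inf S by split; [exists b; apply/SE|exists 1 => e /S1].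
pose m := inf S.
have mS : S m.
  apply/SE => v; have [->|vn0] := eqVneq v 0; first by rewrite !qform0 mulr0.
  have qv := Hpos _ vn0; rewrite -ler_pdivrMr//.
  apply: lb_le_inf; first by case: Sinf.
  by move=> e /SE h; rewrite ler_pdivrMr.
have mmin e : S e -> m <= e by move=> Se; apply: ge_inf => //; case: Sinf.
have etaE : eta H G = m%:E.
  rewrite /eta -/S; case: xgetP => [_ -> [e [Se emin] <-]|].
    by congr EFin; apply/eqP; rewrite eq_le emin// mmin.
  by move=> /(_ m%:E) /= []; exists m.
rewrite etaE /=; split=> // [|v|e /SE/mmin//]; first exact: S1.
by move/SE: mS; exact.
Qed.

Context {disp : measure_display} {T : measurableType disp}.

(** The factor exceeds a iff G - a H is positive at some vector, hence, by continuity, at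
    one of the countably many rational vectors. *)
Lemma measurable_eta k (H G : T -> 'M[R]_k) (b : R) : (0 < k)%N ->
  (forall w, pdmx (H w)) -> (forall w, (G w)^T = G w) ->
  (forall w v, qform (H w) v <= qform (G w) v) ->
  (forall w v, qform (G w) v <= b * qform (H w) v) ->
  mx_measurable H -> mx_measurable G ->
  measurable_fun [set: T] (fun w => fine (eta (H w) (G w))).
Proof.
move=> k0 Hp GT HG Gb mH mG.
apply: (measurability _ (RGenOInfty.measurableE R)) => //.
move=> _ [_ [a ->] <-]; rewrite setTI.
have -> : (fun w => fine (eta (H w) (G w))) @^-1` [set` `]a, +oo[ ] =
    \bigcup_(q : 'cV[rat]_k) ((fun w => qform (G w - a *: H w) (map_mx ratr q))
       @^-1` [set` `]0, +oo[ ]).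
  apply/seteqP; split => w /=; rewrite in_itv/= andbT.
    have [_ _ _ emin] := etaP k0 (Hp w) (GT w) (HG w) (Gb w).
    move=> ae; have [v av] : exists v, 0 < qform (G w - a *: H w) v.
      apply/not_existsP => nv; move: ae; rewrite ltNge => /negP; apply.
      apply: emin => v; have := nv v => /negP; rewrite -leNgt.
      by rewrite qformB qformZ subr_le0.
    have oU : open [set v | 0 < qform (G w - a *: H w) v].
      rewrite (_ : [set _ | _] = (fun v => qform (G w - a *: H w) v) @^-1` [set` `]0, +oo[ ]).
        apply: open_comp; last exact: itv_open_ends_open.
        by move=> x _; exact: continuous_qform.
      by apply/seteqP; split => x /=; rewrite in_itv/= andbT.
    have [q [N [_ qU]]] := open_rational_box oU av.
    exists q => //=; rewrite in_itv/= andbT; apply: qU => i.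
    by rewrite mxE subrr normr0 invr_gt0.
  move=> [q _ /=]; rewrite in_itv/= andbT qformB qformZ subr_gt0 => aq.
  have [_ _ eG _] := etaP k0 (Hp w) (GT w) (HG w) (Gb w).
  have := lt_le_trans aq (eG (map_mx ratr q)).
  have := (pd_psd (Hp w)).2 (map_mx ratr q); rewrite le_eqVlt => /predU1P[<-|q0].
    by rewrite !mulr0 ltxx.
  by rewrite ltr_pM2r.
apply: countable_bigcupT_measurable => [|q]; first exact: countableP.
rewrite -[_ @^-1` _]setTI; apply: measurable_qform => //.
apply: mx_measurableB => //; apply: mx_measurableZ => //; exact: measurable_cst.
Qed.

End Eta.

(** * Measurability of the run *)

Section RunMeasurability.
Context {R : realType} {n d : nat} (F : 'cV[R]_d -> 'cV[R]_n).
Context (F_diff : forall i, twice_differentiable (component F i)).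

Lemma measurable_F {disp : measure_display} {T : measurableType disp} (x : T -> 'cV[R]_d) :
  mx_measurable x -> mx_measurable (fun w => F (x w)).
Proof.
move=> mx i j; rewrite ord1; apply: (measurable_continuous (f := component F i)) => // v.
exact/differentiable_continuous/(F_diff i v).1.
Qed.

Lemma measurable_Jac {disp : measure_display} {T : measurableType disp} (x : T -> 'cV[R]_d) :
  mx_measurable x -> mx_measurable (fun w => Jac F (x w)).
Proof.
move=> mx i j.
have -> : (fun w => Jac F (x w) i j) = (fun w => gradient (component F i) (x w) j 0).
  by apply/funext => w; rewrite mxE.
apply: (measurable_continuous (f := fun v => gradient (component F i) v j 0)) => // v.
have cg : {for v, continuous (gradient (component F i))}.
  exact/differentiable_continuous/(F_diff i v).2.
have cj : continuous (fun v : 'cV[R]_d => v j 0) by exact: coord_continuous.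
exact: (@continuous_comp _ _ _ (gradient (component F i)) (fun v : 'cV[R]_d => v j 0) v cg (cj _)).
Qed.

Lemma measurable_gn_hess {disp : measure_display} {T : measurableType disp} (x : T -> 'cV[R]_d) :
  mx_measurable x -> mx_measurable (fun w => gn_hess F (x w)).
Proof.
by move=> mx; apply: mx_measurableM; [apply: mx_measurable_tr|]; exact: measurable_Jac.
Qed.

Lemma measurable_next_x {disp : measure_display} {T : measurableType disp}
    (x : T -> 'cV[R]_d) (G : T -> 'M[R]_d) : (forall w, G w \in unitmx) ->
  mx_measurable x -> mx_measurable G -> mx_measurable (fun w => next_x F (x w) (G w)).
Proof.
move=> Gu mx mG; apply: mx_measurableB => //; apply: mx_measurableM.
  exact: mx_measurableV.
by apply: mx_measurableM; [apply: mx_measurable_tr; exact: measurable_Jac|exact: measurable_F].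
Qed.

Lemma measurable_scaled_G {disp : measure_display} {T : measurableType disp} (M : R)
    (x : T -> 'cV[R]_d) (G : T -> 'M[R]_d) : (forall w, G w \in unitmx) ->
  mx_measurable x -> mx_measurable G -> mx_measurable (fun w => scaled_G F M (x w) (G w)).
Proof.
move=> Gu mx mG; apply: mx_measurableZ => //.
apply: measurable_funD; first exact: measurable_cst.
apply: measurable_funM; first exact: measurable_cst.
by apply: measurable_enorm; apply: mx_measurableB => //; exact: measurable_next_x.
Qed.

Lemma measurable_bfgs {disp : measure_display} {T : measurableType disp}
    (G H : T -> 'M[R]_d) (u : T -> 'cV[R]_d) :
  mx_measurable G -> mx_measurable H -> mx_measurable u ->
  mx_measurable (fun w => bfgs (G w) (H w) (u w)).
Proof.
move=> mG mH mu.
have rank1 (A : T -> 'M[R]_d) : mx_measurable A -> mx_measurable (fun w =>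
    (qform (A w) (u w))^-1 *: (A w *m u w *m (u w)^T *m A w)).
  move=> mA; apply: mx_measurableZ; first exact/measurable_funV/measurable_qform.
  apply: mx_measurableM => //; apply: mx_measurableM; last exact: mx_measurable_tr.
  exact: mx_measurableM.
by apply: mx_measurableD; [apply: mx_measurableB => //|]; exact: rank1.
Qed.

Lemma measurable_sr1 {disp : measure_display} {T : measurableType disp}
    (G H : T -> 'M[R]_d) (u : T -> 'cV[R]_d) :
  mx_measurable G -> mx_measurable H -> mx_measurable u ->
  mx_measurable (fun w => sr1 (G w) (H w) (u w)).
Proof.
move=> mG mH mu; have mB := mx_measurableB mG mH.
apply: mx_measurableB => //; apply: mx_measurableZ; first exact/measurable_funV/measurable_qform.
apply: mx_measurableM => //; apply: mx_measurableM; last exact: mx_measurable_tr.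
exact: mx_measurableM.
Qed.

Lemma measurable_qn_update {disp : measure_display} {T : measurableType disp} (o : qn_option)
    (G H S : T -> 'M[R]_d) (u : T -> 'cV[R]_d) :
  mx_measurable G -> mx_measurable H -> mx_measurable u -> (o = FBFGS -> mx_measurable S) ->
  mx_measurable (fun w => qn_update o (G w) (H w) (S w) (u w)).
Proof.
move=> mG mH mu; case: o => mS /=; [exact: measurable_bfgs| |exact: measurable_sr1].
apply: measurable_bfgs => //; apply: mx_measurableM => //.
exact/mx_measurable_tr/mS.
Qed.

Lemma measurable_rqgn {disp : measure_display} {T : measurableType disp} (M : R)
    (o : qn_option) (x0 : 'cV[R]_d) (G0 : 'M[R]_d)
    (C : nat -> T -> 'M[R]_d) (u : nat -> T -> 'cV[R]_d) (t : nat) :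
  (forall s w, (rqgn F M o x0 G0 (C ^~ w) (u ^~ w) s).2 \in unitmx) ->
  (forall s, (s < t)%N -> mx_measurable (u s)) ->
  (o = FBFGS -> forall s, (s < t)%N -> mx_measurable (C s)) ->
  mx_measurable (fun w => (rqgn F M o x0 G0 (C ^~ w) (u ^~ w) t).1) /\
  mx_measurable (fun w => (rqgn F M o x0 G0 (C ^~ w) (u ^~ w) t).2).
Proof.
move=> Gu; elim: t => [|t IH] mu mC; first by split; exact: mx_measurable_cst.
have [|oF s st|mx mG] := IH; first by move=> s st; apply: mu; exact: ltnW.
  by apply: mC => //; exact: ltnW.
have rS w := rqgnS F M o x0 G0 (C ^~ w) (u ^~ w) t.
have my := measurable_next_x (Gu t) mx mG.
split; first by move: my; congr mx_measurable; apply/funext => w; rewrite rS.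
have := @measurable_qn_update _ _ o _ _ (C t) (u t)
  (measurable_scaled_G M (Gu t) mx mG) (measurable_gn_hess my) (mu t (ltnSn t)).
have mCt : o = FBFGS -> mx_measurable (C t) by move=> oF; apply: mC.
by move=> /(_ mCt); congr mx_measurable; apply/funext => w; rewrite rS.
Qed.

End RunMeasurability.

(** * Information carried by the past directions *)
Section Past.
Context {R : realType} {disp : measure_display} {T : measurableType disp}.
Context (P : probability T R) {d : nat} (U : nat -> T -> 'cV[R]_d).

(** Measurability on this copy of the sample space says that a variable depends only on
    the directions indexed by D. *)
Definition info (D : set nat) := g_sigma_algebraType
  [set B | exists s i (A : set R), [/\ D s, measurable A & B = (fun w : T => U s w i 0) @^-1` A]].

Lemma info_direction (D : set nat) s : D s -> mx_measurable (U s : info D -> 'cV[R]_d).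
Proof.
move=> Ds i j _ A mA; rewrite setTI ord1; apply: sub_sigma_algebra.
by exists s, i, A.
Qed.

Lemma info_preimage (D : set nat) (X : T -> R) (A : set R) :
  measurable_fun [set: info D] (X : info D -> R) -> measurable A -> sigma_of U D (X @^-1` A).
Proof. by move=> mX mA; rewrite -[X @^-1` A]setTI; exact: mX. Qed.

Lemma sigma_of_measurable (D : set nat) : (forall s, mx_measurable (U s)) ->
  sigma_of U D `<=` measurable.
Proof.
move=> mU; apply: smallest_sub; first exact: sigma_algebra_measurable.
move=> _ [s [i [A [Ds mA ->]]]]; rewrite -[_ @^-1` _]setTI; exact: mU.
Qed.

Lemma sub_sigma_of (D D' : set nat) : D `<=` D' -> sigma_of U D `<=` sigma_of U D'.
Proof.
move=> DD; apply: sub_sigma_algebra2 => _ [s [i [A [Ds mA ->]]]].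
by exists s, i, A; split => //; exact: DD.
Qed.

Lemma info_measurable (D : set nat) (X : T -> R) : (forall s, mx_measurable (U s)) ->
  measurable_fun [set: info D] (X : info D -> R) -> measurable_fun [set: T] X.
Proof.
move=> mU mX _ A mA; apply: (sigma_of_measurable mU).
by rewrite setTI; exact: info_preimage mX mA.
Qed.

Context (draws : gaussian_draws P U).

Lemma draws_measurable s : mx_measurable (U s).
Proof. by move=> i j; rewrite ord1; apply: (draws s).1.1. Qed.

Lemma past_indep t (X : T -> R) i j :
  measurable_fun [set: info [set s | (s < t)%N]] (X : info [set s | (s < t)%N] -> R) ->
  indep P X (fun w => direction i j (U t w)).
Proof.
move=> mX A B mA mB; apply: (draws t).2.
  exact: (info_preimage mX mA).
apply: (info_preimage _ mB); apply: direction_measurable => k.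
exact: info_direction.
Qed.

End Past.

(** * Trace potentials *)

Section Potential.
Context {R : realType} {d : nat}.
Implicit Types (G H S B : 'M[R]_d).

(** Unlike the Loewner factor, a trace is linear in G, so its mean after an update can be
    bounded. The weight in the SR1 case makes the potential dominate the Loewner factor
    minus 1, as the trace of H^-1 (G - H) does. *)
Definition potential (o : qn_option) (L mu : R) H G : R :=
  match o with
  | SR1 => d%:R * L ^+ 2 * \tr (G - H) / (mu ^+ 2 * \tr H)
  | _ => \tr (invmx H *m (G - H))
  end.

(** The guaranteed relative decrease of the potential, on average over the direction. *)
Definition rate (o : qn_option) (L mu : R) : R :=
  match o with BFGS => mu ^+ 2 / (d%:R * L ^+ 2) | _ => d%:R^-1 end.

(** The price of moving to the next Hessian, relative to its price for BFGS. *)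
Definition cost (o : qn_option) (L mu : R) : R :=
  match o with SR1 => L ^+ 2 / mu ^+ 2 | _ => 1 end.

(** The potential decreases by at least the Rayleigh quotient of this matrix at u. *)
Definition gain (o : qn_option) (L mu : R) H G S : 'M[R]_d :=
  match o with
  | BFGS => (L ^+ 2)^-1 *: (G - H)
  | FBFGS => S *m (G *m invmx H *m G - G) *m S^T
  | SR1 => (d%:R * L ^+ 2 / (mu ^+ 2 * \tr H)) *: (G - H)
  end.

Context (L mu : R) (mu_gt0 : 0 < mu) (L_gt0 : 0 < L) (d_gt0 : (0 < d)%N).

Definition well_conditioned H : Prop :=
  [/\ H^T = H, (forall v, mu ^+ 2 * qform 1%:M v <= qform H v)
    & (forall v, qform H v <= L ^+ 2 * qform 1%:M v)].

Let musq_gt0 : 0 < mu ^+ 2. Proof. exact: exprn_gt0. Qed.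
Let Lsq_gt0 : 0 < L ^+ 2. Proof. exact: exprn_gt0. Qed.
Let L_ge0 : 0 <= L. Proof. exact: ltW. Qed.
Let mu_ge0 : 0 <= mu. Proof. exact: ltW. Qed.
Let dR : 0 < d%:R :> R. Proof. by rewrite ltr0n. Qed.

Lemma well_conditioned_pd H : well_conditioned H -> pdmx H.
Proof.
by move=> [HT Hmu _]; split=> // v v0; apply: lt_le_trans (Hmu v); rewrite mulr_gt0 ?qform1_gt0.
Qed.

Lemma le_mxtrace B B' : (forall v, qform B v <= qform B' v) -> \tr B <= \tr B'.
Proof. by move=> BB; rewrite !mxtrace_qform; apply: ler_sum => i _; exact: BB. Qed.

Lemma well_conditioned_trace_le H : well_conditioned H -> \tr H <= d%:R * L ^+ 2.
Proof.
move=> [_ _ HL].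
apply: (@le_trans _ _ (\tr ((L ^+ 2)%:M : 'M[R]_d))).
  by apply: le_mxtrace => v; rewrite qform_scalar.
by rewrite mxtrace_scalar mulr_natl.
Qed.

Lemma well_conditioned_trace_gt0 H : well_conditioned H -> 0 < \tr H.
Proof.
move=> [_ Hmu _]; apply: (@lt_le_trans _ _ (\tr ((mu ^+ 2)%:M : 'M[R]_d))).
  by rewrite mxtrace_scalar -mulr_natl mulr_gt0.
by apply: le_mxtrace => v; rewrite qform_scalar.
Qed.

Let psdB H G : H^T = H -> G^T = G -> (forall v, qform H v <= qform G v) -> psdmx (G - H).
Proof.
move=> HT GT HG; split=> [|v]; first by rewrite linearB/= GT HT.
by rewrite qformB subr_ge0.
Qed.

Lemma potential_ge0 o H G : well_conditioned H -> G^T = G ->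
  (forall v, qform H v <= qform G v) -> 0 <= potential o L mu H G.
Proof.
move=> Hw GT HG; have [HT _ _] := Hw; have Hp := well_conditioned_pd Hw.
have Bp := psdB HT GT HG; have h1 := psd_trace_mul_ge0 (pd_psd (pd_invmx Hp)) Bp.
have Hpsd := pd_psd Hp.
by case: o => //=; rewrite divr_ge0 ?mulr_ge0 ?psd_trace_ge0.
Qed.

Lemma qform_le_potential o H G v : well_conditioned H -> G^T = G ->
  (forall v, qform H v <= qform G v) ->
  qform G v <= (1 + potential o L mu H G) * qform H v.
Proof.
move=> Hw GT HG; have [HT Hmu _] := Hw; have Hp := well_conditioned_pd Hw.
have Bp := psdB HT GT HG; have trH := well_conditioned_trace_gt0 Hw.
rewrite mulrDl mul1r -lerBlDl -qformB.
have h1 := qform_le_trace_invmx v Hp Bp.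
case: o => //=; apply: (le_trans (qform_le_trace v Bp)).
apply: (@le_trans _ _ (\tr (G - H) / mu ^+ 2 * qform H v)).
  by rewrite -mulrA ler_wpM2l ?psd_trace_ge0// ler_pdivlMl.
apply: ler_wpM2r; first exact: (pd_psd Hp).2.
rewrite [leRHS](_ : _ = \tr (G - H) / mu ^+ 2 * (d%:R * L ^+ 2 / \tr H)); last first.
  by field; rewrite (gt_eqF trH) (gt_eqF mu_gt0).
rewrite ler_peMr ?divr_ge0 ?psd_trace_ge0 ?exprn_ge0//.
by rewrite ler_pdivlMr// mul1r well_conditioned_trace_le.
Qed.

Let inflation_le (r s : R) : 0 <= r -> 0 <= s ->
  (1 + r) ^+ 2 * (s + 1) - 1 <= (1 + r) ^+ 2 * (s + 2 * r).
Proof.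
move=> r0 s0; rewrite -subr_ge0 (_ : _ - _ = 3 * r ^+ 2 + 2 * r ^+ 3); last by ring.
by rewrite addr_ge0// mulr_ge0// exprn_ge0.
Qed.

(** The inflation of G and the change of Hessian cost a factor 1 + r each; the additive
    term pays for the subtracted H, which is not inflated. *)
Lemma potential_scaled o H H' G (r : R) : well_conditioned H -> well_conditioned H' -> G^T = G ->
  (forall v, qform H v <= qform G v) -> 0 <= r ->
  (forall v, qform H v <= (1 + r) * qform H' v) ->
  potential o L mu H' ((1 + r) *: G) <=
  (1 + r) ^+ 2 * (potential o L mu H G + 2 * d%:R * cost o L mu * r).
Proof.
move=> Hw Hw' GT HG r0 HH'; have Hp := well_conditioned_pd Hw; have Hp' := well_conditioned_pd Hw'.
have r1 : 0 < 1 + r by rewrite ltr_pwDl.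
have [HT _ _] := Hw; have [HT' _ _] := Hw'.
have Gp : psdmx G by split=> // v; apply: le_trans (HG v); apply (pd_psd Hp).2.
have Bp := psdB HT GT HG.
have I1 : \tr (invmx H' *m ((1 + r) *: G - H')) <=
    (1 + r) ^+ 2 * (\tr (invmx H *m (G - H)) + 2 * d%:R * 1 * r).
  have tr1 (X : 'M[R]_d) : pdmx X -> \tr (invmx X *m X) = d%:R.
    by move=> Xp; rewrite mulVmx ?pd_unitmx// mxtrace1.
  rewrite !mxtrace_mulmxBr !tr1// -scalemxAr mxtraceZ.
  set a := \tr (invmx H' *m G); set b := \tr (invmx H *m G).
  have ab : a <= (1 + r) * b.
    rewrite -subr_ge0 (_ : _ - _ = \tr (((1 + r) *: invmx H - invmx H') *m G)); last first.
      by rewrite mulmxBl linearB/= -scalemxAl mxtraceZ.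
    apply: psd_trace_mul_ge0 => //; apply: psdB; first exact: trmx_invmx_sym.
      by rewrite linearZ/= trmx_invmx_sym.
    move=> v; rewrite qformZ.
    have Zp : pdmx ((1 + r)^-1 *: H).
      split=> [|w w0]; first by rewrite linearZ/= HT.
      by rewrite qformZ mulr_gt0 ?invr_gt0// Hp.2.
    have := loewner_invmx v Zp Hp' (fun w => _).
    rewrite invmxZ ?pd_unitmx// ?unitfE ?invr_eq0 ?gt_eqF// invrK qformZ; apply => w.
    by rewrite qformZ ler_pdivrMl.
  have b0 : 0 <= b - d%:R.
    by rewrite -(tr1 _ Hp) -mxtrace_mulmxBr psd_trace_mul_ge0//; exact/pd_psd/pd_invmx.
  have bd0 : 0 <= (b - d%:R) / d%:R by rewrite divr_ge0.
  apply: (@le_trans _ _ ((1 + r) ^+ 2 * b - d%:R)).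
    by rewrite lerD2r expr2 -mulrA ler_wpM2l// ltW.
  have := inflation_le r0 bd0; rewrite -(ler_pM2l dR).
  rewrite (_ : d%:R * _ = (1 + r) ^+ 2 * b - d%:R); last by field; rewrite gt_eqF.
  by rewrite (_ : d%:R * _ = (1 + r) ^+ 2 * (b - d%:R + 2 * d%:R * 1 * r)) //; field; rewrite gt_eqF.
case: o => //=.
have tH := well_conditioned_trace_gt0 Hw; have tH' := well_conditioned_trace_gt0 Hw'.
set K := d%:R * L ^+ 2; have K0 : 0 < K by rewrite mulr_gt0.
rewrite !linearB/= mxtraceZ.
have Hpsd := pd_psd Hp.
have s0 : 0 <= \tr (G - H) / \tr H by rewrite divr_ge0 ?psd_trace_ge0.
have tHH : \tr H <= (1 + r) * \tr H'.
  by rewrite -mxtraceZ; apply: le_mxtrace => v; rewrite qformZ.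
have h : ((1 + r) * \tr G - \tr H') / \tr H' <= (1 + r) ^+ 2 * (\tr (G - H) / \tr H + 2 * r).
  apply: le_trans (inflation_le r0 s0); rewrite mulrBl divff ?gt_eqF// lerD2r.
  rewrite linearB/= mulrBl divff ?gt_eqF// subrK expr2 -!mulrA ler_pM2l//.
  rewrite mulrCA ler_wpM2l ?psd_trace_ge0// mulrC.
  by rewrite ler_pdivlMl// ler_pdivrMr.
have : K / mu ^+ 2 * (((1 + r) * \tr G - \tr H') / \tr H') <=
  K / mu ^+ 2 * ((1 + r) ^+ 2 * (\tr (G - H) / \tr H + 2 * r)).
  by rewrite ler_pM2l ?divr_gt0.
rewrite linearB/=.
rewrite (_ : K / mu ^+ 2 * (_ / \tr H') = K * ((1 + r) * \tr G - \tr H') / (mu ^+ 2 * \tr H')); last first.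
  by field; rewrite (gt_eqF tH') (gt_eqF mu_gt0).
move/le_trans; apply; rewrite le_eqVlt; apply/orP; left; apply/eqP.
by rewrite /K; field; rewrite (gt_eqF tH) (gt_eqF mu_gt0).
Qed.

Lemma potential_update o H G S u : well_conditioned H -> pdmx G ->
  (forall v, qform H v <= qform G v) -> (o = FBFGS -> invmx G = S^T *m S) ->
  potential o L mu H (qn_update o G H S u) <=
  potential o L mu H G - qform (gain o L mu H G S) u / qform 1%:M u.
Proof.
move=> Hw Gp HG; have Hp := well_conditioned_pd Hw; have [HT _ HL] := Hw; have [GT _] := Gp.
case: o => GS /=.
- exact: bfgs_trace_le.
- by apply: fbfgs_trace_le => //; exact: GS.
have tH := well_conditioned_trace_gt0 Hw.
have K0 : 0 < d%:R * L ^+ 2 / (mu ^+ 2 * \tr H) by rewrite divr_gt0 ?mulr_gt0.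
rewrite qformZ; set K := d%:R * L ^+ 2; set z := mu ^+ 2 * \tr H.
rewrite [K * _ / z]mulrAC [K * \tr (G - H) / z]mulrAC -[K / z * _ / _]mulrA -mulrBr ler_pM2l//.
exact: sr1_trace_le (psdB HT GT HG).
Qed.

Lemma gain_psd o H G S : well_conditioned H -> pdmx G ->
  (forall v, qform H v <= qform G v) -> psdmx (gain o L mu H G S).
Proof.
move=> Hw Gp HG; have Hp := well_conditioned_pd Hw; have [HT _ HL] := Hw; have [GT _] := Gp.
have [BT B0] := psdB HT GT HG; have tH := well_conditioned_trace_gt0 Hw.
case: o => /=; last 1 first.
- by split=> [|v]; rewrite ?linearZ/= ?BT// qformZ mulr_ge0// ltW// divr_gt0 ?mulr_gt0.
- by split=> [|v]; rewrite ?linearZ/= ?BT// qformZ mulr_ge0// invr_ge0 ltW.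
- exact: fbfgs_gain_psd.
Qed.

(** By the mean of the Rayleigh quotient, the right-hand side is the average decrease of the
    potential. *)
Lemma gain_trace_ge o H G S : well_conditioned H -> pdmx G ->
  (forall v, qform H v <= qform G v) -> (o = FBFGS -> invmx G = S^T *m S) ->
  rate o L mu * potential o L mu H G <= \tr (gain o L mu H G S) / d%:R.
Proof.
move=> Hw Gp HG; have Hp := well_conditioned_pd Hw; have [HT Hmu HL] := Hw; have [GT _] := Gp.
have Bp := psdB HT GT HG; have tH := well_conditioned_trace_gt0 Hw.
case: o => GS /=; rewrite ?mxtraceZ.
- suff h : mu ^+ 2 * \tr (invmx H *m (G - H)) <= \tr (G - H).
    have gL := gt_eqF L_gt0; have gd := gt_eqF dR.
    rewrite (_ : _ * \tr (invmx H *m _) = (d%:R * L ^+ 2)^-1 * (mu ^+ 2 * \tr (invmx H *m (G - H)))).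
      rewrite (_ : _ / d%:R = (d%:R * L ^+ 2)^-1 * \tr (G - H)); last by field; rewrite gL gd.
      by rewrite ler_pM2l// invr_gt0 mulr_gt0.
    by field; rewrite gL gd.
  rewrite -subr_ge0 (_ : _ - _ = \tr ((1%:M - mu ^+ 2 *: invmx H) *m (G - H))); last first.
    by rewrite mulmxBl mul1mx [RHS]linearB/= -scalemxAl mxtraceZ.
  apply: psd_trace_mul_ge0 => //; apply: psdB; rewrite ?linearZ/= ?trmx_invmx_sym ?tr_scalar_mx//.
  move=> v; rewrite qformZ.
  have Zp : pdmx ((mu ^+ 2)%:M : 'M[R]_d).
    split=> [|w w0]; first by rewrite tr_scalar_mx.
    by rewrite qform_scalar mulr_gt0 ?qform1_gt0.
  have := loewner_invmx v Zp Hp (fun w => _).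
  rewrite invmx_scalar qform_scalar -ler_pdivlMl//; apply => w.
  by rewrite qform_scalar.
- by rewrite fbfgs_gain_trace ?GS// mulrC.
rewrite le_eqVlt; apply/orP; left; apply/eqP; field.
by rewrite (gt_eqF tH) (gt_eqF mu_gt0) (gt_eqF dR).
Qed.

Lemma potential_le o H G (e : R) : well_conditioned H -> G^T = G -> 1 <= e ->
  (forall v, qform G v <= e * qform H v) ->
  potential o L mu H G <= d%:R * (1 + L ^+ 2 / mu ^+ 2) * e.
Proof.
move=> Hw GT e1 GH; have Hp := well_conditioned_pd Hw; have [HT _ _] := Hw.
have e0 : 0 <= e by apply: le_trans e1.
have tH := well_conditioned_trace_gt0 Hw.
have k0 : 0 <= L ^+ 2 / mu ^+ 2 by rewrite divr_ge0 ?(ltW musq_gt0) ?(ltW Lsq_gt0).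
have I1 : \tr (invmx H *m (G - H)) <= d%:R * (1 + L ^+ 2 / mu ^+ 2) * e.
  apply: (@le_trans _ _ (d%:R * e)); last first.
    by rewrite ler_wpM2r// ler_peMr// ?(ltW dR)// lerDl.
  rewrite mxtrace_mulmxBr mulVmx ?pd_unitmx// mxtrace1.
  have : 0 <= \tr (invmx H *m (e *: H - G)).
    apply: psd_trace_mul_ge0; first exact/pd_psd/pd_invmx.
    by apply: psdB => //; rewrite ?linearZ/= ?HT// => v; rewrite qformZ.
  rewrite mxtrace_mulmxBr -scalemxAr mxtraceZ mulVmx ?pd_unitmx// mxtrace1 subr_ge0 => h.
  by rewrite lerBlDr (le_trans h)// mulrC lerDl ltW.
case: o => //=.
have h : \tr (G - H) <= e * \tr H.
  by rewrite -mxtraceZ; apply: le_mxtrace => v; rewrite qformZ qformB (le_trans _ (GH v))// gerBl (pd_psd Hp).2.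
apply: (@le_trans _ _ (d%:R * (L ^+ 2 / mu ^+ 2) * e)); last first.
  by rewrite ler_wpM2r// ler_wpM2l ?(ltW dR)// lerDr.
rewrite ler_pdivrMr ?mulr_gt0//.
rewrite (_ : d%:R * (L ^+ 2 / mu ^+ 2) * e * _ = d%:R * L ^+ 2 * (e * \tr H)); last first.
  by field; rewrite gt_eqF.
by rewrite ler_wpM2l// mulr_ge0 ?(ltW dR) ?(ltW Lsq_gt0).
Qed.

(** Bounds the entries of the gain by its trace, so that clipping leaves it unchanged. *)
Lemma psd_entry_le B i j : psdmx B -> `|B i j| <= \tr B.
Proof.
move=> Bp.
have BE p q : B p q = bform B (delta_mx p 0) (delta_mx q 0).
  by rewrite /bform trmx_delta -rowE -colE !mxE.
have qle p : qform B (delta_mx p 0) <= \tr B.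
  by rewrite mxtrace_qform (bigD1 p)//= lerDl sumr_ge0// => q _; apply Bp.2.
have t0 := psd_trace_ge0 Bp.
rewrite BE (le_trans (psd_cauchy_schwarz_sqrt _ _ Bp))//.
by rewrite -[leRHS]sqr_sqrtr// expr2 ler_pM ?sqrtr_ge0 ?ler_wsqrtr.
Qed.

Lemma gain_trace_le o H G S (e : R) : well_conditioned H -> pdmx G -> 1 <= e ->
  (forall v, qform H v <= qform G v) -> (forall v, qform G v <= e * qform H v) ->
  (o = FBFGS -> invmx G = S^T *m S) ->
  \tr (gain o L mu H G S) <= d%:R * (1 + L ^+ 2 / mu ^+ 2) * e.
Proof.
move=> Hw Gp e1 HG GH; have Hp := well_conditioned_pd Hw; have [HT _ _] := Hw; have [GT _] := Gp.
have k0 : 0 <= L ^+ 2 / mu ^+ 2 by rewrite divr_ge0 ?exprn_ge0.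
case: o => GS /=.
- rewrite mxtraceZ ler_pdivrMl//; apply: (@le_trans _ _ (e * \tr H)).
    rewrite -mxtraceZ; apply: le_mxtrace => v; rewrite qformZ qformB (le_trans _ (GH v))// gerBl.
    exact: (pd_psd Hp).2.
  apply: (@le_trans _ _ (e * (d%:R * L ^+ 2))).
    by rewrite ler_wpM2l ?well_conditioned_trace_le// (le_trans _ e1).
  rewrite (_ : e * _ = L ^+ 2 * (d%:R * 1 * e)); last by ring.
  rewrite ler_pM2l// ler_wpM2r ?(le_trans _ e1)//.
  by rewrite ler_wpM2l ?(ltW dR)// lerDl.
- rewrite fbfgs_gain_trace ?GS//; exact: (potential_le BFGS Hw GT e1 GH).
rewrite mxtraceZ mulrAC; exact: (potential_le SR1 Hw GT e1 GH).
Qed.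

Lemma measurable_potential {disp : measure_display} {T : measurableType disp} o
    (H G : T -> 'M[R]_d) : (forall w, H w \in unitmx) -> mx_measurable H -> mx_measurable G ->
  measurable_fun [set: T] (fun w => potential o L mu (H w) (G w)).
Proof.
move=> Hu mH mG; have mB := mx_measurableB mG mH.
have m1 : measurable_fun [set: T] (fun w => \tr (invmx (H w) *m (G w - H w))).
  by apply: measurable_mxtrace; apply: mx_measurableM => //; exact: mx_measurableV.
case: o => //=; apply: measurable_funM.
  by apply: measurable_funM; [exact: measurable_cst|exact: measurable_mxtrace].
apply: measurable_funV; apply: measurable_funM; first exact: measurable_cst.
exact: measurable_mxtrace.
Qed.

Lemma measurable_gain {disp : measure_display} {T : measurableType disp} o
    (H G S : T -> 'M[R]_d) : (forall w, H w \in unitmx) -> mx_measurable H -> mx_measurable G ->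
  (o = FBFGS -> mx_measurable S) ->
  mx_measurable (fun w => gain o L mu (H w) (G w) (S w)).
Proof.
move=> Hu mH mG; have mB := mx_measurableB mG mH.
case: o => mS /=.
- by apply: mx_measurableZ => //; exact: measurable_cst.
- apply: mx_measurableM; last exact/mx_measurable_tr/mS.
  apply: mx_measurableM; first exact: mS.
  apply: mx_measurableB => //; apply: mx_measurableM => //; apply: mx_measurableM => //.
  exact: mx_measurableV.
apply: mx_measurableZ => //; apply: measurable_funM; first exact: measurable_cst.
apply: measurable_funV; apply: measurable_funM; first exact: measurable_cst.
exact: measurable_mxtrace.
Qed.

End Potential.

(** * Length of the burn-in phase *)

Section BurnIn.
Context {R : realType}.
Implicit Types (a r nu Z : R).

(** The partial sum is the right-hand side minus an explicit nonnegative tail. *)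
Lemma sum_arith_geom a r (N : nat) : 0 <= a -> 0 <= r -> r < 1 ->
  \sum_(k < N) ((a + k%:R) * r ^+ k) <= a / (1 - r) + r / (1 - r) ^+ 2.
Proof.
move=> a0 r0 r1; have r1' : 0 < 1 - r by rewrite subr_gt0.
have -> : \sum_(k < N) ((a + k%:R) * r ^+ k) =
    a / (1 - r) + r / (1 - r) ^+ 2 - r ^+ N * ((a + N%:R) / (1 - r) + r / (1 - r) ^+ 2).
  elim: N => [|N IH]; first by rewrite big_ord0; field; rewrite gt_eqF.
  by rewrite big_ord_recr/= IH [r ^+ N.+1]exprS -natr1; field; rewrite gt_eqF.
have r1w := ltW r1'.
rewrite gerBl; apply: mulr_ge0; first exact: exprn_ge0.
by apply: addr_ge0; apply: divr_ge0 => //; [exact: addr_ge0|exact: exprn_ge0].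
Qed.

Lemma exp_dominates_linear (y : R) : 0 <= y -> (y + 2) * expR (- y) <= 2 * expR (- (y / 2)).
Proof.
move=> y0; have h := expR_ge1Dx (y / 2).
have {1}-> : - y = - (y / 2) + - (y / 2) by field.
rewrite expRD mulrA ler_pM2r ?expR_gt0//.
rewrite -(ler_pM2r (expR_gt0 (y / 2))) -mulrA -expRD addNr expR0 mulr1.
by rewrite -[leLHS]/(y + 2); lra.
Qed.

Lemma ln_mul4_le Z : 0 < Z -> ln (4 * Z) <= 4 * ln (1 + Z).
Proof.
move=> Z0.
have p1 : 0 < 1 + Z by rewrite addr_gt0.
have -> : 4 * ln (1 + Z) = ln ((1 + Z) ^+ 4) by rewrite lnXn// mulr_natl.
rewrite ler_ln ?posrE ?exprn_gt0 ?mulr_gt0//; nra.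
Qed.

(** With y = nu t0, the left-hand side of the last inequality is at most
    4 Z (y + 2) exp (- y). Half of the exponential absorbs the linear factor and the other
    half absorbs 4 Z once y >= 2 ln (4 Z); if 4 Z <= 1, then t0 = 0 will do. *)
Lemma burn_in_length nu Z : 0 < nu -> nu <= 1 -> 0 <= Z -> exists2 t0 : nat,
  t0%:R <= 13 * (ln (1 + Z) / nu) &
  4 * Z * nu ^+ 2 * ((1 - nu) ^+ t0 * (t0.+1%:R / nu + 1 / nu ^+ 2)) <= 2.
Proof.
move=> nu0 nu1 Z0; have nn : nu != 0 by rewrite gt_eqF.
have [Zs|Zb] := leP (4 * Z) 1.
  exists 0%N; first by rewrite mulr_ge0// divr_ge0 ?(ltW nu0)// ln_ge0// lerDl.
  rewrite expr0 !mul1r (_ : _ * _ = 4 * Z * (nu + 1)); last by field.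
  by nra.
have Zp : 0 < Z by lra.
pose X := 2 / nu * ln (4 * Z).
have X0 : 0 <= X by rewrite mulr_ge0 ?divr_ge0 ?(ltW nu0)// ln_ge0// ltW.
have [N NX XN] : exists2 N : nat, N%:R <= X + 1 & X <= N%:R.
  have /andP[Xl Xu] := truncn_itv X0.
  by exists (Num.truncn X).+1; [rewrite -natr1 lerD2r|exact: ltW].
exists N.
  have l1 := ln_mul4_le Zp.
  have l2 : 1 / 5 <= ln (1 + Z).
    have -> : 1 + Z = (1 + Z)^-1^-1 by rewrite invrK.
    have p1 : 0 < (1 + Z)^-1 by rewrite invr_gt0; lra.
    rewrite lnV ?posrE//.
    have h : ln (1 + ((1 + Z)^-1 - 1)) <= (1 + Z)^-1 - 1.
      by apply: le_ln1Dx; lra.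
    have h2 : (1 + Z)^-1 <= 4 / 5.
      rewrite -[leRHS]invrK lef_pV2 ?posrE ?invr_gt0//; last by lra.
      by rewrite invfM invrK; lra.
    by rewrite addrC subrK in h; lra.
  (* 13 = 8 + 5: ln (4 Z) <= 4 ln (1 + Z), and rounding up costs 1 <= 5 ln (1 + Z). *)
  have i1 : 1 <= nu^-1 by rewrite invf_ge1.
  apply: (le_trans NX).
  rewrite /X; set l4 := ln (4 * Z) in l1 *; set l := ln (1 + Z) in l1 l2 *.
  by rewrite -!mulrA [_^-1 * _]mulrC; nra.
have Nnu : (1 - nu) ^+ N <= expR (- (nu * N%:R)).
  have -> : - (nu * N%:R) = N%:R * (- nu) by ring.
  rewrite expRM_natl lerXn2r ?nnegrE ?expR_ge0 ?subr_ge0//.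
  exact: expR_ge1Dx.
set y := nu * N%:R in Nnu.
have y0 : 0 <= y by rewrite mulr_ge0// ltW.
have yl : ln (4 * Z) <= y / 2.
  have -> : ln (4 * Z) = nu * X / 2 by rewrite /X; field.
  by rewrite ler_pM2r// ler_pM2l.
have e4 : 4 * Z <= expR (y / 2) by rewrite -[leLHS]lnK ?ler_expR ?posrE//; lra.
have -> : 4 * Z * nu ^+ 2 * ((1 - nu) ^+ N * (N.+1%:R / nu + 1 / nu ^+ 2)) =
   4 * Z * ((y + nu + 1) * (1 - nu) ^+ N).
  by rewrite /y -natr1; field.
apply: (@le_trans _ _ (4 * Z * ((y + 2) * expR (- y)))).
  rewrite ler_wpM2l ?mulr_ge0// ler_pM//; [lra| |lra].
  by rewrite exprn_ge0// subr_ge0.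
apply: (@le_trans _ _ (expR (y / 2) * (2 * expR (- (y / 2))))).
  apply: ler_pM => //; [by rewrite mulr_ge0| |exact: exp_dominates_linear].
  by rewrite mulr_ge0 ?expR_ge0// addr_ge0.
by rewrite mulrCA -expRD subrr expR0 mulr1.
Qed.

End BurnIn.

(** * One step of the method inside the basin *)

Section GaussNewtonStep.
Context {R : realType} {n d : nat} (F : 'cV[R]_d -> 'cV[R]_n) (xs : 'cV[R]_d).
Implicit Types (y v : 'cV[R]_d) (G : 'M[R]_d).

Let relative_error_le (a lam B om C lam2 : R) : 0 <= a -> a <= 1 -> 0 <= lam -> 0 <= B -> 0 <= om ->
  lam2 <= a * lam + B * lam ^+ 2 -> 2 * om * lam <= 1 -> 2 * B + 2 * om <= C ->
  (1 + 2 * om * lam) * lam2 <= (a + C * lam) * lam.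
Proof.
move=> a0 a1 l0 B0 om0 h x1 hC; have x0 : 0 <= 2 * om * lam by rewrite !mulr_ge0.
apply: (@le_trans _ _ ((1 + 2 * om * lam) * ((a + B * lam) * lam))).
  by rewrite ler_wpM2l ?addr_ge0// (le_trans h)// mulrDl -mulrA -expr2.
rewrite mulrA ler_wpM2r//.
have h1 : (2 * om * lam) * a <= 2 * om * lam by rewrite ler_piMr.
have h2 : (2 * om * lam) * (B * lam) <= B * lam by rewrite ler_piMl// mulr_ge0.
have h3 : (2 * B + 2 * om) * lam <= C * lam by rewrite ler_wpM2r.
lra.
Qed.

Let sub_split (V : zmodType) (g a b c : V) : g - (a + b) = (g - (c + b)) + (c - a).
Proof.
by rewrite -addrA; congr (_ + _); rewrite [- (c + b)]opprD addrACA addNr add0r -opprD addrC.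
Qed.

Let error_split (V : zmodType) (x y g a : V) : (y - g) - x = ((y - x) - a) - (g - a).
Proof. by rewrite [- (g - a)]opprB addrA subrK addrAC. Qed.

Let linear_le_sqr (x q : R) : 0 <= x -> 0 <= q -> (1 + 2 * x) * q <= (1 + x) ^+ 2 * q.
Proof. by move=> x0 q0; rewrite ler_wpM2r// sqrrD expr1n mul1r mulr_natl lerDl sqr_ge0. Qed.

Let C1_dominates_B (t x Ka Pa Cr C : R) : 0 < x -> 0 < Cr -> 0 <= Pa -> t <= Ka * x ->
  4 * x + 4 * Ka * x + Cr + 2 * Pa <= C -> 2 * (2 * t + Pa) + 2 * x <= C.
Proof. lra. Qed.

Let C1_dominates (x k Cr Pa C : R) : 0 < x -> 0 <= k -> 0 < Cr -> 0 <= Pa ->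
  4 * x + 4 * (1 + k) * x + Cr + 2 * Pa <= C -> 4 * x <= C /\ Cr <= C.
Proof. by move=> x0 k0 Cr0 Pa0 h; have := mulr_ge0 k0 (ltW x0); split; lra. Qed.

Let C1_dominates8 (x k Cr Pa C : R) : 0 < x -> 0 <= k -> 0 < Cr -> 0 <= Pa ->
  4 * x + 4 * (1 + k) * x + Cr + 2 * Pa <= C -> 8 * x <= C.
Proof. by move=> x0 k0 Cr0 Pa0 h; have := mulr_ge0 k0 (ltW x0); lra. Qed.

Let contraction_budget (z a b : R) : 0 <= z -> 9 / 10 * z <= a -> b <= 1 / 20 * z ->
  1 - a + b <= 1 - 1 / 2 * z.
Proof. lra. Qed.

(** The value of lambda_over wherever the approximate Hessian is positive semidefinite; see
    lambda_overE. *)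
Definition lam y : R := Num.sqrt (qform (tilde_hess F xs y) (y - xs)).

(* kappa stands for c theta, rad for the radius of the basin, and Crad for the part of C1
   that prevents the iterates from leaving the basin. *)
Context (L L2 mu rho kappa rad Crad C1 : R).
Context (L_gt0 : 0 < L) (L2_gt0 : 0 < L2) (mu_gt0 : 0 < mu) (rho_ge0 : 0 <= rho).
Context (kappa_ge0 : 0 <= kappa) (kappa_lt1 : kappa < 1).
Context (Jac_le : forall y, specnorm (Jac F y) <= L).
Context (Jac_lip : forall y z, specnorm (Jac F y - Jac F z) <= L2 * enorm (y - z)).
Context (Q_sym : (Qmx F xs)^T = Qmx F xs).
Context (residual : forall y,
  enorm (grad_phi F y - (gn_hess F xs + Qmx F xs) *m (y - xs)) <= rho * enorm (y - xs) ^+ 2).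
Context (hess_ge : forall y v, enorm (y - xs) <= rad ->
  mu ^+ 2 * qform 1%:M v <= qform (gn_hess F y) v).
Context (tilde_ge : forall y v, enorm (y - xs) <= rad ->
  (1 - kappa) * qform (gn_hess F y) v <= qform (tilde_hess F xs y) v).
Context (tilde_le : forall y v, enorm (y - xs) <= rad ->
  qform (tilde_hess F xs y) v <= (1 + kappa) * qform (gn_hess F y) v).
Context (Crad_gt0 : 0 < Crad) (Crad_rad : 1 <= Crad * rad * mu).

Let s := Num.sqrt (1 - kappa).
Let om := L * L2 / (s ^+ 3 * mu ^+ 3).
Let resid := Num.sqrt (1 + kappa) * rho / (s ^+ 2 * mu ^+ 3).

Context (C1_ge : 4 * om + 4 * (1 + kappa) * om + Crad + 2 * resid <= C1).

Let s_gt0 : 0 < s. Proof. by rewrite sqrtr_gt0 subr_gt0. Qed.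
Let s2 : s ^+ 2 = 1 - kappa. Proof. by rewrite sqr_sqrtr// subr_ge0 ltW. Qed.
Let s_le1 : s <= 1. Proof. by rewrite -[leRHS]sqrtr1 ler_wsqrtr// gerBl. Qed.
Let om_gt0 : 0 < om. Proof. by rewrite divr_gt0 ?mulr_gt0 ?exprn_gt0. Qed.
Let resid_ge0 : 0 <= resid.
Proof. by rewrite divr_ge0 ?mulr_ge0 ?sqrtr_ge0 ?exprn_ge0 ?(ltW s_gt0) ?(ltW mu_gt0). Qed.

Lemma tilde_hess_sym y : (tilde_hess F xs y)^T = tilde_hess F xs y.
Proof. by rewrite /tilde_hess linearD/= gn_hess_sym Q_sym. Qed.

Lemma gn_hess_pd y : enorm (y - xs) <= rad -> pdmx (gn_hess F y).
Proof.
move=> yr; split=> [|v v0]; first exact: gn_hess_sym.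
by apply: lt_le_trans (hess_ge v yr); rewrite mulr_gt0 ?exprn_gt0 ?qform1_gt0.
Qed.

Lemma tilde_hess_psd y : enorm (y - xs) <= rad -> psdmx (tilde_hess F xs y).
Proof.
move=> yr; split=> [|v]; first exact: tilde_hess_sym.
apply: le_trans (tilde_ge v yr); rewrite mulr_ge0 ?subr_ge0 ?(ltW kappa_lt1)//.
exact: (pd_psd (gn_hess_pd yr)).2.
Qed.

Lemma lambda_overE y : enorm (y - xs) <= rad -> lambda_over F xs y = (lam y)%:E.
Proof.
move=> yr; have Ap := tilde_hess_psd yr.
by rewrite /lambda_over; case: asboolP => // _; rewrite enorm_sqrtmx.
Qed.

Lemma enorm_err_le y v : enorm (y - xs) <= rad ->
  s * mu * enorm v <= Num.sqrt (qform (tilde_hess F xs y) v).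
Proof.
move=> yr; apply: (enorm_le_tilde (H := gn_hess F y)) => // w.
  exact: hess_ge.
exact: tilde_ge.
Qed.

Let Crad_le_C1 : Crad <= C1.
Proof. by have [] := C1_dominates om_gt0 kappa_ge0 Crad_gt0 resid_ge0 C1_ge. Qed.

Section OneStep.
Context (y : 'cV[R]_d) (G : 'M[R]_d) (eta : R).
Context (y_rad : enorm (y - xs) <= rad) (G_sym : G^T = G).
Context (HG : forall v, qform (gn_hess F y) v <= qform G v).
Context (eta_ge1 : 1 <= eta) (G_le : forall v, qform G v <= eta * qform (gn_hess F y) v).
Context (lam_small : C1 * lam y <= (1 - kappa) / 20).
Context (lam_decr : 1 - (1 - kappa) / eta + C1 * lam y <= 1).

Let H := gn_hess F y.
Let A := tilde_hess F xs y.
Let e := y - xs.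
Let y1 := next_x F y G.
Let w := grad_phi F y - A *m e.
Let B := Num.sqrt (1 + kappa) * (2 * L * L2 + rho) / (s ^+ 2 * mu ^+ 3).

Let Hp : pdmx H. Proof. exact: gn_hess_pd. Qed.

Lemma step_G_pd : pdmx G.
Proof. by split=> // v v0; apply: lt_le_trans (HG v); apply Hp.2. Qed.

Let Ap : pdmx A.
Proof. by apply: (tilde_pd (H := H) Hp _ kappa_lt1); [exact: tilde_hess_sym|move=> v; exact: tilde_ge]. Qed.

Let lam_ge0 : 0 <= lam y. Proof. exact: sqrtr_ge0. Qed.

Let e_le : enorm e <= lam y / (s * mu).
Proof. by rewrite ler_pdivlMr ?mulr_gt0// mulrC enorm_err_le. Qed.

Let w_le : enorm w <= (2 * L * L2 + rho) * enorm e ^+ 2.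
Proof.
have -> : w = (grad_phi F y - (gn_hess F xs + Qmx F xs) *m e) + (gn_hess F xs - gn_hess F y) *m e.
  rewrite /w /A /tilde_hess !mulmxDl mulNmx; exact: sub_split.
apply: (le_trans (enormD _ _)); rewrite addrC mulrDl lerD ?residual//.
apply: (le_trans (enorm_gn_hessB Jac_le Jac_lip _ _ _ (ltW L_gt0))).
by rewrite -[xs - y]opprB enormN -mulrA -expr2.
Qed.

(** The new error is the exact preconditioned Newton step for the linear map A, up to the
    preconditioned remainder w, which is quadratic in the error. *)
Let y1E : y1 - xs = (e - invmx G *m (A *m e)) - invmx G *m w.
Proof.
rewrite /y1 /next_x /w [invmx G *m (grad_phi F y - _)]mulmxBr; exact: error_split.
Qed.

Let B_ge0 : 0 <= B.
Proof.
apply: divr_ge0; last by rewrite mulr_ge0 ?exprn_ge0 ?(ltW s_gt0) ?(ltW mu_gt0).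
by rewrite mulr_ge0 ?sqrtr_ge0// addr_ge0// !mulr_ge0// ltW.
Qed.

Let B_le : 2 * B + 2 * om <= C1.
Proof.
have sk : Num.sqrt (1 + kappa) <= 1 + kappa.
  rewrite -[leRHS]ger0_norm ?addr_ge0// -sqrtr_sqr ler_wsqrtr// expr2.
  by rewrite ler_peMl ?addr_ge0// lerDl.
have h1 : L * L2 / (s ^+ 2 * mu ^+ 3) <= om.
  rewrite /om ler_pM2l ?mulr_gt0// lef_pV2 ?posrE ?mulr_gt0 ?exprn_gt0//.
  by rewrite ler_pM2r ?exprn_gt0// exprSr ler_piMr// exprn_ge0// ltW.
have BE : B = 2 * (Num.sqrt (1 + kappa) * (L * L2 / (s ^+ 2 * mu ^+ 3))) + resid.
  by rewrite /B /resid; ring.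
have h2 : Num.sqrt (1 + kappa) * (L * L2 / (s ^+ 2 * mu ^+ 3)) <= (1 + kappa) * om.
  apply: ler_pM => //.
  by rewrite divr_ge0 ?mulr_ge0 ?exprn_ge0 ?(ltW s_gt0) ?(ltW mu_gt0) ?(ltW L_gt0) ?(ltW L2_gt0).
by rewrite BE; apply: (C1_dominates_B om_gt0 Crad_gt0 resid_ge0 h2).
Qed.

(** The first term is the contraction of the exact step, the second the remainder w. *)
Lemma step_old_norm (eta' : R) : 1 <= eta' -> (forall v, qform G v <= eta' * qform H v) ->
  Num.sqrt (qform A (y1 - xs)) <= (1 - (1 - kappa) / eta') * lam y + B * lam y ^+ 2.
Proof.
move=> eta'1 Geta'; rewrite y1E.
apply: (le_trans (psd_seminorm_triangle _ _ (pd_psd Ap))).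
rewrite lerD//.
  apply: (newton_contraction Hp step_G_pd) => //.
  - exact: tilde_hess_sym.
  - by move=> v; exact: tilde_ge.
  - by move=> v; exact: tilde_le.
rewrite -mulmxN.
apply: (le_trans (tilde_precond_le step_G_pd kappa_ge0 mu_gt0
  (fun v => hess_ge v y_rad) (fun v => tilde_le v y_rad) HG _)).
rewrite enormN; apply: (@le_trans _ _ (Num.sqrt (1 + kappa) / mu *
    ((2 * L * L2 + rho) * (lam y / (s * mu)) ^+ 2))).
  rewrite ler_wpM2l ?divr_ge0 ?sqrtr_ge0 ?(ltW mu_gt0)//.
  apply: (le_trans w_le); rewrite ler_wpM2l ?addr_ge0 ?mulr_ge0 ?(ltW L_gt0) ?(ltW L2_gt0)//.
  by rewrite ler_sqr ?nnegrE ?enorm_ge0// divr_ge0// mulr_ge0 ?(ltW s_gt0) ?(ltW mu_gt0).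
rewrite le_eqVlt; apply/orP; left; apply/eqP; rewrite /B; field.
by rewrite (gt_eqF s_gt0) (gt_eqF mu_gt0).
Qed.

Lemma step_old_norm_le : Num.sqrt (qform A (y1 - xs)) <= lam y.
Proof.
apply: (le_trans (step_old_norm eta_ge1 G_le)).
have BC : B * lam y <= C1 * lam y.
  rewrite ler_wpM2r//; apply: le_trans B_le.
  by rewrite [2 * B]mulr_natl mulr2n -addrA lerDl addr_ge0// mulr_ge0// ltW.
rewrite expr2 mulrA -mulrDl ler_piMl//.
by apply: le_trans lam_decr; rewrite lerD2l.
Qed.

Lemma step_length : enorm (y1 - y) <= 2 * lam y / (s * mu).
Proof.
have -> : y1 - y = (y1 - xs) - e by rewrite /e opprB addrA subrK.
apply: (le_trans (enormB _ _)).
rewrite [2 * _]mulr_natl mulr2n mulrDl lerD//.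
rewrite ler_pdivlMr ?mulr_gt0// mulrC; apply: le_trans step_old_norm_le.
exact: enorm_err_le.
Qed.

Let om_le_C1 : 4 * om <= C1.
Proof. by have [] := C1_dominates om_gt0 kappa_ge0 Crad_gt0 resid_ge0 C1_ge. Qed.

(** The new error is at most lam y in the old norm, and lam_small makes that smaller than
    rad in the Euclidean norm, because Crad is a part of C1. *)
Lemma step_region : enorm (y1 - xs) <= rad.
Proof.
have rad0 : 0 <= rad.
  have : 0 < Crad * rad * mu by apply: lt_le_trans Crad_rad.
  by rewrite pmulr_lgt0// pmulr_rgt0//; exact: ltW.
rewrite -(ler_pM2l (mulr_gt0 s_gt0 mu_gt0)).
apply: (le_trans (enorm_err_le _ y_rad)); apply: (le_trans step_old_norm_le).
have h : Crad * lam y <= s ^+ 2 / 20.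
  by rewrite s2; apply: le_trans lam_small; rewrite ler_wpM2r.
apply: (@le_trans _ _ (s ^+ 2 / 20 * (rad * mu))).
  rewrite -[leLHS]mul1r; apply: (@le_trans _ _ (Crad * rad * mu * lam y)).
    by rewrite ler_wpM2r.
  rewrite (_ : _ * lam y = Crad * lam y * (rad * mu)); last by ring.
  by rewrite ler_wpM2r// mulr_ge0// ltW.
rewrite (_ : s * mu * rad = s * (rad * mu)); last by ring.
rewrite ler_wpM2r ?mulr_ge0 ?(ltW mu_gt0)// expr2 -mulrA ler_piMr ?(ltW s_gt0)//.
by rewrite ler_pdivrMr// mul1r (le_trans s_le1)// ler1n.
Qed.

(** Measuring the new error with the new matrix costs a relative change of the Hessian that
    is proportional to the step length, hence to lam y. *)
Lemma step_lam (eta' : R) : 1 <= eta' -> (forall v, qform G v <= eta' * qform H v) ->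
  lam y1 <= (1 - (1 - kappa) / eta' + C1 * lam y) * lam y.
Proof.
move=> eta'1 Geta'; have eta'0 : 0 < eta' by apply: lt_le_trans eta'1.
set N := Num.sqrt (qform A (y1 - xs)).
have x0 : 0 <= 2 * om * lam y by apply: mulr_ge0 => //; apply: mulr_ge0 => //; exact: ltW.
have lamN : lam y1 <= (1 + 2 * om * lam y) * N.
  rewrite /lam /N -[1 + _]ger0_norm ?addr_ge0// -sqrtr_sqr -sqrtrM ?sqr_ge0// ler_wsqrtr//.
  apply: le_trans (linear_le_sqr x0 ((pd_psd Ap).2 _)).
  set v := y1 - xs; rewrite /tilde_hess qformD.
  apply: (@le_trans _ _ (qform A v + 2 * L * L2 * enorm (y1 - y) * qform 1%:M v)).
    by rewrite /A /tilde_hess qformD addrAC lerD2r; exact: gn_hess_lip.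
  rewrite [leRHS]mulrDl mul1r lerD2l.
  apply: (@le_trans _ _ (2 * L * L2 * (2 * lam y / (s * mu)) * (qform A v / (s * mu) ^+ 2))).
    apply: ler_pM.
    - by rewrite !mulr_ge0 ?enorm_ge0 ?(ltW L_gt0) ?(ltW L2_gt0).
    - exact: qform1_ge0.
    - by rewrite ler_wpM2l ?mulr_ge0 ?(ltW L_gt0) ?(ltW L2_gt0)//; exact: step_length.
    rewrite ler_pdivlMr ?exprn_gt0 ?mulr_gt0// mulrC exprMn s2 -mulrA.
    apply: le_trans (tilde_ge _ y_rad); rewrite ler_pM2l ?subr_gt0//.
    exact: hess_ge.
  rewrite le_eqVlt; apply/orP; left; apply/eqP; rewrite /om; field.
  by rewrite (gt_eqF s_gt0) (gt_eqF mu_gt0).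
apply: (le_trans lamN); apply: relative_error_le (step_old_norm eta'1 Geta') _ B_le => //.
- rewrite subr_ge0 ler_pdivrMr// mul1r; apply: le_trans eta'1.
  by rewrite gerBl.
- by rewrite gerBl divr_ge0 ?subr_ge0 ?(ltW kappa_lt1) ?(ltW eta'0).
- exact: ltW.
apply: (@le_trans _ _ (C1 * lam y)).
  rewrite ler_wpM2r//; apply: le_trans om_le_C1.
  by rewrite ler_pM2r ?om_gt0// ler_nat.
apply: (le_trans lam_small); rewrite ler_pdivrMr// mul1r.
by rewrite lerBlDl (le_trans (_ : _ <= 20)) ?ler1n// lerDr.
Qed.

End OneStep.

(** * Bounds that hold for every realisation *)
Section Trajectory.
Context (M eta0 : R) (ME : M = 2 * L * L2 / mu ^+ 2).
Context (o : qn_option) (x0 : 'cV[R]_d) (G0 : 'M[R]_d).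
Context (x0_rad : enorm (x0 - xs) <= rad) (G0_sym : G0^T = G0).
Context (H0_le : forall v, qform (gn_hess F x0) v <= qform G0 v).
Context (eta0_ge1 : 1 <= eta0) (G0_le : forall v, qform G0 v <= eta0 * qform (gn_hess F x0) v).
Context (lam0_small : C1 * lam x0 <= (1 - kappa) / (20 * eta0)).

Let tau := 1 - (1 - kappa) / (2 * eta0).

(** An upper bound for M r_t that does not depend on the random directions. *)
Definition step_bound (t : nat) : R := M * (2 * (tau ^+ t * lam x0) / (s * mu)).

(** How much the Loewner factor may have grown by time t: each step inflates G by 1 + M r_t
    and loses another 1 + M r_t to the change of Hessian. *)
Definition growth (t : nat) : R := expR (2 * \sum_(k < t) step_bound k).

Let eta0_gt0 : 0 < eta0. Proof. exact: lt_le_trans eta0_ge1. Qed.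

Let k1 : 0 < 1 - kappa. Proof. by rewrite subr_gt0. Qed.

Let gap_le : (1 - kappa) / (2 * eta0) <= 1 / 2.
Proof.
rewrite ler_pdivrMr ?mulr_gt0// mulrA divfK// mul1r.
by apply: le_trans eta0_ge1; rewrite gerBl.
Qed.

Let gap_gt0 : 0 < (1 - kappa) / (2 * eta0).
Proof. by rewrite divr_gt0 ?mulr_gt0. Qed.

Lemma tau_ge0 : 0 <= tau.
Proof. by rewrite subr_ge0 (le_trans gap_le)// mul1r invf_le1 ?ler1n. Qed.

Lemma tau_le1 : tau <= 1.
Proof. by rewrite gerBl ltW. Qed.

Let M_gt0 : 0 < M.
Proof. by rewrite ME divr_gt0 ?mulr_gt0 ?exprn_gt0. Qed.

Let lam_x0_ge0 : 0 <= lam x0. Proof. exact: sqrtr_ge0. Qed.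

Lemma step_bound_ge0 t : 0 <= step_bound t.
Proof.
apply: mulr_ge0; first exact: ltW.
by rewrite divr_ge0 ?mulr_ge0 ?exprn_ge0 ?tau_ge0 ?(ltW s_gt0) ?(ltW mu_gt0).
Qed.

Lemma sum_step_bound t : \sum_(k < t) step_bound k <= 1 / 20.
Proof.
have -> : \sum_(k < t) step_bound k =
    M * (2 * lam x0 / (s * mu)) * \sum_(k < t) tau ^+ k.
  rewrite mulr_sumr; apply: eq_bigr => i _; rewrite /step_bound; ring.
have geo : (1 - tau) * \sum_(k < t) tau ^+ k <= 1.
  rewrite -opprB mulNr -subrX1 opprB gerBl exprn_ge0 ?tau_ge0//.
have t1 : 1 - tau = (1 - kappa) / (2 * eta0) by rewrite opprB addrC subrK.
rewrite t1 in geo.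
have -> : M * (2 * lam x0 / (s * mu)) = 8 * om * lam x0 * eta0 * ((1 - kappa) / (2 * eta0)).
  rewrite ME /om -s2; field.
  by rewrite (gt_eqF s_gt0) (gt_eqF mu_gt0) (gt_eqF eta0_gt0).
rewrite -mulrA; apply: (@le_trans _ _ (8 * om * lam x0 * eta0)).
  rewrite ler_piMr//; apply: mulr_ge0; last exact: ltW.
  by apply: mulr_ge0 => //; apply: mulr_ge0 => //; exact: ltW.
have C1_8 : 8 * om <= C1.
  apply: C1_dominates8 om_gt0 kappa_ge0 Crad_gt0 resid_ge0 C1_ge.
apply: (@le_trans _ _ (C1 * lam x0 * eta0)).
  by rewrite ler_pM2r// ler_wpM2r.
rewrite -ler_pdivlMr// (le_trans lam0_small)//.
rewrite invfM mulrA ler_pM2r ?invr_gt0// ler_pM2r ?invr_gt0//.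
by rewrite gerBl.
Qed.

Lemma growth_ge1 t : 1 <= growth t.
Proof.
rewrite -expR0 ler_expR mulr_ge0// sumr_ge0// => i _; exact: step_bound_ge0.
Qed.

Lemma growth_le t : growth t <= expR (1 / 10).
Proof.
rewrite ler_expR (_ : 1 / 10 = 2 * (1 / 20)); last by field.
by rewrite ler_pM2l// sum_step_bound.
Qed.

Lemma growthS t (b : R) : 0 <= b -> b <= step_bound t ->
  (1 + b) ^+ 2 * growth t <= growth t.+1.
Proof.
move=> b0 bt; rewrite /growth big_ord_recr/= mulrDr expRD mulrC ler_pM2l ?expR_gt0//.
rewrite [2 * step_bound t]mulr_natl mulr2n expRD -expr2.
rewrite ler_sqr ?nnegrE ?addr_ge0 ?expR_ge0//.
by apply: le_trans (expR_ge1Dx _); rewrite lerD2l.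
Qed.

Let growth_small t : growth t <= 10 / 9.
Proof.
apply: (le_trans (growth_le t)).
have h : 9 / 10 <= expR (- (1 / 10) : R).
  by apply: le_trans (expR_ge1Dx _); rewrite le_eqVlt; apply/orP; left; apply/eqP; field.
rewrite -[leLHS]invrK -expRN -[leRHS]invrK lef_pV2 ?posrE ?invr_gt0 ?divr_gt0 ?expR_gt0//.
by rewrite invf_div.
Qed.

(** The margin is 9/10 - 1/20 >= 1/2, since growth is at most 10/9. *)
Lemma contraction_le_tau t (l : R) : l <= lam x0 ->
  1 - (1 - kappa) / (eta0 * growth t) + C1 * l <= tau.
Proof.
move=> ll.
have h1 : 9 / 10 * ((1 - kappa) / eta0) <= (1 - kappa) / (eta0 * growth t).
  have g0 : 0 < growth t by apply: lt_le_trans (growth_ge1 t).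
  rewrite (_ : (1 - kappa) / (eta0 * growth t) = (growth t)^-1 * ((1 - kappa) / eta0)); last first.
    by field; rewrite (gt_eqF g0) (gt_eqF eta0_gt0).
  apply: ler_wpM2r; first by rewrite divr_ge0 ?(ltW k1) ?(ltW eta0_gt0).
  by rewrite -[leLHS]invrK lef_pV2 ?posrE ?invr_gt0 ?divr_gt0// invf_div.
have h2 : C1 * l <= 1 / 20 * ((1 - kappa) / eta0).
  have C1_ge0 : 0 <= C1 by apply: le_trans Crad_le_C1; exact: ltW.
  apply: (@le_trans _ _ (C1 * lam x0)); first by rewrite ler_wpM2l.
  by rewrite mul1r -[leRHS]mulrC -mulrA -invfM [eta0 * _]mulrC.
have h3 : (1 - kappa) / (2 * eta0) = 1 / 2 * ((1 - kappa) / eta0).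
  by field; rewrite gt_eqF.
have h0 : 0 <= (1 - kappa) / eta0 by rewrite divr_ge0 ?(ltW k1) ?(ltW eta0_gt0).
rewrite /tau h3; exact: contraction_budget h0 h1 h2.
Qed.

(** Invariant of the run. The rate tau is the worst one, obtained from the initial Loewner
    factor: updates never make the factor worse, whatever the direction. *)
Definition sound_state (t : nat) (x : 'cV[R]_d) (G : 'M[R]_d) : Prop :=
  [/\ enorm (x - xs) <= rad, G^T = G, (forall v, qform (gn_hess F x) v <= qform G v),
   (forall v, qform G v <= eta0 * growth t * qform (gn_hess F x) v)
    & lam x <= tau ^+ t * lam x0].

Section SoundStep.
Context (t : nat) (x : 'cV[R]_d) (G : 'M[R]_d) (sound : sound_state t x G).

Let y := next_x F x G.
Let r := M * enorm (y - x).

Let lam_le : lam x <= lam x0.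
Proof. by have [_ _ _ _ /le_trans->//] := sound; rewrite ler_piMl ?exprn_ile1 ?tau_ge0 ?tau_le1. Qed.

Let eta_ge1 : 1 <= eta0 * growth t.
Proof. by rewrite mulr_ege1 ?growth_ge1. Qed.

Let decr : 1 - (1 - kappa) / (eta0 * growth t) + C1 * lam x <= tau.
Proof. exact: contraction_le_tau. Qed.

Let decr1 : 1 - (1 - kappa) / (eta0 * growth t) + C1 * lam x <= 1.
Proof. exact: le_trans decr tau_le1. Qed.

Let lam_small : C1 * lam x <= (1 - kappa) / 20.
Proof.
have C1_ge0 : 0 <= C1 by apply: le_trans Crad_le_C1; exact: ltW.
apply: (@le_trans _ _ (C1 * lam x0)); first by rewrite ler_wpM2l.
apply: (le_trans lam0_small); rewrite ler_pM2l// lef_pV2 ?posrE ?mulr_gt0//.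
by rewrite ler_peMr.
Qed.

Lemma sound_region : enorm (y - xs) <= rad.
Proof. by have [xr GT HG GH ll] := sound; apply: (step_region xr GT HG eta_ge1 GH). Qed.

Lemma sound_length : r <= step_bound t.
Proof.
have [xr GT HG GH ll] := sound; rewrite /r ler_pM2l//.
apply: (le_trans (step_length xr GT HG eta_ge1 GH decr1)).
rewrite ler_pM2r ?invr_gt0 ?mulr_gt0// ler_pM2l//.
Qed.

Lemma sound_length_ge0 : 0 <= r.
Proof. by rewrite mulr_ge0 ?enorm_ge0 ?(ltW M_gt0). Qed.

Lemma sound_lam (eta' : R) : 1 <= eta' ->
  (forall v, qform G v <= eta' * qform (gn_hess F x) v) ->
  lam y <= (1 - (1 - kappa) / eta' + C1 * lam x) * lam x.
Proof.
by have [xr GT HG GH ll] := sound; exact: (step_lam xr GT HG eta_ge1 GH).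
Qed.

Let hess_close (z z' v : 'cV[R]_d) : enorm (z' - xs) <= rad -> enorm (z - z') = enorm (y - x) ->
  qform (gn_hess F z) v <= (1 + r) * qform (gn_hess F z') v.
Proof.
move=> zr zz; apply: (le_trans (gn_hess_lip Jac_le Jac_lip z z' v)).
rewrite [leRHS]mulrDl mul1r lerD2l zz /r ME.
rewrite [leLHS](_ : _ = 2 * L * L2 / mu ^+ 2 * enorm (y - x) * (mu ^+ 2 * qform 1%:M v)).
  by rewrite ler_wpM2l ?hess_ge// mulr_ge0 ?enorm_ge0// -ME ltW.
by field; rewrite gt_eqF.
Qed.

Lemma sound_hess_next v : qform (gn_hess F y) v <= (1 + r) * qform (gn_hess F x) v.
Proof. by have [xr _ _ _ _] := sound; apply: hess_close. Qed.

Lemma sound_hess_prev v : qform (gn_hess F x) v <= (1 + r) * qform (gn_hess F y) v.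
Proof. by apply: hess_close; [exact: sound_region|rewrite -opprB enormN]. Qed.

Lemma scaled_GE : scaled_G F M x G = (1 + r) *: G.
Proof. by []. Qed.

Lemma scaled_G_ge v : qform (gn_hess F y) v <= qform (scaled_G F M x G) v.
Proof.
have [_ _ HG _ _] := sound; rewrite scaled_GE qformZ.
by apply: (le_trans (sound_hess_next v)); rewrite ler_wpM2l ?addr_ge0 ?sound_length_ge0.
Qed.

Lemma scaled_G_pd : pdmx (scaled_G F M x G).
Proof.
have [_ GT _ _ _] := sound; split=> [|v v0]; first by rewrite scaled_GE linearZ/= GT.
by apply: lt_le_trans (scaled_G_ge v); apply (gn_hess_pd sound_region).2.
Qed.

Lemma scaled_G_le v :
  qform (scaled_G F M x G) v <= eta0 * growth t.+1 * qform (gn_hess F y) v.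
Proof.
have [_ _ _ GH _] := sound; rewrite scaled_GE qformZ.
have H0 z w : enorm (z - xs) <= rad -> 0 <= qform (gn_hess F z) w.
  by move=> zr; apply (pd_psd (gn_hess_pd zr)).2.
apply: (@le_trans _ _ ((1 + r) * (eta0 * growth t * ((1 + r) * qform (gn_hess F y) v)))).
  rewrite ler_wpM2l ?addr_ge0 ?sound_length_ge0//; apply: (le_trans (GH v)).
  by rewrite ler_wpM2l ?sound_hess_prev// (le_trans _ eta_ge1).
rewrite (_ : _ * _ = eta0 * ((1 + r) ^+ 2 * growth t) * qform (gn_hess F y) v); last by ring.
rewrite ler_wpM2r ?H0 ?sound_region// ler_pM2l//.
by rewrite growthS ?sound_length_ge0 ?sound_length.
Qed.

Lemma sound_step S v : sound_state t.+1 y (qn_update o (scaled_G F M x G) (gn_hess F y) S v).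
Proof.
have Hp := gn_hess_pd sound_region; have Gp := scaled_G_pd.
have eta1 : 1 <= eta0 * growth t.+1 by rewrite mulr_ege1 ?growth_ge1.
have [] := qn_update_bounds o S v Hp Gp.1 eta1 scaled_G_ge scaled_G_le.
split=> //; first exact: sound_region.
have [_ _ _ GH ll] := sound.
apply: (le_trans (sound_lam eta_ge1 GH)).
rewrite exprS -mulrA; apply: ler_pM => //; last exact: sqrtr_ge0.
rewrite addr_ge0//.
  rewrite subr_ge0 ler_pdivrMr ?(lt_le_trans _ eta_ge1)// mul1r (le_trans _ eta_ge1)//.
  by rewrite gerBl.
rewrite mulr_ge0 ?sqrtr_ge0//; apply: le_trans Crad_le_C1; exact: ltW.
Qed.

End SoundStep.

(** As the directions and the factors are arbitrary here, no null set needs to be excluded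
    in the deterministic part. *)
Lemma rqgn_sound (Cf : nat -> 'M[R]_d) (u : nat -> 'cV[R]_d) t :
  sound_state t (rqgn F M o x0 G0 Cf u t).1 (rqgn F M o x0 G0 Cf u t).2.
Proof.
elim: t => [|t IH]; last by rewrite rqgnS; exact: sound_step.
split=> // [v|]; last by rewrite expr0 mul1r.
by rewrite /growth big_ord0 mulr0 expR0 mulr1.
Qed.

(** * Expected decrease of the potential *)
Section Expectation.
Context (F_diff : forall i, twice_differentiable (component F i)) (d_gt0 : (0 < d)%N).
Context {disp : measure_display} {T : measurableType disp} (P : probability T R).
Context (U : nat -> T -> 'cV[R]_d) (C : nat -> T -> 'M[R]_d).
Context (draws : gaussian_draws P U).

Let x t w := (rqgn F M o x0 G0 (C ^~ w) (U ^~ w) t).1.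
Let G t w := (rqgn F M o x0 G0 (C ^~ w) (U ^~ w) t).2.
Let y t w := next_x F (x t w) (G t w).
Let Gs t w := scaled_G F M (x t w) (G t w).

Context (factor : o = FBFGS -> past_measurable U C /\
  {ae P, forall w, forall t, invmx (Gs t w) = (C t w)^T *m C t w}).

Let gamma : R := @rate R d o L mu.
Let tc : R := cost o L mu.
Context (gamma_gt0 : 0 < gamma) (gamma_le1 : gamma <= 1).
Context (C2 : R) (C2_ge : C1 + 8 * tc * d%:R * (L * L2) / (s * mu ^+ 3) <= C2).
Let slack : R := (1 - gamma) * (1 - kappa) / (10 * (2 - gamma) * eta0).
Context (lam0_C2 : C2 * lam x0 <= slack).
Let nu : R := Num.min gamma ((1 - kappa) / (2 * eta0)).
Let delta0 : R := potential o L mu (gn_hess F x0) G0.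

Let sound t w : sound_state t (x t w) (G t w). Proof. exact: rqgn_sound. Qed.

Let xS t w : x t.+1 w = y t w. Proof. by rewrite /x rqgnS. Qed.

Let GS t w : G t.+1 w = qn_update o (Gs t w) (gn_hess F (y t w)) (C t w) (U t w).
Proof. by rewrite /G rqgnS. Qed.

Let G_pd t w : pdmx (G t w).
Proof.
have [xr GT HG _ _] := sound t w; split=> // v v0; apply: lt_le_trans (HG v).
exact: (gn_hess_pd xr).2.
Qed.

Let G_unit t w : G t w \in unitmx. Proof. exact: pd_unitmx. Qed.

Let H_unit t w : gn_hess F (x t w) \in unitmx.
Proof. by have [xr _ _ _ _] := sound t w; exact/pd_unitmx/gn_hess_pd. Qed.

Let Hy_unit t w : gn_hess F (y t w) \in unitmx. Proof. by rewrite -xS. Qed.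

Let wc t w : well_conditioned L mu (gn_hess F (x t w)).
Proof.
have [xr _ _ _ _] := sound t w; split; first exact: gn_hess_sym.
  by move=> v; exact: hess_ge.
by move=> v; exact: gn_hess_le.
Qed.

Let wcy t w : well_conditioned L mu (gn_hess F (y t w)). Proof. by rewrite -xS. Qed.

Let info_C t : o = FBFGS -> forall k, (k <= t)%N ->
  mx_measurable (C k : info U [set q | (q < t)%N] -> 'M[R]_d).
Proof.
move=> oF k kt i j _ A mA; rewrite setTI.
apply: (sub_sigma_of (D := [set q | (q < k)%N])); last exact: (factor oF).1.
by move=> q /= qk; exact: leq_trans qk kt.
Qed.

Let info_run t : mx_measurable (x t : info U [set q | (q < t)%N] -> 'cV[R]_d) /\
  mx_measurable (G t : info U [set q | (q < t)%N] -> 'M[R]_d).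
Proof.
apply: (measurable_rqgn F_diff (T := info U [set q | (q < t)%N]) (C := C) (u := U)) => //.
- by move=> k kt; exact: info_direction.
- by move=> oF k kt; apply: info_C => //; exact: ltnW.
Qed.

Let info_y t : mx_measurable (y t : info U [set q | (q < t)%N] -> 'cV[R]_d).
Proof. by have [mx mG] := info_run t; apply: (measurable_next_x F_diff). Qed.

Let info_Gs t : mx_measurable (Gs t : info U [set q | (q < t)%N] -> 'M[R]_d).
Proof. by have [mx mG] := info_run t; apply: (measurable_scaled_G F_diff). Qed.

Let mU q : mx_measurable (U q). Proof. exact: draws_measurable draws q. Qed.

Let mxm m k t (A : T -> 'M[R]_(m, k)) :
  mx_measurable (A : info U [set q | (q < t)%N] -> 'M[R]_(m, k)) -> mx_measurable A.
Proof. by move=> mA i j; apply: (info_measurable mU (mA i j)). Qed.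

Let mx_x t : mx_measurable (x t). Proof. exact: (mxm (info_run t).1). Qed.
Let mx_G t : mx_measurable (G t). Proof. exact: (mxm (info_run t).2). Qed.
Let mx_y t : mx_measurable (y t). Proof. exact: (@mxm _ _ t (y t) (@info_y t)). Qed.
Let mx_Gs t : mx_measurable (Gs t). Proof. exact: (@mxm _ _ t (Gs t) (@info_Gs t)). Qed.

Definition delta t w : R := potential o L mu (gn_hess F (x t w)) (G t w).
Definition delta_scaled t w : R := potential o L mu (gn_hess F (y t w)) (Gs t w).

Let bound (e : R) : R := d%:R * (1 + L ^+ 2 / mu ^+ 2) * e.

Let eta_t t : 1 <= eta0 * growth t. Proof. by rewrite mulr_ege1 ?growth_ge1. Qed.

Let Gs_pd t w : pdmx (Gs t w). Proof. exact: scaled_G_pd (sound t w). Qed.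
Let Gs_ge t w v : qform (gn_hess F (y t w)) v <= qform (Gs t w) v.
Proof. exact: scaled_G_ge (sound t w) v. Qed.
Let Gs_le t w v : qform (Gs t w) v <= eta0 * growth t.+1 * qform (gn_hess F (y t w)) v.
Proof. exact: scaled_G_le (sound t w) v. Qed.

Let delta_ge0 t w : 0 <= delta t w.
Proof. by have [xr GT HG _ _] := sound t w; exact: (potential_ge0 mu_gt0 L_gt0 o (wc t w) GT HG). Qed.

Let brv_delta t : brv (delta t).
Proof.
split; first by apply: measurable_potential => //; exact: (measurable_gn_hess F_diff).
exists (bound (eta0 * growth t)) => w; rewrite ger0_norm//.
have [xr GT HG GH _] := sound t w.
exact: (potential_le mu_gt0 L_gt0 d_gt0 o (wc t w) GT (eta_t t) GH).
Qed.

Let brv_delta_scaled t : brv (delta_scaled t).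
Proof.
split.
  apply: measurable_potential => //.
  by apply: (measurable_gn_hess F_diff); exact: mx_y.
exists (bound (eta0 * growth t.+1)) => w.
rewrite ger0_norm.
  exact: (potential_le mu_gt0 L_gt0 d_gt0 o (wcy t w) (Gs_pd t w).1 (eta_t t.+1) (@Gs_le t w)).
exact: (potential_ge0 mu_gt0 L_gt0 o (wcy t w) (Gs_pd t w).1 (@Gs_ge t w)).
Qed.

Let delta_scaled_le t w :
  delta_scaled t w <= (1 + step_bound t) ^+ 2 * (delta t w + 2 * d%:R * tc * step_bound t).
Proof.
have [xr GT HG GH _] := sound t w.
have r0 := sound_length_ge0 (x t w) (G t w); have rm := sound_length (sound t w).
have tc0 : 0 <= tc by rewrite /tc; case: (o) => //=; rewrite divr_ge0 ?exprn_ge0 ?(ltW L_gt0) ?(ltW mu_gt0).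
apply: (le_trans (potential_scaled mu_gt0 L_gt0 d_gt0 o (wc t w) (wcy t w) GT HG r0 _)).
  by move=> v; exact: sound_hess_prev.
apply: ler_pM.
- by rewrite exprn_ge0// addr_ge0.
- apply: addr_ge0; first exact: delta_ge0.
  by apply: mulr_ge0 => //; apply: mulr_ge0 => //; exact: mulr_ge0.
- by rewrite ler_sqr ?nnegrE ?addr_ge0 ?step_bound_ge0// lerD2l.
by apply: lerD => //; apply: ler_wpM2l => //; apply: mulr_ge0 => //; exact: mulr_ge0.
Qed.

(** Truncating the entries changes the gain on a null set only, and makes it
    bounded even where the factor C t is not the advertised one. *)
Let K t : R := bound (eta0 * growth t.+1).
Let clipped_gain t w : 'M[R]_d :=
  \matrix_(i, j) Num.max (- K t) (Num.min (K t) (gain o L mu (gn_hess F (y t w)) (Gs t w) (C t w) i j)).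

Let good t w := o = FBFGS -> invmx (Gs t w) = (C t w)^T *m C t w.

Let ae_good t : {ae P, forall w, good t w}.
Proof.
have [oF|oF] := pselect (o = FBFGS); last by apply: aeW => w /oF.
have [_ h] := factor oF; by apply: filterS h => w h _; exact: h.
Qed.

Let clipped_gainE t w : good t w ->
  clipped_gain t w = gain o L mu (gn_hess F (y t w)) (Gs t w) (C t w).
Proof.
move=> gw; apply/matrixP => i j; rewrite mxE.
have Bp := gain_psd mu_gt0 L_gt0 d_gt0 o (C t w) (wcy t w) (Gs_pd t w) (Gs_ge t w).
have := psd_entry_le i j Bp.
have := gain_trace_le mu_gt0 L_gt0 d_gt0 (wcy t w) (Gs_pd t w) (eta_t t.+1) (Gs_ge t w) (Gs_le t w) gw.
rewrite -/(K t) => h1 /le_trans/(_ h1); rewrite ler_norml => /andP[h2 h3].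
by rewrite min_r// max_r.
Qed.

Let info_clipped t : mx_measurable (clipped_gain t : info U [set q | (q < t)%N] -> 'M[R]_d).
Proof.
move=> i j; have [mx mG] := info_run t.
have mg : mx_measurable ((fun w => gain o L mu (gn_hess F (y t w)) (Gs t w) (C t w)) :
    info U [set q | (q < t)%N] -> 'M[R]_d).
  apply: measurable_gain => //.
  - by apply: (measurable_gn_hess F_diff); exact: info_y.
  - by move=> oF; exact: (@info_C t oF t (leqnn t)).
have := measurable_maxr (measurable_cst (- K t)) (measurable_minr (measurable_cst (K t)) (mg i j)).
by congr measurable_fun; apply/funext => w; rewrite mxE.
Qed.

Let K_ge0 t : 0 <= K t.
Proof.
have e0 : 0 <= eta0 * growth t.+1 := le_trans ler01 (eta_t t.+1).
apply: mulr_ge0 => //; apply: mulr_ge0 => //.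
by rewrite addr_ge0// divr_ge0// exprn_ge0// ltW.
Qed.

Let brv_clipped t i j : brv (fun w => clipped_gain t w i j).
Proof.
split; first exact: (info_measurable mU (@info_clipped t i j)).
exists (K t) => w; rewrite mxE ler_norml le_max lexx/= ge_max ge_min lexx/= andbT.
by rewrite -subr_ge0 opprK addr_ge0.
Qed.

Let brv_direction t i j : brv (fun w => direction i j (U t w)).
Proof.
split; first by apply: direction_measurable => k; exact: mU.
by exists 1 => w; exact: direction_le1.
Qed.

Let brv_rayleigh t : brv (fun w => qform (clipped_gain t w) (U t w) / qform 1%:M (U t w)).
Proof.
under eq_fun do rewrite rayleighE.
by apply: brv_sum => i; apply: brv_sum => j; exact: brvM.
Qed.

Let brv_tr t : brv (fun w => \tr (clipped_gain t w)).
Proof. by apply: brv_sum => i; exact: brv_clipped. Qed.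

(** The update removes on average the trace of the gain divided by d, which is at least
    gamma times the potential of the inflated matrix. *)
Lemma mean_delta_step t :
  mean P (delta t.+1) <= (1 - gamma) * ((1 + step_bound t) ^+ 2 *
     (mean P (delta t) + 2 * d%:R * tc * step_bound t)).
Proof.
have dR : 0 < d%:R :> R by rewrite ltr0n.
apply: (@le_trans _ _ (mean P (fun w => delta_scaled t w -
    qform (clipped_gain t w) (U t w) / qform 1%:M (U t w)))).
  apply: ae_le_mean => //; first exact: brvB.
  apply: filterS (ae_good t) => w gw; rewrite clipped_gainE// /delta xS GS.
  exact: (potential_update mu_gt0 L_gt0 d_gt0 _ (wcy t w) (Gs_pd t w) (@Gs_ge t w) gw).
rewrite meanB// mean_rayleigh//; [|exact: (draws t).1|]; last first.
  by move=> i j; apply: (past_indep draws); exact: (@info_clipped t i j).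
have h1 : gamma * mean P (delta_scaled t) <= mean P (fun w => \tr (clipped_gain t w)) / d%:R.
  rewrite [leRHS]mulrC -!meanZ//; apply: ae_le_mean; [exact: brvZ|exact: brvZ|].
  apply: filterS (ae_good t) => w gw; rewrite clipped_gainE// [leRHS]mulrC.
  exact: (gain_trace_ge mu_gt0 L_gt0 d_gt0 (wcy t w) (Gs_pd t w) (@Gs_ge t w) gw).
have h2 : mean P (delta_scaled t) <= (1 + step_bound t) ^+ 2 *
     (mean P (delta t) + 2 * d%:R * tc * step_bound t).
  have bb : brv (fun w => delta t w + 2 * d%:R * tc * step_bound t).
    by apply: brvD => //; exact: brv_cst.
  rewrite -[X in mean P (delta t) + X](mean_cst P) -meanD//; last exact: brv_cst.
  by rewrite -meanZ//; apply: le_mean => //; exact: brvZ.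
apply: (@le_trans _ _ ((1 - gamma) * mean P (delta_scaled t))); last first.
  by rewrite ler_wpM2l// subr_ge0.
by rewrite mulrBl mul1r lerD2l lerN2.
Qed.

(** * The two expectations and the linear phase *)
Let tau_nu : tau <= 1 - nu.
Proof. by rewrite lerD2l lerN2 ge_min lexx orbT. Qed.

Let nu_gt0 : 0 < nu.
Proof. by rewrite lt_min gamma_gt0 gap_gt0. Qed.

Let nu_le1 : nu <= 1.
Proof. by apply: le_trans gamma_le1; rewrite ge_min lexx. Qed.

Let gamma_nu : 1 - gamma <= 1 - nu.
Proof. by rewrite lerD2l lerN2 ge_min lexx. Qed.

Let nuX_ge0 t : 0 <= (1 - nu) ^+ t.
Proof. by rewrite exprn_ge0// subr_ge0. Qed.

Let C1_gt0 : 0 < C1. Proof. exact: lt_le_trans Crad_le_C1. Qed.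

Let tc_ge0 : 0 <= tc.
Proof. by rewrite /tc; case: (o) => //=; rewrite divr_ge0 ?exprn_ge0// ltW. Qed.

Let extra_ge0 : 0 <= 8 * tc * d%:R * (L * L2) / (s * mu ^+ 3).
Proof.
apply: divr_ge0; last by rewrite mulr_ge0 ?exprn_ge0// ltW.
by apply: mulr_ge0; [apply: mulr_ge0 => //; exact: mulr_ge0|rewrite mulr_ge0// ltW].
Qed.

Let C1_le_C2 : C1 <= C2.
Proof. by apply: le_trans C2_ge; rewrite lerDl. Qed.

Let extra_le_C2 : 8 * tc * d%:R * (L * L2) / (s * mu ^+ 3) <= C2.
Proof. by apply: le_trans C2_ge; rewrite lerDr ltW. Qed.

Let slack_ge0 : 0 <= slack.
Proof.
by apply: le_trans lam0_C2; apply: mulr_ge0; [apply: le_trans C1_le_C2; exact: ltW|].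
Qed.

Let tauX_ge0 t : 0 <= tau ^+ t. Proof. exact/exprn_ge0/tau_ge0. Qed.

Let tauX_nu t : tau ^+ t <= (1 - nu) ^+ t.
Proof. by rewrite lerXn2r ?nnegrE ?tau_ge0// subr_ge0. Qed.

Let C1_lam0_le t : C1 * (tau ^+ t * lam x0) <= (1 - nu) ^+ t * slack.
Proof.
rewrite mulrCA; apply: ler_pM => //; first by rewrite mulr_ge0// ltW.
by apply: le_trans lam0_C2; rewrite ler_wpM2r.
Qed.

Let drift_le t : 2 * d%:R * tc * step_bound t <= (1 - nu) ^+ t * slack.
Proof.
apply: (@le_trans _ _ (tau ^+ t * slack)); last by rewrite ler_wpM2r.
have -> : 2 * d%:R * tc * step_bound t =
    tau ^+ t * (8 * tc * d%:R * (L * L2) / (s * mu ^+ 3) * lam x0).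
  by rewrite /step_bound ME; field; rewrite (gt_eqF s_gt0) (gt_eqF mu_gt0).
by rewrite ler_wpM2l// (le_trans _ lam0_C2)// ler_wpM2r.
Qed.

Let delta0_ge0 : 0 <= delta0.
Proof.
apply: (potential_ge0 mu_gt0 L_gt0 o) => //; split; first exact: gn_hess_sym.
  by move=> v; exact: hess_ge.
by move=> v; exact: gn_hess_le.
Qed.

Let slackS t : delta0 + t.+1%:R * slack = delta0 + t%:R * slack + slack.
Proof. by rewrite -natr1 mulrDl mul1r addrA. Qed.

Let regroup (a b g z : R) k : a * (b * (g * (a ^+ k * z))) = b * g * (a ^+ k.+1 * z).
Proof. by rewrite exprS; ring. Qed.

(** Solving the recursion: every step contracts by 1 - nu, up to the inflation
    (1 + M r_t)^2, whose product stays below exp(1/10), and adds a geometric drift. *)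
Lemma mean_delta_le t :
  mean P (delta t) <= growth t * ((1 - nu) ^+ t * (delta0 + t%:R * slack)).
Proof.
elim: t => [|t IH].
  rewrite expr0 mul1r mul0r addr0 (_ : delta 0 = cst delta0)// mean_cst ler_peMl//.
  exact: growth_ge1.
apply: (le_trans (mean_delta_step t)).
have m0 := step_bound_ge0 t.
have b0 : 0 <= delta0 + t%:R * slack by rewrite addr_ge0// mulr_ge0.
have g0 : 0 <= growth t by apply: le_trans (growth_ge1 t).
apply: (@le_trans _ _ ((1 - nu) * ((1 + step_bound t) ^+ 2 *
   (growth t * ((1 - nu) ^+ t * (delta0 + t.+1%:R * slack)))))).
  apply: ler_pM => //.
  - by rewrite subr_ge0.
  - apply: mulr_ge0; first by rewrite exprn_ge0// addr_ge0.
    apply: addr_ge0; first exact: mean_ge0 (brv_delta t) (delta_ge0 t).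
    by apply: mulr_ge0 => //; apply: mulr_ge0 => //; exact: mulr_ge0.
  rewrite ler_wpM2l ?exprn_ge0 ?addr_ge0//.
  rewrite slackS [(1 - nu) ^+ t * _]mulrDr [growth t * _]mulrDr; apply: lerD => //.
  apply: (le_trans (drift_le t)); rewrite ler_peMl ?growth_ge1//; exact: mulr_ge0.
rewrite regroup.
rewrite ler_wpM2r ?growthS//.
by rewrite mulr_ge0// addr_ge0// mulr_ge0.
Qed.

Let q : R := expR (1 / 5) * (delta0 + slack).

Let q_ge0 : 0 <= q. Proof. by rewrite mulr_ge0 ?expR_ge0 ?addr_ge0. Qed.

(** Bounds eta_t - 1, because the potential does, and the excess of the ratio over kappa,
    because lam_step turns a Loewner factor 1 + delta into the rate kappa + delta. *)
Let Y t w : R := delta t w + C1 * (tau ^+ t * lam x0).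

Let brv_Y t : brv (Y t).
Proof. by apply: brvD; [exact: brv_delta|exact: brv_cst]. Qed.

Let mean_Y t : mean P (Y t) <= q * t.+1%:R * (1 - nu) ^+ t.
Proof.
rewrite meanD; [|exact: brv_delta|exact: brv_cst]; rewrite mean_cst.
have g1 : growth t <= expR (1 / 5).
  by apply: (le_trans (growth_le t)); rewrite ler_expR ler_pM2l// lef_pV2 ?posrE// ler_nat.
have ge1 : 1 <= expR (1 / 5 : R) by rewrite -expR0 ler_expR divr_ge0.
have b0 : 0 <= delta0 + t%:R * slack by rewrite addr_ge0// mulr_ge0.
apply: (@le_trans _ _ (expR (1 / 5) * ((1 - nu) ^+ t * (delta0 + t.+1%:R * slack)))).
  rewrite slackS [(1 - nu) ^+ t * _]mulrDr [expR _ * _]mulrDr; apply: lerD.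
    by apply: (le_trans (mean_delta_le t)); rewrite ler_wpM2r// mulr_ge0.
  by apply: (le_trans (C1_lam0_le t)); rewrite ler_peMl// mulr_ge0.
rewrite /q -!mulrA ler_wpM2l ?expR_ge0// mulrA [leRHS]mulrC ler_wpM2l//.
by rewrite mulrDl lerD ?ler_peMr ?ler1n// mulrC.
Qed.

Let Y_ge0 t w : 0 <= Y t w.
Proof. by rewrite addr_ge0 ?delta_ge0// mulr_ge0 ?mulr_ge0// ltW. Qed.

Let delta_le_Y t w : delta t w <= Y t w.
Proof. by rewrite lerDl mulr_ge0 ?mulr_ge0// ltW. Qed.

Let eta_facts t w : [/\ eta (gn_hess F (x t w)) (G t w) = (fine (eta (gn_hess F (x t w)) (G t w)))%:E,
  1 <= fine (eta (gn_hess F (x t w)) (G t w)) &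
  fine (eta (gn_hess F (x t w)) (G t w)) <= 1 + delta t w].
Proof.
have [xr GT HG GH _] := sound t w.
have [h1 h2 _ h4] := etaP d_gt0 (gn_hess_pd xr) GT HG GH; split => //.
apply: h4 => v; exact: (qform_le_potential mu_gt0 d_gt0 o v (wc t w) GT HG).
Qed.

Lemma expect_eta t : expect_le P (fun w => eta (gn_hess F (x t w)) (G t w) - 1)%E
  (q * t.+1%:R * (1 - nu) ^+ t).
Proof.
pose e w := fine (eta (gn_hess F (x t w)) (G t w)) - 1.
have eE : (fun w => eta (gn_hess F (x t w)) (G t w) - 1)%E = (fun w => (e w)%:E).
  by apply/funext => w; have [-> _ _] := eta_facts t w.
have me : measurable_fun [set: T] e.
  apply: measurable_funB; last exact: measurable_cst.
  refine (@measurable_eta _ _ _ _ (fun w => gn_hess F (x t w)) (G t) (eta0 * growth t) d_gt0 _ _ _ _ _ _).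
  - by move=> w; have [xr _ _ _ _] := sound t w; exact: gn_hess_pd.
  - by move=> w; have [_ GT _ _ _] := sound t w.
  - by move=> w; have [_ _ HG _ _] := sound t w.
  - by move=> w; have [_ _ _ GH _] := sound t w.
  - exact: (measurable_gn_hess F_diff (mx_x t)).
  - exact: mx_G.
have be : brv e.
  have [_ [K' dK]] := brv_delta t; split => //; exists K' => w.
  have [_ h1 h2] := eta_facts t w.
  have e0 : 0 <= e w by rewrite subr_ge0.
  have ed : e w <= delta t w by rewrite lerBlDl.
  rewrite (ger0_norm e0); apply: (le_trans ed); exact: (le_trans (ler_norm _) (dK w)).
rewrite eE; split; first exact/measurable_EFinP.
rewrite EFin_mean// lee_fin (le_trans _ (mean_Y t))//; apply: le_mean => // w.
by apply: le_trans (delta_le_Y t w); have [_ _ h2] := eta_facts t w; rewrite lerBlDl.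
Qed.

Let lamE t w : lambda_over F xs (x t w) = (lam (x t w))%:E.
Proof. by have [xr _ _ _ _] := sound t w; exact: lambda_overE. Qed.

Let lam_step t w : lam (x t.+1 w) <= (kappa + Y t w) * lam (x t w).
Proof.
have [xr GT HG GH ll] := sound t w; rewrite xS.
have dge := delta_ge0 t w.
have d1 : 1 <= 1 + delta t w by rewrite lerDl.
apply: (le_trans (sound_lam (sound t w) d1 _)).
  by move=> v; exact: (qform_le_potential mu_gt0 d_gt0 o v (wc t w) GT HG).
apply: ler_wpM2r; first exact: sqrtr_ge0.
rewrite /Y addrA lerD//; last by rewrite ler_pM2l.
have dp : 0 < 1 + delta t w by apply: lt_le_trans d1.
rewrite (_ : 1 - _ = (kappa + delta t w) / (1 + delta t w)); last by field; rewrite gt_eqF.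
by rewrite ler_pdivrMr// ler_peMr// addr_ge0.
Qed.

Lemma expect_ratio t :
  expect_le P (fun w => lambda_ratio (lambda_over F xs (x t.+1 w)) (lambda_over F xs (x t w)))
   (kappa + q * t.+1%:R * (1 - nu) ^+ t).
Proof.
pose e w := lam (x t.+1 w) / lam (x t w).
have eE : (fun w => lambda_ratio (lambda_over F xs (x t.+1 w)) (lambda_over F xs (x t w))) =
    (fun w => (e w)%:E).
  apply/funext => w; rewrite !lamE /lambda_ratio /e; case: eqP => // ->.
  by rewrite invr0 mulr0.
have ml k : measurable_fun [set: T] (fun w => lam (x k w)).
  apply/measurable_sqrt/measurable_qform; last first.
    by apply: mx_measurableB => //; exact: mx_measurable_cst.
  by apply: mx_measurableD; [exact: (measurable_gn_hess F_diff)|exact: mx_measurable_cst].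
have me : measurable_fun [set: T] e.
  by apply: measurable_funM => //; exact: measurable_funV.
have e0 w : 0 <= e w by rewrite divr_ge0 ?sqrtr_ge0.
have eY w : e w <= kappa + Y t w.
  have [l0|l0] := eqVneq (lam (x t w)) 0.
    by rewrite /e l0 invr0 mulr0 addr_ge0.
  by rewrite /e ler_pdivrMr ?lam_step// lt_def l0 sqrtr_ge0.
have bkY : brv (fun w => kappa + Y t w) by apply: brvD; [exact: brv_cst|].
have be : brv e.
  have [_ [K' YK]] := bkY; split => //; exists K' => w.
  by rewrite ger0_norm// (le_trans (eY w))// (le_trans _ (YK w))// ler_norm.
rewrite eE; split; first exact/measurable_EFinP.
rewrite EFin_mean// lee_fin.
apply: (le_trans (le_mean P be bkY eY)); rewrite meanD//; last exact: brv_cst.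
by rewrite mean_cst lerD2l.
Qed.

Let lam_x_le t w : lam (x t w) <= tau ^+ t * lam x0.
Proof. by have [_ _ _ _ ll] := sound t w. Qed.

Let markov_Y t : (P [set w | (1 - kappa) / 2 < Y t w]%R <=
  (2 * q / (1 - kappa) * (t.+1%:R * (1 - nu) ^+ t))%:E)%E.
Proof.
have [mY _] := brv_Y t.
set A := [set w | _].
have mA : measurable A.
  have -> : A = Y t @^-1` [set` `](1 - kappa) / 2, +oo[ ].
    by apply/seteqP; split => w /=; rewrite in_itv/= andbT.
  by rewrite -[_ @^-1` _]setTI; exact: mY.
have bA : brv (\1_A : T -> R).
  by split; [exact: measurable_indic|exists 1 => w; rewrite indicE; case: (_ \in _); rewrite ?normr1 ?normr0].
have -> : P A = (mean P (\1_A : T -> R))%:E.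
  by rewrite -EFin_mean// integral_indic// setIT.
rewrite lee_fin.
have h : (1 - kappa) / 2 * mean P (\1_A : T -> R) <= mean P (Y t).
  rewrite -meanZ//; apply: le_mean => //; first exact: brvZ.
  move=> w; rewrite indicE; case: (boolP (w \in A)) => wA; last by rewrite mulr0.
  by rewrite mulr1; move: wA; rewrite inE => /ltW.
have kp : 0 < (1 - kappa) / 2 by rewrite divr_gt0.
rewrite -(ler_pM2l kp) (le_trans h)// (le_trans (mean_Y t))//.
rewrite le_eqVlt; apply/orP; left; apply/eqP; field.
by rewrite gt_eqF.
Qed.

(** The inequality of Markov at every time after t0, and a union bound. *)
Let tail_prob (t0 : nat) (p : R) :
  2 * q / (1 - kappa) * ((1 - nu) ^+ t0 * (t0.+1%:R / nu + 1 / nu ^+ 2)) <= p ->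
  (P (\bigcup_k [set w | (1 - kappa) / 2 < Y (t0 + k)%N w]%R) <= p%:E)%E.
Proof.
move=> hp; set A := fun k => [set w | (1 - kappa) / 2 < Y (t0 + k)%N w]%R.
have mA k : measurable (A k).
  have [mY _] := brv_Y (t0 + k)%N.
  have -> : A k = Y (t0 + k)%N @^-1` [set` `](1 - kappa) / 2, +oo[ ].
    by apply/seteqP; split => w /=; rewrite in_itv/= andbT.
  by rewrite -[_ @^-1` _]setTI; exact: mY.
have mU' : measurable (\bigcup_k A k) by exact: bigcupT_measurable.
have sub := measure_sigma_subadditive P mA mU' (fun w h => h).
rewrite (le_trans sub)//.
apply: lime_le; first exact: is_cvg_nneseries.
near=> N.
rewrite (@le_trans _ _ (\sum_(0 <= k < N) (2 * q / (1 - kappa) * ((t0 + k).+1%:R * (1 - nu) ^+ (t0 + k)))%:E)%E)//.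
  by apply: lee_sum => k _; exact: markov_Y.
rewrite sumEFin lee_fin big_mkord -mulr_sumr (le_trans _ hp)//.
apply: ler_wpM2l; first by apply: divr_ge0; [exact: mulr_ge0|exact: ltW k1].
have -> : \sum_(k < N) ((t0 + k).+1%:R * (1 - nu) ^+ (t0 + k)) =
    (1 - nu) ^+ t0 * \sum_(k < N) ((t0.+1%:R + k%:R) * (1 - nu) ^+ k).
  rewrite mulr_sumr; apply: eq_bigr => k _.
  by rewrite -addSn natrD exprD; ring.
rewrite ler_wpM2l//.
apply: (le_trans (sum_arith_geom _ _ _ _)); rewrite ?subr_ge0 ?ltrBlDr ?ltrDl//.
rewrite (_ : 1 - (1 - nu) = nu); last by rewrite opprB addrC subrK.
rewrite lerD2l ler_pM2r ?invr_gt0 ?exprn_gt0//.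
by rewrite gerBl ltW.
Unshelve. all: by end_near. Qed.

(** Before t0 the worst rate tau applies; afterwards, outside an event of probability at
    most p, every ratio is at most kappa + (1 - kappa) / 2. *)
Lemma linear_phase (p : R) : 0 < p < 1 -> exists2 t0 : nat,
    t0%:R <= 13 * (ln (1 + q / (p * (1 - kappa) * nu ^+ 2)) / nu) &
  exists2 E : set T, measurable E /\ ((1 - p)%:E <= P E)%E &
  forall w, E w -> forall t,
    (lambda_over F xs (x (t0 + t)%N w) <=
      (((1 + kappa) / 2) ^+ t * tau ^+ t0)%:E * lambda_over F xs x0)%E.
Proof.
move=> /andP[p0 p1].
have Z0 : 0 <= q / (p * (1 - kappa) * nu ^+ 2).
  by rewrite divr_ge0// !mulr_ge0 ?exprn_ge0// ltW.
have [t0 t0le t0ge] := burn_in_length nu_gt0 nu_le1 Z0.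
exists t0; first exact: t0le.
pose A k := [set w | (1 - kappa) / 2 < Y (t0 + k)%N w]%R.
have mA k : measurable (A k).
  have [mY _] := brv_Y (t0 + k)%N.
  have -> : A k = Y (t0 + k)%N @^-1` [set` `](1 - kappa) / 2, +oo[ ].
    by apply/seteqP; split => w /=; rewrite in_itv/= andbT.
  by rewrite -[_ @^-1` _]setTI; exact: mY.
have mU' : measurable (\bigcup_k A k) by exact: bigcupT_measurable.
have PA : (P (\bigcup_k A k) <= p%:E)%E.
  apply: tail_prob; rewrite -(ler_pM2l (_ : 0 < 2 / p)) ?divr_gt0//.
  rewrite -[leRHS]mulrA mulVf ?gt_eqF// mulr1 (le_trans _ t0ge)//.
  rewrite le_eqVlt; apply/orP; left; apply/eqP; field.
  by rewrite !gt_eqF.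
exists (~` \bigcup_k A k).
  split; first exact: measurableC.
  rewrite probability_setC// EFinB leeB//.
move=> w nA t.
have step k : lam (x (t0 + k).+1 w) <= (1 + kappa) / 2 * lam (x (t0 + k)%N w).
  apply: (le_trans (lam_step _ w)); apply: ler_wpM2r; first exact: sqrtr_ge0.
  have : ~ A k w by move=> h; apply: nA; exists k.
  rewrite /A /= => /negP; rewrite -leNgt => h.
  rewrite (_ : (1 + kappa) / 2 = kappa + (1 - kappa) / 2); last by field.
  by rewrite lerD2l.
rewrite lamE (lambda_overE x0_rad) -EFinM lee_fin.
elim: t => [|t IH]; first by rewrite addn0 expr0 mul1r.
have half0 : 0 <= (1 + kappa) / 2 by rewrite divr_ge0// addr_ge0.
rewrite addnS (le_trans (step t))// exprS -!(mulrA ((1 + kappa) / 2)).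
exact: ler_wpM2l.
Qed.

Lemma rqgn_convergence :
  [/\ forall t, expect_le P (fun w => eta (gn_hess F (x t w)) (G t w) - 1)%E
        (q * t.+1%:R * (1 - nu) ^+ t),
      forall t, expect_le P
        (fun w => lambda_ratio (lambda_over F xs (x t.+1 w)) (lambda_over F xs (x t w)))
        (kappa + q * t.+1%:R * (1 - nu) ^+ t)
    & forall p : R, 0 < p < 1 -> exists2 t0 : nat,
        t0%:R <= 13 * (ln (1 + q / (p * (1 - kappa) * nu ^+ 2)) / nu) &
      exists2 E : set T, measurable E /\ ((1 - p)%:E <= P E)%E &
      forall w, E w -> forall t,
        (lambda_over F xs (x (t0 + t)%N w) <=
          (((1 + kappa) / 2) ^+ t * tau ^+ t0)%:E * lambda_over F xs x0)%E].
Proof. by split; [exact: expect_eta|exact: expect_ratio|exact: linear_phase]. Qed.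

End Expectation.

End Trajectory.

End GaussNewtonStep.

(** * The basin around the stationary point *)

Section Basin.
Context {R : realType} {n d : nat} (F : 'cV[R]_d -> 'cV[R]_n) (xs : 'cV[R]_d).
Implicit Types (y v : 'cV[R]_d).

(** With S the square root of H, v = S^-1 (S v) and |S v|^2 is the form H at v. *)
Lemma qform_le_preconditioned k (H Q : 'M[R]_k) (v : 'cV[R]_k) : pdmx H ->
  `|qform Q v| <= specnorm (invmx (sqrtmx H) *m Q *m invmx (sqrtmx H)) * qform H v.
Proof.
move=> Hp; have [[ST _] SS] := sqrtmxP (pd_psd Hp).
set S := sqrtmx H in ST SS *; set N := _ *m invmx S.
have Su : S \in unitmx.
  by have := pd_unitmx Hp; rewrite -SS unitmx_mul => /andP[].
have HE : qform H v = enorm (S *m v) ^+ 2.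
  by rewrite sqr_enorm -qform_congr ST mulmx1 SS.
have -> : qform Q v = bform 1%:M (S *m v) (N *m (S *m v)).
  rewrite /N bform_mulr mul1mx qformE bform_mull ST bform_mulr.
  by rewrite -!mulmxA mulVmx// mulmx1 mulKVmx.
apply: (le_trans (enorm_cauchy_schwarz _ _)); rewrite HE expr2 mulrCA.
by rewrite ler_wpM2l ?enorm_ge0// enorm_mulmx_le.
Qed.

Context (L L2 mus c : R).
Context (d_gt0 : (0 < d)%N) (L_gt0 : 0 < L) (L2_gt0 : 0 < L2) (mus_gt0 : 0 < mus) (c_gt1 : 1 < c).
Context (Jac_le : forall y, specnorm (Jac F y) <= L).
Context (Jac_lip : forall y z, specnorm (Jac F y - Jac F z) <= L2 * enorm (y - z)).
Context (sv : mus <= singular_value (Jac F xs) d).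

Let rad : R := (c - 1) * mus ^+ 2 / (4 * c * L * L2).

Lemma stationary_hess_ge v : mus ^+ 2 * qform 1%:M v <= qform (gn_hess F xs) v.
Proof. exact: singular_value_qform. Qed.

Lemma stationary_hess_pd : pdmx (gn_hess F xs).
Proof.
split=> [|v v0]; first exact: gn_hess_sym.
by apply: lt_le_trans (stationary_hess_ge v); rewrite mulr_gt0 ?exprn_gt0 ?qform1_gt0.
Qed.

Lemma sigma_min_le_Jac_bound : mus ^+ 2 <= L ^+ 2.
Proof.
pose v : 'cV[R]_d := delta_mx (Ordinal d_gt0) 0.
have v0 : 0 < qform 1%:M v.
  rewrite qform1_gt0; apply/eqP => /matrixP/(_ (Ordinal d_gt0) 0).
  by rewrite !mxE !eqxx => /eqP; rewrite oner_eq0.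
by rewrite -(ler_pM2r v0) (le_trans (stationary_hess_ge v))// gn_hess_le.
Qed.

Let drift y v : enorm (y - xs) <= rad ->
  2 * L * L2 * enorm (xs - y) * qform 1%:M v <= (c - 1) / (2 * c) * (mus ^+ 2 * qform 1%:M v).
Proof.
move=> yr; rewrite -[xs - y]opprB enormN mulrA ler_wpM2r ?qform1_ge0//.
have c0 : 0 < c by apply: lt_trans c_gt1.
have -> : (c - 1) / (2 * c) * mus ^+ 2 = 2 * L * L2 * rad.
  by rewrite /rad; field; rewrite !gt_eqF.
by rewrite ler_wpM2l// mulr_ge0 ?ltW// mulr_gt0.
Qed.

(** The Hessian loses at most half of its lowest eigenvalue across the basin. *)
Lemma basin_hess_ge y v : enorm (y - xs) <= rad ->
  (mus / Num.sqrt 2) ^+ 2 * qform 1%:M v <= qform (gn_hess F y) v.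
Proof.
move=> yr; have := gn_hess_lip Jac_le Jac_lip xs y v.
have := drift v yr; have := stationary_hess_ge v; have := qform1_ge0 v.
have -> : (mus / Num.sqrt 2) ^+ 2 = mus ^+ 2 / 2 by rewrite expr_div_n sqr_sqrtr.
have -> : (c - 1) / (2 * c) = 1 / 2 - 1 / 2 / c.
  by field; rewrite gt_eqF// (lt_trans _ c_gt1).
have ci : 0 < c^-1 by rewrite invr_gt0 (lt_trans _ c_gt1).
have m2 : 0 < mus ^+ 2 by rewrite exprn_gt0.
move: (qform 1%:M v) (qform _ v) (qform _ v) (mus ^+ 2) (c^-1) m2 ci => q a b m i m0 i0 q0 h1 h2 h3.
have := mulr_ge0 (ltW i0) (mulr_ge0 (ltW m0) q0).
lra.
Qed.

Let absorb_drift (k m e a b w : R) : 1 < w -> k * (2 * w) = w - 1 -> 0 <= k -> 0 <= a ->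
  m <= a -> e <= k * m -> a <= b + e -> a <= w * b.
Proof.
move=> w1 kE k0 a0 ma ek ab.
have h4 := ler_wpM2l k0 ma; have h5 : (1 - k) * a <= b by lra.
apply: (@le_trans _ _ (w * ((1 - k) * a))); last by rewrite ler_wpM2l//; lra.
by rewrite mulrA ler_peMl//; lra.
Qed.

(** The radius makes the drift at most (c - 1) / (2 c) times the Hessian at the stationary
    point, and 1 - (c - 1) / (2 c) >= 1 / c. *)
Lemma stationary_hess_le_basin y v : enorm (y - xs) <= rad ->
  qform (gn_hess F xs) v <= c * qform (gn_hess F y) v.
Proof.
move=> yr; have c0 : 0 < c by apply: lt_trans c_gt1.
apply: (absorb_drift c_gt1 _ _ _ (stationary_hess_ge v) (drift v yr)).
- by field; rewrite gt_eqF.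
- by rewrite divr_ge0 ?subr_ge0 ?mulr_ge0 ?(ltW c_gt1) ?(ltW c0).
- exact: (pd_psd stationary_hess_pd).2.
exact: gn_hess_lip.
Qed.

Let theta : R :=
  specnorm (invmx (sqrtmx (gn_hess F xs)) *m Qmx F xs *m invmx (sqrtmx (gn_hess F xs))).

Lemma qform_Q_le y v : enorm (y - xs) <= rad ->
  `|qform (Qmx F xs) v| <= c * theta * qform (gn_hess F y) v.
Proof.
move=> yr; apply: (le_trans (qform_le_preconditioned _ v stationary_hess_pd)).
rewrite -/theta [c * theta]mulrC -mulrA ler_wpM2l ?specnorm_ge0//.
exact: stationary_hess_le_basin.
Qed.

Lemma basin_tilde_ge y v : enorm (y - xs) <= rad ->
  (1 - c * theta) * qform (gn_hess F y) v <= qform (tilde_hess F xs y) v.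
Proof.
move=> /(qform_Q_le v); rewrite ler_norml => /andP[h _].
by rewrite /tilde_hess qformD mulrBl mul1r lerD2l.
Qed.

Lemma basin_tilde_le y v : enorm (y - xs) <= rad ->
  qform (tilde_hess F xs y) v <= (1 + c * theta) * qform (gn_hess F y) v.
Proof.
move=> /(qform_Q_le v); rewrite ler_norml => /andP[_ h].
by rewrite /tilde_hess qformD mulrDl mul1r lerD2l.
Qed.

End Basin.

(** * Convergence *)

Section Constants.
Context {R : realType}.
Implicit Types (L mu c k : R).

Lemma powR_three_halves (a : R) : 0 <= a -> a `^ (3 / 2) = Num.sqrt a ^+ 3.
Proof.
by move=> a0; rewrite mulrC powRrM powR_mulrn ?powR_ge0// powR12_sqrt.
Qed.

(** D contains L^3 L2, which is at least L L2 mus^2 = 2 L L2 mu^2. *)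
Lemma coupling_le_D (L L2 mu mus D f s : R) (a : R) : 0 < L -> 0 < L2 -> 0 < mu -> 0 < s ->
  mus ^+ 2 = 2 * mu ^+ 2 -> mus ^+ 2 <= L ^+ 2 -> 0 <= f ->
  D = L ^+ 3 * L2 + L * L2 ^+ 2 * f -> 0 <= a ->
  2 * a * (L * L2) / (s * mu ^+ 3) <= a * D / (s * mu ^+ 5).
Proof.
move=> L0 L20 mu0 s0 mE mL f0 DE a0.
have m3 : 0 < s * mu ^+ 3 by rewrite mulr_gt0 ?exprn_gt0.
have m5 : 0 < s * mu ^+ 5 by rewrite mulr_gt0 ?exprn_gt0.
have -> : 2 * a * (L * L2) / (s * mu ^+ 3) = a * (L * L2 * (2 * mu ^+ 2)) / (s * mu ^+ 5).
  by field; rewrite !gt_eqF.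
rewrite ler_pM2r ?invr_gt0// ler_wpM2l// -mE DE.
have -> : L ^+ 3 * L2 = L * L2 * L ^+ 2 by ring.
apply: (@le_trans _ _ (L * L2 * L ^+ 2)).
  by rewrite ler_wpM2l// mulr_ge0 ?(ltW L0) ?(ltW L20).
by rewrite lerDl mulr_ge0// mulr_ge0 ?exprn_ge0 ?(ltW L0) ?(ltW L20).
Qed.

End Constants.

Theorem theorem26 (R : realType) :
  exists2 K : R, 0 < K &
  forall (n d : nat) (F : 'cV[R]_d -> 'cV[R]_n) (L L2 mus rho c : R)
    (xs x0 : 'cV[R]_d) (G0 : 'M[R]_d) (o : qn_option)
    (disp : measure_display) (T : measurableType disp) (P : probability T R)
    (U : nat -> T -> 'cV[R]_d) (C : nat -> T -> 'M[R]_d),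
  let dR : R := d%:R in
  let mu := mus / Num.sqrt 2 in
  let M := 2 * L * L2 / mu ^+ 2 in
  let H := gn_hess F in
  let lambda := lambda_over F xs in
  let theta := specnorm (invmx (sqrtmx (H xs)) *m Qmx F xs
                           *m invmx (sqrtmx (H xs))) in
  let D := L ^+ 3 * L2 + L * L2 ^+ 2 * enorm (F xs) in
  let C1 := 2 * D / ((1 - c * theta) `^ (3 / 2) * mu ^+ 5)
    + (4 * (1 + c * theta) / (1 - c * theta) `^ (3 / 2) + 2 * c / (c - 1))
        * (L * L2 / mu ^+ 3)
    + 2 * Num.sqrt (1 + c * theta) * rho / ((1 - c * theta) * mu ^+ 3) in
  let gamma := match o with
    | BFGS => mu ^+ 2 / (dR * L ^+ 2) | FBFGS => dR^-1 | SR1 => dR^-1 end in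
  let tc := match o with
    | BFGS => 1 | FBFGS => 1 | SR1 => L ^+ 2 / mu ^+ 2 end in
  let delta0 := match o with
    | BFGS => \tr (invmx (H x0) *m (G0 - H x0))
    | FBFGS => \tr (invmx (H x0) *m (G0 - H x0))
    | SR1 => dR * L ^+ 2 * \tr (G0 - H x0) / (mu ^+ 2 * \tr (H x0)) end in
  let C2 := C1 + 4 * tc * dR * D / (Num.sqrt (1 - c * theta) * mu ^+ 5) in
  let eta0 := fine (eta (H x0) G0) in
  let nu := Num.min gamma ((1 - c * theta) / (2 * eta0)) in
  let q := expR (1 / 5) * (delta0 +
    (1 - gamma) * (1 - c * theta) / (10 * (2 - gamma) * eta0)) in
  let run t w := rqgn F M o x0 G0 (C ^~ w) (U ^~ w) t in
  let x t w := (run t w).1 in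
  let G t w := (run t w).2 in
  (0 < d)%N -> (d <= n)%N ->
  (forall i, twice_differentiable (component F i)) ->
  0 < L -> 0 < L2 ->
  (forall y, specnorm (Jac F y) <= L) ->
  (forall y z, specnorm (Jac F y - Jac F z) <= L2 * enorm (y - z)) ->
  0 < mus -> (Jac F xs)^T *m F xs = 0 ->
  mus <= singular_value (Jac F xs) d ->
  0 <= rho ->
  (forall y, enorm ((Jac F y)^T *m F y - (H xs + Qmx F xs) *m (y - xs))
             <= rho * enorm (y - xs) ^+ 2) ->
  theta < 1 ->
  enorm (x0 - xs) <= mus ^+ 2 / (4 * L * L2) ->
  pdmx G0 -> loewner (H x0) G0 ->
  gaussian_draws P U ->
  (o = FBFGS -> past_measurable U C /\
     {ae P, forall w, forall t,
        invmx (scaled_G F M (x t w) (G t w)) = (C t w)^T *m C t w}) ->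
  1 < c -> (c%:E < theta%:E^-1)%E ->
  enorm (x0 - xs) <= (c - 1) * mus ^+ 2 / (4 * c * L * L2) ->
  (lambda x0 <= ((1 - gamma) * (1 - c * theta)
                  / (10 * (2 - gamma) * eta0 * C2))%:E)%E ->
  [/\ forall t, expect_le P (fun w => eta (H (x t w)) (G t w) - 1)%E
                  (q * t.+1%:R * (1 - nu) ^+ t),
      forall t, expect_le P
                  (fun w => lambda_ratio (lambda (x t.+1 w)) (lambda (x t w)))
                  (c * theta + q * t.+1%:R * (1 - nu) ^+ t)
    & forall p : R, 0 < p < 1 ->
      exists2 t0 : nat,
        t0%:R <= K * (ln (1 + q / (p * (1 - c * theta) * nu ^+ 2)) / nu)
      & exists2 E : set T, measurable E /\ ((1 - p)%:E <= P E)%E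
      & forall w, E w -> forall t,
          (lambda (x (t0 + t)%N w)
             <= (((1 + c * theta) / 2) ^+ t
                 * (1 - (1 - c * theta) / (2 * eta0)) ^+ t0)%:E * lambda x0)%E].
Proof.
exists 13 => // n d F L L2 mus rho c xs x0 G0 o disp T P U C.
move=> dR mu M H lambda theta D C1 gamma tc delta0 C2 eta0 nu q run x G.
move=> d_gt0 _ F_diff L_gt0 L2_gt0 Jac_le Jac_lip mus_gt0 _ sv rho_ge0 res theta_lt1 _.
move=> G0_pd HG0 draws factor c_gt1 c_theta x0_rad lam_le.
have c_gt0 : 0 < c by apply: lt_trans c_gt1.
have theta_ge0 : 0 <= theta := specnorm_ge0 _.
have kappa_ge0 : 0 <= c * theta by rewrite mulr_ge0// ltW.
have kappa_lt1 : c * theta < 1.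
  have [->|t0] := eqVneq theta 0; first by rewrite mulr0.
  have tp : 0 < theta by rewrite lt_def t0.
  by move: c_theta; rewrite inver (negbTE t0) lte_fin -[theta^-1]mul1r ltr_pdivlMr.
have mu_gt0 : 0 < mu by rewrite divr_gt0// sqrtr_gt0.
have musE : mus ^+ 2 = 2 * mu ^+ 2.
  by rewrite /mu expr_div_n sqr_sqrtr// mulrCA divff ?mulr1.
have musL := sigma_min_le_Jac_bound d_gt0 mus_gt0 Jac_le sv.
have muL : mu ^+ 2 <= L ^+ 2.
  by apply: le_trans musL; rewrite musE ler_peMl ?sqr_ge0// ler1n.
have hess_ge y v := basin_hess_ge d_gt0 L_gt0 L2_gt0 mus_gt0 c_gt1 Jac_le Jac_lip sv (y := y) v.
have tilde_ge y v := basin_tilde_ge d_gt0 L_gt0 L2_gt0 mus_gt0 c_gt1 Jac_le Jac_lip sv (y := y) v.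
have tilde_le y v := basin_tilde_le d_gt0 L_gt0 L2_gt0 mus_gt0 c_gt1 Jac_le Jac_lip sv (y := y) v.
(* Finiteness of lambda_over at x0 contains the symmetry of the approximate Hessian there,
   which spares a proof that second derivatives commute. *)
have Q_sym : (Qmx F xs)^T = Qmx F xs.
  move: lam_le; rewrite /lambda /lambda_over; case: asboolP => // -[hs _] _.
  by move: hs; rewrite /tilde_hess linearD/= gn_hess_sym => /addrI.
have H0_pd : pdmx (H x0).
  split=> [|v v0]; first exact: gn_hess_sym.
  by apply: lt_le_trans (hess_ge _ v x0_rad); rewrite mulr_gt0 ?exprn_gt0 ?qform1_gt0.
have H0_le v : qform (H x0) v <= qform G0 v := loewner_qform v HG0.
have G0_bound v : qform G0 v <= (1 + \tr (invmx (H x0) *m (G0 - H x0))) * qform (H x0) v.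
  by rewrite mulrDl mul1r -lerBlDl -qformB; exact: qform_le_trace_invmx.
have [_ eta0_ge1 G0_le _] := etaP d_gt0 H0_pd G0_pd.1 H0_le G0_bound.
rewrite -/eta0 in eta0_ge1 G0_le.
have eta0_gt0 : 0 < eta0 by apply: lt_le_trans eta0_ge1.
have dR_ge1 : 1 <= dR by rewrite ler1n.
have dR_gt0 : 0 < dR by apply: lt_le_trans dR_ge1.
have gamma_gt0 : 0 < gamma.
  by rewrite /gamma; case: (o); rewrite ?divr_gt0 ?mulr_gt0 ?invr_gt0 ?exprn_gt0.
have gamma_le1 : gamma <= 1.
  rewrite /gamma; case: (o); rewrite ?invf_le1//.
  rewrite ler_pdivrMr ?mul1r ?mulr_gt0 ?exprn_gt0// (le_trans muL)//.
  by rewrite ler_peMl ?sqr_ge0.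
have tc_ge0 : 0 <= tc by rewrite /tc; case: (o) => //; rewrite divr_ge0 ?sqr_ge0.
set s := Num.sqrt (1 - c * theta).
have s_gt0 : 0 < s by rewrite sqrtr_gt0 subr_gt0.
have s2 : s ^+ 2 = 1 - c * theta by rewrite sqr_sqrtr// subr_ge0 ltW.
pose Crad : R := 2 * c / (c - 1) * (L * L2 / mu ^+ 3).
have c1_gt0 : 0 < c - 1 by rewrite subr_gt0.
have Crad_gt0 : 0 < Crad by rewrite mulr_gt0 ?divr_gt0 ?mulr_gt0 ?exprn_gt0.
have Crad_rad : 1 <= Crad * ((c - 1) * mus ^+ 2 / (4 * c * L * L2)) * mu.
  rewrite le_eqVlt; apply/orP; left; apply/eqP; rewrite musE /Crad; field.
  by rewrite !gt_eqF.
have D_le (a b : R) : 0 <= a -> 0 < b ->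
    2 * a * (L * L2) / (b * mu ^+ 3) <= a * D / (b * mu ^+ 5).
  move=> a0 b0.
  exact: (coupling_le_D L_gt0 L2_gt0 mu_gt0 b0 musE musL (enorm_ge0 (F xs)) erefl a0).
(* The term of C1 with D covers the cost of measuring the error with the new matrix. *)
have C1_ge : 4 * (L * L2 / (s ^+ 3 * mu ^+ 3)) + 4 * (1 + c * theta) * (L * L2 / (s ^+ 3 * mu ^+ 3))
    + Crad + 2 * (Num.sqrt (1 + c * theta) * rho / (s ^+ 2 * mu ^+ 3)) <= C1.
  rewrite /C1 powR_three_halves ?subr_ge0 ?(ltW kappa_lt1)// -/s -s2.
  have := D_le 2 (s ^+ 3) (ler0n _ _) (exprn_gt0 _ s_gt0).
  rewrite (_ : 2 * 2 * (L * L2) / _ = 4 * (L * L2 / (s ^+ 3 * mu ^+ 3))); last first.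
    by field; rewrite !gt_eqF.
  move=> h; rewrite -!addrA; apply: lerD => //.
  rewrite le_eqVlt; apply/orP; left; apply/eqP; rewrite /Crad; field.
  by rewrite !gt_eqF.
have C2_ge : C1 + 8 * tc * d%:R * (L * L2) / (s * mu ^+ 3) <= C2.
  rewrite lerD2l -/s; have := D_le (4 * tc * dR) s.
  rewrite (_ : 2 * (4 * tc * dR) = 8 * tc * d%:R); last by rewrite /dR; ring.
  by apply; rewrite // !mulr_ge0// ltW.
have C1_gt0 : 0 < C1.
  have om_gt0 : 0 < L * L2 / (s ^+ 3 * mu ^+ 3).
    by apply: divr_gt0; apply: mulr_gt0 => //; exact: exprn_gt0.
  have rho_term : 0 <= Num.sqrt (1 + c * theta) * rho / (s ^+ 2 * mu ^+ 3).
    apply: divr_ge0; first by rewrite mulr_ge0 ?sqrtr_ge0.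
    by apply/ltW/mulr_gt0; exact: exprn_gt0.
  apply: lt_le_trans C1_ge; apply: ltr_wpDr; first exact: mulr_ge0.
  apply: ltr_wpDl Crad_gt0; apply: addr_ge0; first by rewrite mulr_ge0 ?(ltW om_gt0).
  by apply: mulr_ge0 (ltW om_gt0); rewrite mulr_ge0 ?addr_ge0.
have C1_le_C2 : C1 <= C2.
  apply: le_trans C2_ge; rewrite lerDl divr_ge0 ?mulr_ge0 ?exprn_ge0//; exact: ltW.
have C2_gt0 : 0 < C2 by apply: lt_le_trans C1_le_C2.
have lam0_ge0 : 0 <= lam F xs x0 by exact: sqrtr_ge0.
have lam0_C2 : C2 * lam F xs x0 <= (1 - gamma) * (1 - c * theta) / (10 * (2 - gamma) * eta0).
  move: lam_le; rewrite /lambda (lambda_overE mu_gt0 kappa_lt1 Q_sym hess_ge tilde_ge x0_rad).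
  by rewrite lee_fin invfM mulrA ler_pdivlMr// mulrC.
have lam0_small : C1 * lam F xs x0 <= (1 - c * theta) / (20 * eta0).
  apply: (@le_trans _ _ (C2 * lam F xs x0)); first by rewrite ler_wpM2r.
  apply: (le_trans lam0_C2).
  have g2 : 0 < 2 - gamma by rewrite subr_gt0 (le_lt_trans gamma_le1)// ltr1n.
  have e0 : 0 <= (1 - c * theta) / (20 * eta0).
    by rewrite divr_ge0 ?subr_ge0 ?mulr_ge0 ?(ltW kappa_lt1) ?(ltW eta0_gt0).
  rewrite (_ : _ / _ = (1 - c * theta) / (20 * eta0) * (2 * (1 - gamma) / (2 - gamma))); last first.
    by field; rewrite !gt_eqF.
  rewrite ler_piMr// ler_pdivrMr// mul1r mulrBr mulr1 lerD2l lerN2.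
  by rewrite ler_peMl ?ler1n// ltW.
exact: (rqgn_convergence L_gt0 L2_gt0 mu_gt0 rho_ge0 kappa_ge0 kappa_lt1 Jac_le Jac_lip Q_sym res
  hess_ge tilde_ge tilde_le Crad_gt0 Crad_rad C1_ge erefl x0_rad G0_pd.1 H0_le eta0_ge1 G0_le
  lam0_small F_diff d_gt0 draws factor gamma_gt0 gamma_le1 C2_ge lam0_C2).
Qed.
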